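(* Fix $\epsilon,K'>0$ and $C>0$. Let $\xi$ be a complex random variable with $\mathbb{E}\xi=0$, $\mathbb{E}|\xi|^2=1$ and $\mathbb{E}|\xi|^{4+\epsilon}\le C$. Let $\tilde X$ be an $n\times n$ periodic block band matrix with atom variable $\xi$ and bandwidth $b_n$, let $m=n/b_n$, $c_n=3b_n$, $X=\tilde X/\sqrt{c_n}$, and assume $b_n\ge m\ge m_0$ where $m_0$ is a sufficiently large constant. Then for any $z\in\mathbb{C}$ with $|z|\le K'$, $$\mathbb{P}\big(s_n(X-zI)\le c_n^{-25m}\big)\le \frac{C_\xi}{\sqrt{c_n}},$$ where $C_\xi$ is a constant depending only on $\epsilon$, $C$ and $K'$.
   Context: Periodic block band matrix: let $b_n\ge 1$ divide $n$ and $m:=n/b_n$. Let $\tilde D_1,\tilde U_1,\tilde T_1,\dots,\tilde D_m,\tilde U_m,\tilde T_m$ be $3m$ independent $b_n\times b_n$ random matrices, each with iid entries distributed as $\xi$. $\tilde X$ is the $m\times m$ block matrix (blocks $b_n\times b_n$, block indices modulo $m$) with $(i,i)$ block $\tilde D_i$, $(i,i-1)$ block $\tilde T_{i-1}$, $(i,i+1)$ block $\tilde U_{i+1}$, all other blocks zero. For an $n\times n$ matrix $A$, $s_1(A)\ge\dots\ge s_n(A)\ge0$ are its singular values. *)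

(* Defs.v *)
From HB Require Import structures.
From mathcomp Require Import all_boot all_order all_algebra.
From mathcomp Require Import all_classical all_reals all_analysis.
From mathcomp Require Import complex.

Set Implicit Arguments.
Unset Strict Implicit.
Unset Printing Implicit Defensive.

Import Order.TTheory GRing.Theory Num.Theory.
Local Open Scope classical_set_scope.
Local Open Scope ring_scope.

Definition conjT (R : rcfType) (n : nat) (A : 'M[R[i]]_n) : 'M[R[i]]_n :=
  (map_mx (@conjc R) A)^T.

Definition eigenvalues (R : rcfType) (n : nat) (A : 'M[R[i]]_n) : seq R[i] :=
  sval (closed_field_poly_normal (char_poly A)).

Definition singular_values (R : rcfType) (n : nat) (A : 'M[R[i]]_n) : seq R :=
  sort (fun x y : R => y <= x)
    [seq Num.sqrt (complex.Re l) | l <- eigenvalues (conjT A *m A)].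

(* s_k(A), 1 <= k <= n *)
Definition sing_val (R : rcfType) (n : nat) (A : 'M[R[i]]_n) (k : nat) : R :=
  nth 0 (singular_values A) k.-1.

(* Indices of 'I_(m*b) are written p = i*b + r with i < m (block       *)
(* index) and r < b (index inside the block).                          *)
(* The 3m blocks are indexed by ('I_3 * 'I_m): label 0 = D, 1 = U,     *)
(* 2 = T, i.e. (0,j) is D_j, (1,j) is U_j, (2,j) is T_j.               *)

Local Open Scope nat_scope.
Lemma blk_q_lt (m b : nat) (p : 'I_(m * b)) : (p %/ b < m)%N.
Proof.
have hp := ltn_ord p.
have hb : 0 < b by move: (leq_ltn_trans (leq0n p) hp); rewrite muln_gt0 => /andP[].
by rewrite ltn_divLR.
Qed.

Lemma blk_r_lt (m b : nat) (p : 'I_(m * b)) : (p %% b < b)%N.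
Proof.
have hp := ltn_ord p.
have hb : 0 < b by move: (leq_ltn_trans (leq0n p) hp); rewrite muln_gt0 => /andP[].
by rewrite ltn_mod.
Qed.

Local Close Scope nat_scope.
Definition blkq (m b : nat) (p : 'I_(m * b)) : 'I_m := Ordinal (blk_q_lt p).
Definition blkr (m b : nat) (p : 'I_(m * b)) : 'I_b := Ordinal (blk_r_lt p).

Definition block_band (R : pzRingType) (m b : nat) (B : 'I_3 -> 'I_m -> 'M[R]_b)
  : 'M[R]_(m * b) :=
  \matrix_(p, q)
    let i := blkq p in let r := blkr p in
    let j := blkq q in let s := blkr q in
    if (j : nat) == i then B 0%R j r s
    else if (j.+1 %% m == i)%N then B 2%R j r s
    else if ((j : nat) == i.+1 %% m)%N then B 1%R j r s
    else 0.

(* Probabilistic setting.  A complex random variable is given by its   *)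
(* real and imaginary parts; its law is the law of the pair in R * R.  *)

Definition cpair (d : measure_display) (T : measurableType d) (R : realType)
  (I : Type) (xr xi : I -> T -> R) (k : I) : T -> R * R :=
  fun w => (xr k w, xi k w).

Definition mutually_independent (d : measure_display) (T : measurableType d)
  (R : realType) (P : probability T R) (I : finType) (Y : I -> T -> R * R) : Prop :=
  forall A : I -> set (R * R), (forall k, measurable (A k)) ->
    P (\bigcap_(k in [set: I]) (Y k @^-1` A k)) =
    (\prod_(k : I) P (Y k @^-1` A k))%E.

Definition identically_distributed (d : measure_display) (T : measurableType d)
  (R : realType) (P : probability T R) (I : Type) (Y : I -> T -> R * R) : Prop :=
  forall k l (A : set (R * R)), measurable A ->
    P (Y k @^-1` A) = P (Y l @^-1` A).

Definition pbb_matrix (d : measure_display) (T : measurableType d) (R : realType)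
  (m b : nat) (xr xi : 'I_3 * 'I_m * 'I_b * 'I_b -> T -> R) (w : T)
  : 'M[R[i]]_(m * b) :=
  block_band (fun t j => \matrix_(r, s) ((xr (t, j, r, s) w) +i* (xi (t, j, r, s) w))%C).

(* Main.v *)
(** Discretizing the atom turns the entries into a point of a finite product space, at the price
    of an error far below c_n^(-24m) and of an overflow event of probability O(1/b).  If
    s_n(X - zI) <= c_n^(-25m), the shifted band matrix A has a vector v with maximal coordinate 1
    and |Av| <= tau = c_n^(-24m).

    Remove from the cyclic band a block column j and its two neighbours.  The rest is an arc, a
    band matrix with two more block rows than block columns, and except with
    probability O(b^(-1/2)) it is bounded below by Q^(-m), where Q is a fixed power of b.  Hence v
    has a large coordinate on the three blocks next to j, and since small-ball nets show that block
    rows do not annihilate sparse vectors, it has at least b/144 coordinates that are not small.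
    Averaging over the columns of these three blocks reduces the claim to: a given column is close
    to the span of the others with probability O(b^(-1/2)).  A unit left null vector of the other
    columns is spread out in the same way (the transpose is again a band), so this is the
    Littlewood-Offord estimate.  Kleitman's argument proves it for complex coefficients.

    An arc fails to be bounded below only if one of its bl < b^2 columns is close to the span of
    the others.  A union bound over the columns would cost b^2; instead the two extra block rows
    leave room for five left null vectors, each vanishing on a set of coordinates used by the
    previous ones, and these give five independent small-ball events of total probability
    O(b^(-5/2)) per column.  Propagating a null vector through the arc by substitution needs the
    square blocks to be bounded below outside few coordinates, which again holds by
    Littlewood-Offord with an exceptional set of controlled size. *)

Require Import Defs.
From HB Require Import structures.
From mathcomp Require Import all_boot all_order all_algebra.
From mathcomp Require Import all_classical all_reals all_analysis.
From mathcomp Require Import complex.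
From mathcomp Require Import all_boot all_order all_algebra.
From mathcomp Require Import ring lra zify.

Set Implicit Arguments.
Unset Strict Implicit.
Unset Printing Implicit Defensive.

Import Order.TTheory GRing.Theory Num.Theory.
Local Open Scope ring_scope.

(** * Finite product probability *)

(** The events met here quantify over all complex vectors. On a finite product every such event is
    admissible and conditioning is the resampling of some coordinates, so measurability matters only
    where the original space is met again. What shapes the arc is a dimension count: with [(l+2) b]
    rows against [l b] columns, a left null vector can be prescribed to vanish at [2b] coordinates.
    One [b] pays for the exceptional coordinates of the square blocks, the other for the coordinates
    used by up to four earlier null vectors. A square block fails to be bounded below with
    probability [O(b^(-1/2))]; this is too much for a union over the [2l] blocks, but it shows that
    at most [b/2] of them fail. If two exceptional coordinates are allowed, failure has probability
    [O(b^(-3/2))] and the union bound works. The exponent 24 arises since [Q] is at most [b^12] and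
    its power is lost twice in the last pairing, once in the near null vector and once in the left
    null vector. *)

Section FiniteProduct.
Variables (R : realType) (S I : finType) (mu : S -> R).
Hypothesis mu_ge0 : forall s, 0 <= mu s.
Hypothesis mu_sum1 : \sum_s mu s = 1.

Local Notation conf := {ffun I -> S}.

Definition weight (s : conf) : R := \prod_i mu (s i).

Definition ex (f : conf -> R) : R := \sum_s weight s * f s.

Definition pr (E : conf -> Prop) : R := ex (fun s => (`[< E s >])%:R).

(** Conditioning on the coordinates outside [J] means keeping [s] there and drawing a fresh [t] on
    [J]. That an event does not see [J] becomes the equation [A (resample J s t) = A s]. *)
Definition resample (J : {set I}) (s t : conf) : conf :=
  [ffun i => if i \in J then t i else s i].

Lemma weight_ge0 s : 0 <= weight s.
Proof. by apply: prodr_ge0. Qed.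

Lemma sum_weight : \sum_s weight s = 1.
Proof.
rewrite /weight -(bigA_distr_bigA (fun (_ : I) s => mu s)) /=.
by rewrite big1.
Qed.

Lemma ex_cst c : ex (fun=> c) = c.
Proof. by rewrite /ex -mulr_suml sum_weight mul1r. Qed.

Lemma ex_le f g : (forall s, f s <= g s) -> ex f <= ex g.
Proof. by move=> fg; apply: ler_sum => s _; rewrite ler_wpM2l ?weight_ge0. Qed.

Lemma ex_sum (K : finType) (A : {pred K}) (f : K -> conf -> R) :
  ex (fun s => \sum_(k in A) f k s) = \sum_(k in A) ex (f k).
Proof.
rewrite /ex exchange_big /=; apply: eq_bigr => s _.
by rewrite big_distrr.
Qed.

Lemma exZ c f : ex (fun s => c * f s) = c * ex f.
Proof. by rewrite /ex big_distrr; apply: eq_bigr => s _; rewrite mulrCA. Qed.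

Lemma eq_ex f g : f =1 g -> ex f = ex g.
Proof. by move=> fg; apply: eq_bigr => s _; rewrite fg. Qed.

Lemma pr_le E F : (forall s, E s -> F s) -> pr E <= pr F.
Proof.
move=> EF; apply: ex_le => s; rewrite ler_nat.
by case: asboolP => // /EF Fs; rewrite asboolT.
Qed.

Lemma pr_le1 E : pr E <= 1.
Proof. by rewrite -[leRHS](ex_cst 1); apply: ex_le => s; case: (`[< _ >]). Qed.

Lemma pr_or E F : pr (fun s => E s \/ F s) <= pr E + pr F.
Proof.
rewrite /pr /ex -big_split /=; apply: ler_sum => s _.
rewrite -mulrDr ler_wpM2l ?weight_ge0 //.
case: (asboolP (E s)) => [Es|nE]; case: (asboolP (F s)) => [Fs|nF].
- by rewrite asboolT /=; [lra|left].
- by rewrite asboolT /=; [lra|left].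
- by rewrite asboolT /=; [lra|right].
- by rewrite asboolF /=; [lra|case].
Qed.

Lemma pr_ex (K : finType) (A : {pred K}) (E : K -> conf -> Prop) :
  pr (fun s => exists2 k, k \in A & E k s) <= \sum_(k in A) pr (E k).
Proof.
rewrite /pr -ex_sum; apply: ex_le => s.
case: asboolP => [[k kA Ek]|_]; last by apply: sumr_ge0.
by rewrite (bigD1 k) //= asboolT // lerDl sumr_ge0.
Qed.

Lemma pr_exT (K : finType) (E : K -> conf -> Prop) :
  pr (fun s => exists k, E k s) <= \sum_k pr (E k).
Proof.
apply: le_trans (pr_ex predT E).
by apply: pr_le => s [k Ek]; exists k.
Qed.

Lemma markov_ex (f : conf -> R) c (E : conf -> Prop) :
  0 < c -> (forall s, 0 <= f s) -> (forall s, E s -> c <= f s) ->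
  pr E <= ex f / c.
Proof.
move=> c0 f0 Ef; rewrite ler_pdivlMr // mulrC -exZ; apply: ex_le => s.
by case: asboolP => [/Ef|_]; rewrite ?mulr1 ?mulr0.
Qed.

Lemma markov_count (K : finType) (A : {pred K}) (E : K -> conf -> Prop) (c : R) :
  0 < c ->
  pr (fun s => c <= \sum_(k in A) (`[< E k s >])%:R) <= (\sum_(k in A) pr (E k)) / c.
Proof.
move=> c0; rewrite /pr -ex_sum; apply: markov_ex => // s.
by apply: sumr_ge0.
Qed.

(* Exchanging the J-coordinates of two independent samples preserves their joint law. *)
Lemma ex_resample (J : {set I}) (f : conf -> R) :
  ex f = ex (fun s => ex (fun t => f (resample J s t))).
Proof.
pose sw (p : conf * conf) := (resample J p.1 p.2, resample J p.2 p.1).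
have swK : involutive sw.
  move=> [s t]; rewrite /sw /=; congr (_, _); apply/ffunP => i; rewrite !ffunE.
    by case: (i \in J).
  by case: (i \in J).
have -> : ex f = \sum_(p : conf * conf) weight p.1 * weight p.2 * f p.1.
  rewrite -(pair_big xpredT xpredT (fun s t => weight s * weight t * f s)) /=.
  apply: eq_bigr => s _; rewrite -mulr_suml; congr (_ * _).
  by rewrite -mulr_sumr sum_weight mulr1.
rewrite (reindex_inj (inv_inj swK)) /=.
rewrite -(pair_big xpredT xpredT
  (fun s t => weight (resample J s t) * weight (resample J t s) * f (resample J s t))) /=.
apply: eq_bigr => s _; rewrite /ex big_distrr /=; apply: eq_bigr => t _.
rewrite mulrA; congr (_ * _); rewrite /weight -!big_split /=.
apply: eq_bigr => i _; rewrite !ffunE; case: ifP => // _; exact: mulrC.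
Qed.

Lemma resample_notin (J : {set I}) (s t : conf) i : i \notin J -> resample J s t i = s i.
Proof. by rewrite ffunE => /negbTE ->. Qed.

Lemma resample_in (J : {set I}) (s t : conf) i : i \in J -> resample J s t i = t i.
Proof. by rewrite ffunE => ->. Qed.

(* The conditioning principle: given A, which does not see the coordinates in J,
   E has probability at most p over a fresh sample of these coordinates. *)
Lemma ex_cond (J : {set I}) (g : conf -> R) (E : conf -> Prop) p :
  (forall s, 0 <= g s) ->
  (forall s t, g (resample J s t) = g s) ->
  (forall s, g s != 0 -> pr (fun t => E (resample J s t)) <= p) ->
  ex (fun s => g s * (`[< E s >])%:R) <= p * ex g.
Proof.
move=> g0 gJ Ep; rewrite (ex_resample J) -exZ; apply: ex_le => s.
rewrite (@eq_ex _ (fun t => g s * (`[< E (resample J s t) >])%:R)); last first.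
  by move=> t; rewrite gJ.
rewrite exZ mulrC; have [->|gs] := eqVneq (g s) 0; first by rewrite !mulr0.
by rewrite ler_wpM2r // Ep.
Qed.

Lemma pr_cond (J : {set I}) (A E : conf -> Prop) p :
  (forall s t, A (resample J s t) = A s) ->
  (forall s, A s -> pr (fun t => E (resample J s t)) <= p) ->
  pr (fun s => A s /\ E s) <= p * pr A.
Proof.
move=> AJ Ep.
apply: le_trans (ex_cond (J := J) (g := fun s => (`[< A s >])%:R) (E := E) (p := p) _ _ _).
- by apply: ex_le => s; rewrite asbool_and -natrM mulnb.
- by move=> s; case: (`[< _ >]).
- by move=> s t; rewrite AJ.
- by move=> s; case: asboolP => [/Ep //|]; rewrite eqxx.
Qed.

Lemma pr_cond_le (J : {set I}) (A E : conf -> Prop) p :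
  0 <= p ->
  (forall s t, A (resample J s t) = A s) ->
  (forall s, A s -> pr (fun t => E (resample J s t)) <= p) ->
  pr (fun s => A s /\ E s) <= p.
Proof.
move=> p0 AJ Ep; apply: le_trans (pr_cond AJ Ep) _.
by rewrite ler_piMr // pr_le1.
Qed.

Lemma pr_cond0 (J : {set I}) (E : conf -> Prop) p :
  (forall s, pr (fun t => E (resample J s t)) <= p) -> pr E <= p.
Proof.
move=> Ep; rewrite /pr (ex_resample J) -[p]ex_cst; apply: ex_le => s.
exact: Ep.
Qed.

(** The dependence is triangular: event [j] ignores the sets [J i] with [i < j], but event [i] may
    see everything. Hence all later events can be conditioned upon while [J 0] is resampled, and the
    rest follows by induction. *)
Lemma pr_chain (n : nat) (J : nat -> {set I}) (E : nat -> conf -> Prop) p :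
  0 <= p ->
  (forall i, (i < n)%N -> forall s, pr (fun t => E i (resample (J i) s t)) <= p) ->
  (forall i j, (i < j < n)%N -> forall s t, E j (resample (J i) s t) = E j s) ->
  pr (fun s => forall i, (i < n)%N -> E i s) <= p ^+ n.
Proof.
move=> p0; elim: n J E => [|n IH] J E Ep EJ; first by rewrite expr0 pr_le1.
apply: (@le_trans _ _ (pr (fun s => (forall i, (i < n)%N -> E i.+1 s) /\ E 0%N s))).
  by apply: pr_le => s h; split=> [i im|]; apply: h.
apply: (@le_trans _ _ (p * pr (fun s => forall i, (i < n)%N -> E i.+1 s))).
  apply: (pr_cond (J := J 0%N)) => [s t|s _]; last exact: Ep.
  have Ei i : (i < n)%N -> E i.+1 (resample (J 0%N) s t) = E i.+1 s by move=> im; apply: EJ.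
  by apply/propext; split=> h i im; have := h i im; rewrite Ei.
rewrite exprS ler_wpM2l //; apply: (IH (fun i => J i.+1) (fun i => E i.+1)).
- by move=> i im s; apply: Ep.
- by move=> i j ij s t; apply: EJ.
Qed.

Lemma ex_one (i : I) (g : S -> R) : ex (fun s => g (s i)) = \sum_x mu x * g x.
Proof.
rewrite /ex.
pose F j x := mu x * (if j == i then g x else 1) : R.
transitivity (\sum_(f : conf) \prod_j F j (f j)).
  apply: eq_bigr => f _; rewrite /F big_split /=; congr (_ * _).
  by rewrite -big_mkcond /= big_pred1_eq.
rewrite -bigA_distr_bigA /= (bigD1 i) //= [X in _ * X]big1 ?mulr1.
  by apply: eq_bigr => x _; rewrite /F eqxx.
by move=> j /negbTE ji; rewrite -[RHS]mu_sum1; apply: eq_bigr => x _; rewrite /F ji mulr1.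
Qed.

End FiniteProduct.

(** * The real-valued modulus of complex numbers *)

Section Nrm.
Variable R : realType.
Implicit Types x y : R[i].

Definition nrm x : R := Normc.normc x.

Lemma nrmE x : nrm x = Num.sqrt (complex.Re x ^+ 2 + complex.Im x ^+ 2).
Proof. by case: x. Qed.

Lemma nrm_ge0 x : 0 <= nrm x.
Proof. by rewrite nrmE sqrtr_ge0. Qed.

Lemma nrm0 : nrm 0 = 0.
Proof. exact: Normc.normc0. Qed.

Lemma nrm1 : nrm 1 = 1.
Proof. exact: Normc.normc1. Qed.

Lemma nrmM x y : nrm (x * y) = nrm x * nrm y.
Proof. exact: Normc.normcM. Qed.

Lemma nrmV x : nrm x^-1 = (nrm x)^-1.
Proof. exact: Normc.normcV. Qed.

Lemma nrmN x : nrm (- x) = nrm x.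
Proof. exact: normcN. Qed.

Lemma nrmD x y : nrm (x + y) <= nrm x + nrm y.
Proof. exact: le_normcD. Qed.

Lemma nrmB x y : nrm (x - y) <= nrm x + nrm y.
Proof. by rewrite -(nrmN y) nrmD. Qed.

Lemma nrmBC x y : nrm (x - y) = nrm (y - x).
Proof. by rewrite -nrmN opprB. Qed.

Lemma nrm_tri x y : nrm x <= nrm (x - y) + nrm y.
Proof. by rewrite -{1}(subrK y x) nrmD. Qed.

Lemma nrm_eq0 x : (nrm x == 0) = (x == 0).
Proof. by apply/eqP/eqP => [/Normc.eq0_normc|->]; rewrite ?nrm0. Qed.

Lemma nrm_gt0 x : (0 < nrm x) = (x != 0).
Proof. by rewrite lt_def nrm_ge0 nrm_eq0 andbT. Qed.

Lemma nrm_real (a : R) : 0 <= a -> nrm a%:C%C = a.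
Proof. by move=> a0; rewrite nrmE /= expr0n addr0 sqrtr_sqr ger0_norm. Qed.

Lemma nrm_sum (K : finType) (P : pred K) (f : K -> R[i]) :
  nrm (\sum_(k | P k) f k) <= \sum_(k | P k) nrm (f k).
Proof.
elim/big_ind2: _ => [|x1 x2 y1 y2 h1 h2|//]; first by rewrite nrm0.
by apply: le_trans (nrmD _ _) _; apply: lerD.
Qed.

(** The inner product of the plane; Kleitman's argument uses it to select an extreme point in a
    given direction. *)
Definition rdot x y : R := complex.Re x * complex.Re y + complex.Im x * complex.Im y.

Lemma nrm_rdot x y : 0 <= rdot x y -> nrm y <= nrm (x + y).
Proof.
move=> xy; rewrite !nrmE ler_wsqrtr //; move: xy; case: x => a b; case: y => c d.
rewrite /rdot /= => h; have := sqr_ge0 a; have := sqr_ge0 b; nra.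
Qed.

Lemma rdotBl x y z : rdot (x - y) z = rdot x z - rdot y z.
Proof. by case: x => a b; case: y => c d; rewrite /rdot /=; ring. Qed.

End Nrm.

(** * Walks killed at 0 and central binomial coefficients *)

Section Walk.
Variable R : realType.

(** The number of paths with [j] steps of size 1, up or down, that start at [s] and stay positive.
    The argument [s] will be the size of a separated family, which one Kleitman step replaces by
    [s + 1] and [s - 1]. *)
Fixpoint walk (j s : nat) {struct j} : nat :=
  match j, s with
  | 0, s => (0 < s)%N : nat
  | j.+1, 0 => 0%N
  | j.+1, s.+1 => (walk j s.+2 + walk j s)%N
  end.

Let G j s := (\sum_(i < j.+1 | (j < 2 * i + s) && (2 * i <= j + s)) 'C(j, i))%N.

Let GE j s n : (j < n)%N ->
  G j s = (\sum_(i < n | (j < 2 * i + s) && (2 * i <= j + s)) 'C(j, i))%N.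
Proof.
move=> jn; rewrite /G (big_ord_widen_cond n (fun i => (j < 2 * i + s) && (2 * i <= j + s))%N
  (fun i => 'C(j, i))) //.
rewrite [in LHS]big_mkcond [in RHS]big_mkcond; apply: eq_bigr => i _.
have [h|h] := ltnP i j.+1; rewrite ?andbT // andbF.
by rewrite bin_small // if_same.
Qed.

(** The reflection principle: the paths staying positive are as many as those whose displacement
    [2i - j] lies above [-s] and is at most [s]. The induction is Pascal's rule, with all sums
    brought to a common range where the extra binomials are zero. *)
Lemma walk_binomial j s :
  walk j s = (\sum_(i < j.+1 | (j < 2 * i + s) && (2 * i <= j + s)) 'C(j, i))%N.
Proof.
rewrite -/(G j s).
elim: j s => [|j IH] s /=.
  rewrite /G big_mkcond big_ord_recl big_ord0 /= !muln0 !add0n addn0 /= andbT.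
  by case: (0 < s)%N.
case: s => [|s].
  by rewrite /G big1 // => i; rewrite !addn0; lia.
rewrite !IH (GE s.+2 (n := j.+2)) // (GE s (n := j.+2)) // /G.
rewrite [in RHS]big_mkcond [RHS]big_ord_recl /=.
rewrite (eq_bigr (fun i : 'I_j.+1 => 
   ((if (j.+1 < 2 * i.+1 + s.+1) && (2 * i.+1 <= j.+1 + s.+1) then 'C(j, i.+1) else 0)
   + (if (j.+1 < 2 * i.+1 + s.+1) && (2 * i.+1 <= j.+1 + s.+1) then 'C(j, i) else 0))%N));
  last by move=> i _; rewrite /bump leq0n add1n; case: ifP => // _; rewrite binS.
rewrite big_split /= addnA.
have -> : ((if (j.+1 < 2 * 0 + s.+1) && (2 * 0 <= j.+1 + s.+1) then 'C(j.+1, 0) else 0)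
   + \sum_(i < j.+1) (if (j.+1 < 2 * i.+1 + s.+1) && (2 * i.+1 <= j.+1 + s.+1)
     then 'C(j, i.+1) else 0) =
   \sum_(i < j.+2) (if (j.+1 < 2 * i + s.+1) && (2 * i <= j.+1 + s.+1)
     then 'C(j, i) else 0))%N.
  by rewrite [RHS]big_ord_recl /= !bin0.
have -> : (\sum_(i < j.+1) (if (j.+1 < 2 * i.+1 + s.+1) && (2 * i.+1 <= j.+1 + s.+1)
     then 'C(j, i) else 0) =
   \sum_(i < j.+2) (if (j.+1 < 2 * i.+1 + s.+1) && (2 * i.+1 <= j.+1 + s.+1)
     then 'C(j, i) else 0))%N.
  by rewrite [RHS]big_ord_recr /= bin_small // if_same addn0.
rewrite -big_split big_mkcond [X in (_ + X)%N]big_mkcond -big_split /=.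
apply: eq_bigr => i _.
have -> : (j < 2 * i + s.+2)%N = (j.+1 < 2 * i.+1 + s.+1)%N by lia.
have -> : (2 * i <= j + s)%N = (2 * i.+1 <= j.+1 + s.+1)%N by lia.
have -> : (2 * i <= j + s.+2)%N = (2 * i <= j.+1 + s.+1)%N by lia.
have -> : (j < 2 * i + s)%N = (j.+1 < 2 * i + s.+1)%N by lia.
have [a|a] := ltnP j.+1 (2 * i.+1 + s.+1); have [b|b] := leqP (2 * i.+1) (j.+1 + s.+1);
have [c|c] := ltnP j.+1 (2 * i + s.+1); have [d|d] := leqP (2 * i) (j.+1 + s.+1) => //=;
  rewrite ?addn0 //; lia.
Qed.

Lemma walk1 j : walk j 1 = 'C(j, uphalf j).
Proof.
rewrite walk_binomial.
have hj : (uphalf j < j.+1)%N by rewrite ltnS; lia.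
rewrite (bigD1 (Ordinal hj)) /=; last by lia.
rewrite big1 ?addn0 // => i /andP[h1 /eqP h2]; exfalso; apply: h2.
by apply: val_inj => /=; lia.
Qed.

(** Passing from [k] to [k + 1] multiplies the binomial by [2(2k+1)/(k+1)], and
    [(2k+1)(2k+3) <= (2k+2)^2]. *)
Lemma central_bin_bound k : ('C(k.*2, k) ^ 2 * k.*2.+1 <= 4 ^ k.*2)%N.
Proof.
elim: k => [//|k IH].
have e : (k.+1 * 'C(k.+1.*2, k.+1) = 2 * k.*2.+1 * 'C(k.*2, k))%N.
  have := mul_bin_diag k.*2.+2 k; rewrite /= => h.
  have h2 := mul_bin_left k.*2.+1 k.
  have h3 : (k.+1 * 'C(k.*2.+1, k.+1) = k.*2.+1 * 'C(k.*2, k))%N.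
    by rewrite -(mul_bin_diag k.*2.+1 k).
  have -> : k.+1.*2 = k.*2.+2 by lia.
  rewrite binS.
  have h4 : 'C(k.*2.+1, k.+1) = 'C(k.*2.+1, k).
    by rewrite -bin_sub; [congr 'C(_, _); lia|lia].
  by rewrite mulnDr -h4; lia.
rewrite -(leq_pmul2l (m := k.+1 ^ 2)) ?expn_gt0 //.
have -> : (k.+1 ^ 2 * ('C(k.+1.*2, k.+1) ^ 2 * k.+1.*2.+1) =
  (2 * k.*2.+1) ^ 2 * 'C(k.*2, k) ^ 2 * k.+1.*2.+1)%N by rewrite mulnA -!expnMn e.
have -> : (4 ^ k.+1.*2 = 16 * 4 ^ k.*2)%N.
  by rewrite (_ : k.+1.*2 = k.*2.+2) ?expnS; lia.
move: (4 ^ _)%N ('C(_, _) ^ 2)%N IH => x y; rewrite -!mul2n !expnS !expn0; nia.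
Qed.

Lemma walk1_bound j : (walk j 1 ^ 2 * j.+1 <= 4 ^ j)%N.
Proof.
rewrite walk1.
have [[k ->]|[k ->]] : (exists k, j = k.*2) \/ (exists k, j = k.*2.+1).
- by have := odd_double_half j; case: (odd j) => h; [right|left]; exists j./2; lia.
- by rewrite uphalf_double central_bin_bound.
have := central_bin_bound k.+1.
have e : 'C(k.+1.*2, k.+1) = (2 * 'C(k.*2.+1, k.+1))%N.
  rewrite (_ : k.+1.*2 = k.*2.+2) ?(binS k.*2.+1); last lia.
  rewrite mul2n -[RHS]addnn; congr addn.
  by rewrite -bin_sub; [congr 'C(_, _); lia|lia].
rewrite e (_ : uphalf k.*2.+1 = k.+1); last lia.
rewrite (_ : 4 ^ k.+1.*2 = 4 * 4 ^ k.*2.+1)%N; last by rewrite (_ : k.+1.*2 = k.*2.+2) ?expnS; lia.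
rewrite -!mul2n.
move: (4 ^ _)%N ('C(_, _)) => x y; rewrite !expnS !expn0; nia.
Qed.

End Walk.

(** * The Littlewood-Offord estimate *)

Section LazyWalk.
Variables (R : realType) (p : R).
Hypothesis p01 : 0 < p <= 1.

(** Survival probability of the walk that stays put with probability [1 - p]. A coordinate makes the
    walk move only when two independent copies of the atom are far apart, so [p] will be [psep]. *)
Fixpoint lazy_walk (N s : nat) {struct N} : R :=
  match N, s with
  | 0, s => (0 < s)%:R
  | N.+1, 0 => 0
  | N.+1, s.+1 => (1 - p) * lazy_walk N s.+1 + p / 2 * (lazy_walk N s.+2 + lazy_walk N s)
  end.

(* Mean of g under the binomial law with parameters N and p. *)
Fixpoint bmean (N : nat) (g : nat -> R) : R :=
  if N is N.+1 then (1 - p) * bmean N g + p * bmean N (fun j => g j.+1) else g 0%N.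

Lemma eq_bmean N g h : g =1 h -> bmean N g = bmean N h.
Proof.
by elim: N g h => [|N IH] g h gh //=; rewrite (IH _ _ gh) (IH (fun j => g j.+1) (fun j => h j.+1)).
Qed.

Lemma bmeanD N g h : bmean N (fun j => g j + h j) = bmean N g + bmean N h.
Proof. by elim: N g h => [|N IH] g h //=; rewrite !IH; ring. Qed.

Lemma bmeanZ N c g : bmean N (fun j => c * g j) = c * bmean N g.
Proof. by elim: N g => [|N IH] g //=; rewrite !IH; ring. Qed.

Lemma bmean_cst N c : bmean N (fun=> c) = c.
Proof. by elim: N => [|N IH] //=; rewrite IH; ring. Qed.

Lemma bmean_le N g h : (forall j, g j <= h j) -> bmean N g <= bmean N h.
Proof.
elim: N g h => [|N IH] g h gh //=; case/andP: p01 => p0 p1.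
by apply: lerD; rewrite ler_wpM2l ?subr_ge0 ?(ltW p0) // IH.
Qed.

(** Size biasing, from [j C(N+1,j) = (N+1) C(N,j-1)]. With [g j = 1/(j+1)] it yields [bmean_inv]. *)
Lemma bmean_size_bias N g :
  bmean N.+1 (fun j => j%:R * g j.-1) = N.+1%:R * p * bmean N g.
Proof.
elim: N g => [|N IH] g; first by rewrite /=; ring.
rewrite [LHS]/= -/(bmean N.+1 (fun j => j%:R * g j.-1)) IH.
have -> : (1 - p) * bmean N (fun j => j.+1%:R * g j) + p * bmean N (fun j => j.+2%:R * g j.+1)
  = bmean N.+1 (fun j => j%:R * g j.-1.+1) + bmean N.+1 g.
  rewrite -bmeanD /=; congr (_ * _ + _ * _); apply: eq_bmean => -[|j] /=.
  - ring.
  - rewrite -(natr1 j.+1); ring.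
  - rewrite -(natr1 1); ring.
  - rewrite -(natr1 j.+2); ring.
rewrite (IH (fun j => g j.+1)) /= -[in RHS](natr1 N.+1); ring.
Qed.

Lemma bmean_inv N : bmean N (fun j => j.+1%:R^-1) <= (N.+1%:R * p)^-1.
Proof.
case/andP: p01 => p0 p1.
rewrite -[leRHS]mulr1 ler_pdivlMl ?mulr_gt0 // -bmean_size_bias -[leRHS](bmean_cst N.+1).
apply: bmean_le => -[|j] /=; first by rewrite mul0r.
by rewrite divff ?pnatr_eq0.
Qed.

(** Conditioning on the number [j] of genuine steps. *)
Lemma lazy_walkE N s : lazy_walk N s = bmean N (fun j => (walk j s)%:R / 2 ^+ j).
Proof.
elim: N s => [|N IH] s /=; first by rewrite expr0 divr1.
case: s => [|s].
  rewrite (eq_bmean _ (h := fun=> 0)); last by case=> [|j]; rewrite mul0r.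
  rewrite (eq_bmean _ (g := (fun j => 0%N%:R / _)) (h := fun=> 0)); last by move=> j; rewrite mul0r.
  by rewrite !bmean_cst !mulr0 addr0.
rewrite !IH; congr (_ + _).
rewrite -mulrA; congr (_ * _); rewrite -bmeanD -bmeanZ.
by apply: eq_bmean => j; rewrite natrD exprS invfM; ring.
Qed.

Lemma lazy_walk1_bound N : lazy_walk N 1 <= (Num.sqrt (N.+1%:R * p))^-1.
Proof.
case/andP: p01 => p0 p1; rewrite lazy_walkE.
set l := Num.sqrt _.
have l0 : 0 < l by rewrite sqrtr_gt0 mulr_gt0.
have l2 : l ^+ 2 = N.+1%:R * p by rewrite sqr_sqrtr // mulr_ge0 // ltW.
(* The AM-GM bound [sqrt y <= l y / 2 + 1/(2 l)] makes the square root linear in [y = 1/(j+1)],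
   whose mean is controlled; this [l] balances the two terms. *)
apply: (@le_trans _ _ (bmean N (fun j => l / 2 * j.+1%:R^-1 + (2 * l)^-1))).
  apply: bmean_le => j.
  set x := _ / _.
  have x0 : 0 <= x by rewrite divr_ge0 // exprn_ge0.
  have hx : x ^+ 2 <= j.+1%:R^-1.
    rewrite -[leRHS]mul1r ler_pdivlMr // /x expr_div_n mulrAC ler_pdivrMr ?exprn_gt0 // mul1r.
    have := walk1_bound j; rewrite -(ler_nat R) natrM !natrX => h.
    by rewrite exprAC (_ : 2 ^+ 2 = 4%:R) //; rewrite expr2 -natrM.
  move: hx; set y := _^-1 => hx; rewrite invfM.
  have il0 : 0 < l^-1 by rewrite invr_gt0.
  have y0 : 0 <= y by apply: le_trans hx; apply: sqr_ge0.
  rewrite -(ler_pXn2r (n := 2)) ?nnegrE //; last by nra.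
  apply: le_trans hx _.
  have := sqr_ge0 (l / 2 * y - 2^-1 / l).
  have e : l * l^-1 = 1 by rewrite divff ?gt_eqF.
  have -> : (l / 2 * y - 2^-1 / l) ^+ 2 = (l / 2 * y + 2^-1 / l) ^+ 2 - (l * l^-1) * y by field; rewrite gt_eqF.
  rewrite e mul1r; lra.
rewrite bmeanD bmeanZ bmean_cst.
apply: (@le_trans _ _ (l / 2 * (N.+1%:R * p)^-1 + (2 * l)^-1)).
  by rewrite lerD2r ler_wpM2l ?bmean_inv // divr_ge0 // ltW.
rewrite -l2 le_eqVlt; apply/orP; left; apply/eqP; field; by rewrite gt_eqF.
Qed.

End LazyWalk.

Section Kleitman.
Variable R : realType.
Implicit Types (D : seq R[i]) (r : R).

Definition separated r D := pairwise (fun x y => r <= nrm (x - y)) D.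

Lemma separated_map r D x : separated r (map (fun y => y + x) D) = separated r D.
Proof.
rewrite /separated pairwise_map; apply: eq_pairwise => y z /=.
by rewrite (_ : y + x - (z + x) = y - z) //; ring.
Qed.

Lemma seq_argmax (T : eqType) (D : seq T) (f : T -> R) x0 :
  exists2 x, x \in x0 :: D & forall y, y \in x0 :: D -> f y <= f x.
Proof.
elim: D x0 => [|x1 D IH] x0.
  by exists x0; rewrite ?mem_head // => y; rewrite inE => /eqP ->.
have [x xD xmax] := IH x1.
have [fx|fx] := leP (f x0) (f x).
  exists x; first by rewrite inE xD orbT.
  by move=> y; rewrite inE => /orP[/eqP -> //|/xmax].
exists x0; first exact: mem_head.
move=> y; rewrite inE => /orP[/eqP -> //|/xmax h]; exact: (le_trans h (ltW fx)).
Qed.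

(* Kleitman's step: the farthest point of D in the direction w moves to D + w. *)
Lemma kleitman_step r D w (F : R[i] -> R) (b : nat -> R) :
  separated r D -> r <= nrm w -> (0 < size D)%N ->
  (forall D', separated r D' -> \sum_(d <- D') F d <= b (size D')) ->
  \sum_(d <- D) (F d + F (d + w)) <= b (size D).+1 + b (size D).-1.
Proof.
move=> sD rw D0 Fb.
have [x xD xmax] : exists2 x, x \in D & forall y, y \in D -> rdot y w <= rdot x w.
  by case: (D) D0 => // x0 D1 _; apply: seq_argmax.
have far y : y \in D -> r <= nrm (x + w - y).
  move=> yD; rewrite addrAC; apply: le_trans rw (nrm_rdot _).
  by rewrite rdotBl subr_ge0 xmax.
have sD1 : separated r ((x + w) :: D).
  by rewrite /separated pairwise_cons; apply/andP; split => //; apply/allP => y /far.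
have := Fb _ sD1; rewrite big_cons /=.
case/splitPr: D / xD sD {D0 xmax far sD1} => D1 D2.
rewrite /separated pairwise_cat pairwise_cons => /and3P[s12 s1 /andP[_ s2]] h1.
have sD2 : separated r (map (fun y => y + w) (D1 ++ D2)).
  rewrite separated_map /separated pairwise_cat s1 s2 !andbT.
  by apply/allrelP => y z yD1 zD2; move/allrelP: s12; apply=> //; rewrite inE zD2 orbT.
have := Fb _ sD2; rewrite big_map size_map.
move: h1; rewrite !big_cat !big_cons !size_cat /= addnS /= !big_split /=; lra.
Qed.

Lemma separated_sum_le1 r D (P : pred R[i]) :
  separated r D -> (forall x y, P x -> P y -> nrm (x - y) < r) ->
  \sum_(d <- D) (P d)%:R <= (0 < size D)%:R :> R.
Proof.
move=> sD Pr; elim: D sD => [|x D IH]; first by rewrite big_nil.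
rewrite /separated pairwise_cons => /andP[/allP far /IH {}IH]; rewrite big_cons /=.
have [Px|_] := boolP (P x); last by rewrite add0r (le_trans IH) // ler_nat; case: size.
rewrite big1_seq ?addr0 // => y /= yD.
by case: (boolP (P y)) => // Py; have := far _ yD; rewrite leNgt Pr.
Qed.

End Kleitman.

Section LittlewoodOfford.
Variables (R : realType) (S : finType) (mu : S -> R) (val : S -> R[i]) (c0 c1 : R).
Hypothesis mu_ge0 : forall s, 0 <= mu s.
Hypothesis mu_sum1 : \sum_s mu s = 1.
Hypothesis c0_gt0 : 0 < c0.
Hypothesis c1_gt0 : 0 < c1.
Hypothesis spread : forall z : R[i], \sum_s mu s * (nrm (val s - z) < c0)%R%:R <= 1 - c1.

Definition psep : R := \sum_s \sum_t mu s * mu t * (c0 <= nrm (val s - val t))%R%:R.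

(** Freeze the second copy and apply [spread] with centre [val t]. *)
Lemma psep_ge : c1 <= psep.
Proof.
rewrite /psep exchange_big /= -[leLHS]mul1r -[X in X * c1]mu_sum1 mulr_suml; apply: ler_sum => t _.
rewrite (eq_bigr (fun s => mu t * (mu s - mu s * (nrm (val s - val t) < c0)%R%:R))).
  rewrite -mulr_sumr ler_wpM2l // sumrB mu_sum1; have := spread (val t); lra.
by move=> s _; rewrite leNgt; case: (_ < _); rewrite /= ?mulr1n ?mulr0n; ring.
Qed.

Lemma psep_le1 : psep <= 1.
Proof.
rewrite /psep -[leRHS]mul1r -[X in _ <= X * _]mu_sum1 mulr_suml; apply: ler_sum => s _.
rewrite mulr1 -[leRHS]mulr1 -[in leRHS]mu_sum1 mulr_sumr; apply: ler_sum => t _.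
by rewrite ler_piMr ?mulr_ge0 // lern1; case: (_ <= _).
Qed.

Lemma psep01 : 0 < psep <= 1.
Proof. by rewrite psep_le1 (lt_le_trans c1_gt0 psep_ge). Qed.

Variable I : finType.
Local Notation Pr := (@pr R S I mu).

Definition lin (v : I -> R[i]) (s : {ffun I -> S}) : R[i] := \sum_i v i * val (s i).

Lemma pr_split_coord k (v : I -> R[i]) (E : R[i] -> Prop) :
  Pr (fun s => E (lin v s)) =
  \sum_x mu x * Pr (fun s => E (v k * val x + lin (fun i => if i == k then 0 else v i) s)).
Proof.
rewrite /pr (ex_resample mu_sum1 [set k]).
pose g s x := (`[< E (v k * val x + lin (fun i => if i == k then 0 else v i) s) >])%:R : R.
rewrite (@eq_ex _ _ _ _ _ (fun s => \sum_x mu x * g s x)); last first.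
  move=> s; rewrite -(ex_one mu_sum1 k); apply: eq_ex => t; congr (`[< E _ >]%:R).
  rewrite /lin (bigD1 k) //= [in RHS](bigD1 k) //= eqxx mul0r add0r resample_in ?set11 //.
  congr (_ + _); apply: eq_bigr => i /negbTE ik; rewrite ik resample_notin //.
  by rewrite in_set1 ik.
by rewrite ex_sum; apply: eq_bigr => x _; rewrite exZ.
Qed.

(** Induction on the coordinates in [ks]. The sum over the value of the new coordinate is
    symmetrized into a sum over pairs [(x, y)]. For a close pair each translate of [D] is handled by
    induction; for a far pair the two translates differ by some [w] of modulus at least [a c0], so
    [kleitman_step] applies. The result is the recursion of [lazy_walk]. *)
Lemma separated_concentration (a : R) (ks : seq I) (v : I -> R[i]) (D : seq R[i]) z :
  0 < a -> uniq ks -> (forall k, k \in ks -> a <= nrm (v k)) -> separated (a * c0) D ->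
  \sum_(d <- D) Pr (fun s => nrm (d + lin v s - z) < a * c0 / 2)
    <= lazy_walk psep (size ks) (size D).
Proof.
move=> a0; elim: ks v D => [|k ks IH] v D /=.
  (* No coordinate is left: a disc of radius [a c0 / 2] contains at most one point of a family
     separated by [a c0]. *)
  move=> _ _ sD.
  rewrite /pr /ex exchange_big /= -[leRHS](ex_cst I mu_sum1); apply: ler_sum => s _.
  rewrite -mulr_sumr ler_wpM2l ?weight_ge0 //.
  under eq_bigr do rewrite asboolb.
  apply: (separated_sum_le1 sD) => x y hx hy.
  have := nrmB (x + lin v s - z) (y + lin v s - z).
  rewrite (_ : x + _ - _ - _ = x - y); last by ring.
  move: hx hy; lra.
move=> /andP[kks uks] av sD.
set v' := fun i => if i == k then 0 else v i.
have av' j : j \in ks -> a <= nrm (v' j).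
  move=> jks; rewrite /v'; case: eqP => [e|_]; first by move: kks; rewrite -e jks.
  by apply: av; rewrite inE jks orbT.
pose F d := Pr (fun s => nrm (d + lin v' s - z) < a * c0 / 2).
have FIH D' : separated (a * c0) D' -> \sum_(d <- D') F d <= lazy_walk psep (size ks) (size D').
  by move=> sD'; apply: IH.
rewrite (eq_bigr (fun d => \sum_x mu x * F (d + v k * val x))); last first.
  move=> d _; rewrite (pr_split_coord k v (fun y => nrm (d + y - z) < a * c0 / 2)).
  apply: eq_bigr => x _; congr (_ * _); rewrite /F; congr Pr; apply: funext => s.
  by rewrite addrA.
case: (posnP (size D)) => [/size0nil ->|D0]; first by rewrite big_nil.
rewrite exchange_big /=.
under eq_bigr do rewrite -mulr_sumr.
set n := size ks in FIH *.
rewrite -[leRHS]/(lazy_walk psep n.+1 (size D)).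
have -> : lazy_walk psep n.+1 (size D) = (1 - psep) * lazy_walk psep n (size D)
    + psep / 2 * (lazy_walk psep n (size D).+1 + lazy_walk psep n (size D).-1).
  by case: (size D) D0.
pose T x := \sum_(d <- D) F (d + v k * val x).
have -> : \sum_x mu x * T x = \sum_x \sum_y mu x * mu y * ((T x + T y) / 2).
  have e : \sum_x \sum_y mu x * mu y * (T x / 2) = \sum_x mu x * T x / 2.
    apply: eq_bigr => x _; rewrite -[RHS]mulr1 -mu_sum1 mulr_sumr; apply: eq_bigr => y _.
    by rewrite -!mulrA; congr (_ * _); rewrite mulrC mulrA.
  transitivity (\sum_x \sum_y mu x * mu y * (T x / 2) + \sum_x \sum_y mu x * mu y * (T y / 2)).
    rewrite [X in _ + X]exchange_big /=.
    rewrite [X in _ + X](eq_bigr (fun x => \sum_y mu x * mu y * (T x / 2))); last first.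
      by move=> x _; apply: eq_bigr => y _; rewrite (mulrC (mu y)).
    by rewrite e -big_split /=; apply: eq_bigr => x _; lra.
  by rewrite -big_split; apply: eq_bigr => x _; rewrite -big_split; apply: eq_bigr => y _ /=; ring.
pose A := lazy_walk psep n (size D).
pose B := (lazy_walk psep n (size D).+1 + lazy_walk psep n (size D).-1) / 2.
(* As [psep] is the mass of the far pairs, the recursion is the mean over all pairs of [A] for a
   close pair and [B] for a far one. *)
rewrite [leRHS](_ : _ = \sum_x \sum_y mu x * mu y *
   (A + (c0 <= nrm (val x - val y))%R%:R * (B - A))); last first.
  under eq_bigr do under eq_bigr do rewrite mulrDr mulrA.
  under eq_bigr do rewrite big_split /= -!mulr_suml -mulr_sumr mu_sum1 mulr1.
  rewrite big_split /= -!mulr_suml mu_sum1 -/psep /A /B; ring.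
apply: ler_sum => x _; apply: ler_sum => y _; rewrite ler_wpM2l ?mulr_ge0 //.
have [far|near] := leP c0 (nrm (val x - val y)); rewrite /= ?mul1r ?mul0r; last first.
  have TA u : T u <= A.
    rewrite /T -(big_map (fun d => d + v k * val u) xpredT F).
    by have := FIH (map (fun d => d + v k * val u) D); rewrite separated_map size_map; apply.
  by have := TA x; have := TA y; lra.
rewrite addrCA subrr addr0 /B ler_pM2r ?invr_gt0 ?ltr0n // /T -big_split /=.
set w := v k * (val y - val x).
have wr : a * c0 <= nrm w.
  by rewrite nrmM (nrmBC (val y)) ler_pM ?(ltW a0) ?(ltW c0_gt0) //; apply: av; apply: mem_head.
pose D' := map (fun d => d + v k * val x) D.
have sD' : separated (a * c0) D' by rewrite separated_map.
have sz : size D' = size D by rewrite size_map.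
rewrite -sz in D0 *.
have := kleitman_step (b := lazy_walk psep n) sD' wr D0 FIH.
rewrite big_map; congr (_ <= _); apply: eq_bigr => d _; congr (_ + F _).
by rewrite /w; ring.
Qed.

Lemma littlewood_offord (a : R) (K : {set I}) (v : I -> R[i]) z :
  0 < a -> (forall k, k \in K -> a <= nrm (v k)) ->
  Pr (fun s => nrm (lin v s - z) < a * c0 / 2) <= (Num.sqrt (#|K|.+1%:R * c1))^-1.
Proof.
move=> a0 aK.
have aK' k : k \in enum K -> a <= nrm (v k) by rewrite mem_enum; apply: aK.
have := separated_concentration (D := [:: 0]) z a0 (enum_uniq K) aK' isT.
rewrite big_seq1 /= -cardE.
under [X in pr _ X]funext do rewrite add0r.
move=> /le_trans; apply; apply: (le_trans (lazy_walk1_bound psep01 _)).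
rewrite lef_pV2 ?posrE ?sqrtr_gt0 ?mulr_gt0 //; last by case/andP: psep01.
by rewrite ler_wsqrtr // ler_wpM2l // psep_ge.
Qed.

Lemma single_coord (k : I) (v : I -> R[i]) (th : R) z :
  th <= nrm (v k) * c0 -> 0 < nrm (v k) -> Pr (fun s => nrm (lin v s - z) < th) <= 1 - c1.
Proof.
move=> hth vk0; apply: (@pr_cond0 _ _ _ _ mu_ge0 mu_sum1 [set k]) => s.
set w := \sum_(i | i != k) v i * val (s i).
apply: le_trans (spread ((z - w) / v k)).
rewrite -(ex_one mu_sum1 k); apply: ex_le => // t; rewrite ler_nat.
case: asboolP => // h; rewrite lt0n eqb0 negbK.
rewrite -(ltr_pM2r vk0) -nrmM; move: h; rewrite /lin (bigD1 k) //= resample_in ?set11 //.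
rewrite (eq_bigr (fun i => v i * val (s i))); last first.
  by move=> i ik; rewrite resample_notin // in_set1.
have -> : (val (t k) - (z - w) / v k) * v k = v k * val (t k) + w - z.
  by rewrite mulrBl divfK -?nrm_gt0 // mulrC; ring.
by rewrite -/w [c0 * _]mulrC => h; apply: lt_le_trans hth.
Qed.

Variables (Cl : finType) (f : Cl -> I).
Hypothesis f_inj : injective f.

(** A form in the entries [f k] is a form in all coordinates of the space, with coefficients pushed
    forward along [f]; the concentration bounds are proved for the latter. *)
Lemma lin_push (x : Cl -> R[i]) (s : {ffun I -> S}) :
  \sum_k x k * val (s (f k)) = lin (fun i => \sum_(k | f k == i) x k) s.
Proof.
rewrite /lin; under [RHS]eq_bigr do rewrite mulr_suml.
rewrite (exchange_big_dep xpredT) //=; apply: eq_bigr => k _.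
by rewrite (big_pred1 (f k)) // => i; rewrite eq_sym.
Qed.

Lemma push_coef (x : Cl -> R[i]) k : \sum_(j | f j == f k) x j = x k.
Proof. by rewrite (eq_bigl (pred1 k)) ?big_pred1_eq // => j; rewrite (inj_eq f_inj). Qed.

Lemma littlewood_offord_inj (a : R) (K : {set Cl}) (x : Cl -> R[i]) z :
  0 < a -> (forall k, k \in K -> a <= nrm (x k)) ->
  Pr (fun s => nrm (\sum_k x k * val (s (f k)) - z) < a * c0 / 2)
    <= (Num.sqrt (#|K|.+1%:R * c1))^-1.
Proof.
move=> a0 aK; under [X in pr _ X]funext do rewrite lin_push.
rewrite -(card_imset _ f_inj); apply: littlewood_offord => // i /imsetP[k kK ->].
by rewrite push_coef aK.
Qed.

Lemma single_coord_inj (k : Cl) (x : Cl -> R[i]) (th : R) z :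
  th <= nrm (x k) * c0 -> 0 < nrm (x k) ->
  Pr (fun s => nrm (\sum_k x k * val (s (f k)) - z) < th) <= 1 - c1.
Proof.
move=> hth x0; under [X in pr _ X]funext do rewrite lin_push.
by apply: (@single_coord (f k)); rewrite push_coef.
Qed.

End LittlewoodOfford.

(** * Compressible vectors *)

Section Net.
Variables (R : realType) (Cl : finType) (M : nat) (rho : R).
Hypothesis rho_gt0 : 0 < rho.
Hypothesis rhoM : 1 <= rho * M%:R.

Definition grid : finType := ('I_(2 * M).+1 * 'I_(2 * M).+1)%type.

Definition gval (g : grid) : R[i] :=
  Complex (rho * (g.1%:R - M%:R)) (rho * (g.2%:R - M%:R)).

Lemma round_real (u : R) : `|u| <= 1 ->
  exists a : 'I_(2 * M).+1, `|u - rho * (a%:R - M%:R)| <= rho.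
Proof.
rewrite ler_norml => /andP[u1 u2].
have [t ut] : exists t, u = rho * (t - M%:R).
  by exists (u / rho + M%:R); rewrite addrK mulrC divfK // gt_eqF.
have h := rhoM.
have t0 : 0 <= t by rewrite -(pmulr_rge0 _ rho_gt0); lra.
have t1 : t <= (2 * M)%:R.
  by rewrite natrM -(ler_pM2l rho_gt0); move: ut; lra.
have /andP[at1 at2] := truncn_itv t0.
have aM : (Num.truncn t < (2 * M).+1)%N.
  by rewrite ltnS -(ler_nat R); apply: le_trans t1.
exists (Ordinal aM) => /=; rewrite ut -mulrBr normrM (gtr0_norm rho_gt0).
rewrite -[leRHS]mulr1 ler_wpM2l ?(ltW rho_gt0) //.
rewrite ler_norml -natr1 in at2 *; apply/andP; split; lra.
Qed.

Lemma nrm_le_abs (x : R[i]) : nrm x <= `|complex.Re x| + `|complex.Im x|.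
Proof.
rewrite nrmE -[leRHS]ger0_norm ?addr_ge0 // -sqrtr_sqr ler_wsqrtr //.
rewrite -[complex.Re x ^+ 2]real_normK ?num_real // -[complex.Im x ^+ 2]real_normK ?num_real //.
by rewrite sqrrD lerD2r lerDl mulrn_wge0 // mulr_ge0.
Qed.

Lemma abs_le_nrm (x : R[i]) : `|complex.Re x| <= nrm x /\ `|complex.Im x| <= nrm x.
Proof.
rewrite nrmE -!sqrtr_sqr; split; apply: ler_wsqrtr; [rewrite lerDl|rewrite lerDr]; exact: sqr_ge0.
Qed.

Lemma round_complex (x : R[i]) : nrm x <= 1 -> exists g : grid, nrm (x - gval g) <= 2 * rho.
Proof.
move=> x1; have [hr hi] := abs_le_nrm x.
have [a ha] := round_real (le_trans hr x1).
have [b hb] := round_real (le_trans hi x1).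
exists (a, b); apply: le_trans (nrm_le_abs _) _.
by case: x {x1 hr hi} ha hb => u v /=; rewrite /gval /= => *; lra.
Qed.

(** A net point is coded by [n] pairs of a position and a grid value, so that the net has at most
    [(|Cl| (2M+1)^2)^n] points. Positions may repeat; [pick] then takes one of them. *)
Definition net_point n (f : {ffun 'I_n -> Cl * grid}) (k : Cl) : R[i] :=
  if [pick i | (f i).1 == k] is Some i then gval (f i).2 else 0.

Lemma net_cover n (x : Cl -> R[i]) :
  (forall k, nrm (x k) <= 1) -> (exists k, rho <= nrm (x k)) ->
  (#|[set k | (rho <= nrm (x k))%R]| <= n)%N ->
  exists f : {ffun 'I_n -> Cl * grid}, forall k, nrm (x k - net_point f k) <= 2 * rho.
Proof.
move=> x1 [k0 k0P]; set J := [set k | _] => Jn.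
have /choice[g gP] : forall k, exists g : grid, nrm (x k - gval g) <= 2 * rho.
  by move=> k; apply: round_complex.
(* Slots beyond the end of [J] repeat the position [k0]. This is harmless because the value in a
   slot depends only on its position. *)
pose h (i : 'I_n) := nth k0 (enum J) i.
exists [ffun i => (h i, g (h i))] => k; rewrite /net_point.
case: pickP => [i|no]; first by rewrite !ffunE /= => /eqP ->.
rewrite subr0; have [kJ|kJ] := boolP (k \in J); last first.
  by move: kJ; rewrite inE -ltNge => h1; apply: ltW; apply: lt_trans h1 _; have := rho_gt0; lra.
have ik : (index k (enum J) < n)%N.
  by apply: leq_trans Jn; rewrite cardE index_mem mem_enum.
by have := no (Ordinal ik); rewrite ffunE /h /= nth_index ?mem_enum // eqxx.
Qed.

End Net.

Section Compressible.
Variables (R : realType) (S : finType) (mu : S -> R) (val : S -> R[i]) (c0 c1 : R).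
Hypothesis mu_ge0 : forall s, 0 <= mu s.
Hypothesis mu_sum1 : \sum_s mu s = 1.
Hypothesis c0_gt0 : 0 < c0.
Hypothesis c1_gt0 : 0 < c1.
Hypothesis spread : forall z : R[i], \sum_s mu s * (nrm (val s - z) < c0)%R%:R <= 1 - c1.
Variables (I Rw Cl : finType) (e : Rw -> Cl -> I) (Z : Rw -> Cl -> R[i]) (Bd : R).
Hypothesis e_inj : forall r k r' k', e r k = e r' k' -> r = r' /\ k = k'.
Hypothesis entry_le : forall x r k, nrm (val x + Z r k) <= Bd.

Local Notation Pr := (@pr R S I mu).
Local Notation conf := {ffun I -> S}.

Definition app (s : conf) (x : Cl -> R[i]) (r : Rw) : R[i] :=
  \sum_k (val (s (e r k)) + Z r k) * x k.

Lemma app_lipschitz s x y r d : (forall k, nrm (x k - y k) <= d) ->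
  nrm (app s y r) <= nrm (app s x r) + #|Cl|%:R * (Bd * d).
Proof.
move=> xyd; rewrite addrC -lerBlDr; apply: (@le_trans _ _ (nrm (app s y r - app s x r))).
  by rewrite lerBlDr nrm_tri.
rewrite nrmBC /app -sumrB; apply: le_trans (nrm_sum _ _) _.
rewrite -sum1_card natr_sum mulr_suml; apply: ler_sum => k _.
rewrite mul1r -mulrBr nrmM ler_pM ?nrm_ge0 //.
Qed.

Lemma app_split s (x : Cl -> R[i]) r :
  app s x r = \sum_k x k * val (s (e r k)) - - \sum_k Z r k * x k.
Proof.
rewrite opprK -big_split; apply: eq_bigr => k _ /=; ring.
Qed.

Lemma e_injr r : injective (e r).
Proof. by move=> k k' /e_inj[]. Qed.

Variable RS : {set Rw}.

(** Different rows read disjoint sets of coordinates, so [pr_chain] multiplies the bounds of the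
    single rows. *)
Lemma rows_bound (y : Cl -> R[i]) th p : 0 <= p ->
  (forall r z, Pr (fun t => nrm (\sum_k y k * val (t (e r k)) - z) < th) <= p) ->
  Pr (fun s => forall r, r \in RS -> nrm (app s y r) < th) <= p ^+ #|RS|.
Proof.
move=> p0 hp; case: (set_0Vmem RS) => [->|[r0 r0RS]].
  by rewrite cards0 expr0 pr_le1.
pose rr i := nth r0 (enum RS) i.
apply: le_trans (pr_chain mu_ge0 mu_sum1 (n := #|RS|)
   (J := fun i => [set e (rr i) k | k in setT]) (E := fun i s => nrm (app s y (rr i)) < th) p0 _ _).
- apply: pr_le => // s h i im; apply: h.
  by rewrite -mem_enum mem_nth // -cardE.
- move=> i im s; apply: le_trans (hp (rr i) (- \sum_k Z (rr i) k * y k)).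
  apply: pr_le => // t; rewrite app_split (eq_bigr (fun k => y k * val (t (e (rr i) k)))) //.
  by move=> k _; rewrite resample_in // imset_f.
- move=> i j /andP[ij jn] s t; have im := ltn_trans ij jn; congr (is_true (nrm _ < _)).
  apply: eq_bigr => k _; rewrite resample_notin //; apply/imsetP => -[k' _ /e_inj[h _]].
  move: h ij; rewrite /rr => /eqP; rewrite nth_uniq ?enum_uniq -?cardE //.
  by move=> /eqP ->; rewrite ltnn.
Qed.

(** [RS] leaves out the rows that are to be resampled. Applied to a transpose, the negation says
    that a left null vector of the columns listed in [RS] is spread out. *)
Definition compressible (rho eta : R) (n : nat) (s : conf) : Prop :=
  exists x : Cl -> R[i], [/\ forall k, nrm (x k) <= 1, exists k, nrm (x k) = 1,
    forall r, r \in RS -> nrm (app s x r) <= eta &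
    (#|[set k | (rho <= nrm (x k))%R]| <= n)%N].

Variables (rho1 rho2 eta : R) (M1 M2 n1 n2 : nat).
Hypothesis rho1_gt0 : 0 < rho1.
Hypothesis rho2_gt0 : 0 < rho2.
Hypothesis rho1_le : rho1 <= 4^-1.
Hypothesis rho2_le : rho2 <= rho1 / 4.
Hypothesis rhoM1 : 1 <= rho1 * M1%:R.
Hypothesis rhoM2 : 1 <= rho2 * M2%:R.
Hypothesis eta1 : eta + #|Cl|%:R * (Bd * (2 * rho1)) < c0 / 2.
Hypothesis eta2 : eta + #|Cl|%:R * (Bd * (2 * rho2)) < rho1 / 2 * c0 / 2.

(** Two scales are needed. A single large coordinate gives only a factor [1 - c1] per row, which
    cannot pay for a net with [n2] positions. So vectors with at most [n1] coordinates above [rho1]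
    are treated by a smaller net; any other vector still has more than [n1] coordinates above
    [rho1 / 2] after rounding, and Littlewood-Offord gives a factor of order [n1^(-1/2)] per row,
    which pays for the larger net. *)
Lemma compressible_bound :
  Pr (compressible rho2 eta n2) <=
    (#|Cl| * (2 * M1).+1 ^ 2)%:R ^+ n1 * (1 - c1) ^+ #|RS| +
    (#|Cl| * (2 * M2).+1 ^ 2)%:R ^+ n2 * ((Num.sqrt (n1.+1%:R * c1))^-1) ^+ #|RS|.
Proof.
have c1_le1 : c1 <= 1 by have /andP[_] := psep01 mu_ge0 mu_sum1 c1_gt0 spread;
  have := psep_ge mu_ge0 mu_sum1 spread; apply: le_trans.
pose small th y s := forall r, r \in RS -> nrm (app s y r) < th.
pose E1 (f : {ffun 'I_n1 -> Cl * grid M1}) s :=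
  let y := net_point rho1 f in (exists k, 2^-1 <= nrm (y k)) /\ small (c0 / 2) y s.
pose E2 (f : {ffun 'I_n2 -> Cl * grid M2}) s :=
  let y := net_point rho2 f in (n1 < #|[set k | (rho1 / 2 <= nrm (y k))%R]|)%N
     /\ small (rho1 / 2 * c0 / 2) y s.
apply: (@le_trans _ _ (Pr (fun s => (exists f, E1 f s) \/ (exists f, E2 f s)))).
  apply: pr_le => // s [x [x1 [k0 xk0] xsm xn2]].
  have [J1|J1] := leqP #|[set k | (rho1 <= nrm (x k))%R]| n1.
    have [|f fP] := net_cover rho1_gt0 rhoM1 x1 _ J1.
      by exists k0; rewrite xk0; have := rho1_le; lra.
    left; exists f; split.
      exists k0; have := nrm_tri (x k0) (net_point rho1 f k0); have := fP k0.
      rewrite xk0; have := rho1_le; lra.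
    move=> r rRS; apply: le_lt_trans (app_lipschitz _ _ fP) _.
    by apply: le_lt_trans eta1; rewrite lerD2r xsm.
  have [|f fP] := net_cover rho2_gt0 rhoM2 x1 _ xn2.
    by exists k0; rewrite xk0; have := rho1_le; have := rho2_le; lra.
  right; exists f; split.
    apply: (leq_trans J1); apply/subset_leq_card/fintype.subsetP => k; rewrite !inE => h.
    have := nrm_tri (x k) (net_point rho2 f k); have := fP k.
    have := rho2_le; lra.
  move=> r rRS; apply: le_lt_trans (app_lipschitz _ _ fP) _.
  by apply: le_lt_trans eta2; rewrite lerD2r xsm.
apply: le_trans (pr_or mu_ge0 _ _) _; apply: lerD.
  apply: le_trans (pr_exT mu_ge0 _) _.
  rewrite -natrX.
  have -> : (((#|Cl| * (2 * M1).+1 ^ 2) ^ n1)%:R * (1 - c1) ^+ #|RS| : R)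
      = \sum_(f : {ffun 'I_n1 -> Cl * grid M1}) (1 - c1) ^+ #|RS|.
    by rewrite sumr_const card_ffun !card_prod !card_ord mulr_natl mulnn.
  apply: ler_sum => f _.
  (* A net point without a coordinate of size [1/2] makes the event empty; only the others need an
     estimate. *)
  have [[k hk]|no] := pselect (exists k, 2^-1 <= nrm (net_point rho1 f k)); last first.
    apply: (@le_trans _ _ 0); last by rewrite exprn_ge0 // subr_ge0.
    rewrite -(ex_cst I mu_sum1 0); apply: ex_le => // s.
    by rewrite asboolF // => -[].
  apply: (@le_trans _ _ (Pr (small (c0 / 2) (net_point rho1 f)))); first by apply: pr_le => // s [].
  apply: rows_bound; first by rewrite subr_ge0.
  move=> r z; apply: (single_coord_inj mu_ge0 mu_sum1 spread (@e_injr r) (k := k)).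
    by rewrite mulrC ler_wpM2r ?(ltW c0_gt0).
  by apply: lt_le_trans hk; rewrite invr_gt0.
apply: le_trans (pr_exT mu_ge0 _) _.
rewrite -natrX; set p := _^-1.
have -> : (((#|Cl| * (2 * M2).+1 ^ 2) ^ n2)%:R * p ^+ #|RS| : R)
      = \sum_(f : {ffun 'I_n2 -> Cl * grid M2}) p ^+ #|RS|.
  by rewrite sumr_const card_ffun !card_prod !card_ord mulr_natl mulnn.
have p0 : 0 <= p by rewrite invr_ge0 sqrtr_ge0.
apply: ler_sum => f _.
have [hk|no] := leqP #|[set k | (rho1 / 2 <= nrm (net_point rho2 f k))%R]| n1.
  apply: (@le_trans _ _ 0); last by rewrite exprn_ge0.
  rewrite -(ex_cst I mu_sum1 0); apply: ex_le => // s.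
  by rewrite asboolF // => -[]; rewrite ltnNge hk.
apply: (@le_trans _ _ (Pr (small (rho1 / 2 * c0 / 2) (net_point rho2 f)))); first by apply: pr_le => // s [].
apply: rows_bound => // r z.
apply: le_trans (littlewood_offord_inj mu_ge0 mu_sum1 c0_gt0 c1_gt0 spread (@e_injr r)
  (K := [set k | (rho1 / 2 <= nrm (net_point rho2 f k))%R]) z _ _) _.
- by rewrite divr_gt0.
- by move=> k; rewrite inE.
- rewrite lef_pV2 ?posrE ?sqrtr_gt0 ?mulr_gt0 // ler_wsqrtr // ler_wpM2r ?(ltW c1_gt0) //.
  by rewrite ler_nat; apply: ltnW.
Qed.

End Compressible.

(** * Net cardinalities against small-ball probabilities *)

Section Asymptotics.
Variable R : realType.

(** Bernoulli's inequality for [q^(-k)] with [k = n / (d+1)], raised to the power [d + 1], gives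
    growth of degree [d + 1]. *)
Lemma exp_beats_poly (q C : R) (d : nat) : 0 < q < 1 -> 0 < C ->
  exists n0, forall n, (n0 <= n)%N -> C * n%:R ^+ d * q ^+ n <= 1.
Proof.
move=> /andP[q0 q1] C0; pose h := q^-1 - 1.
have h0 : 0 < h by rewrite subr_gt0 invf_gt1.
have bern k : 1 + k%:R * h <= q^-1 ^+ k.
  elim: k => [|k IH]; first by rewrite mul0r addr0 expr0.
  rewrite exprS; apply: (@le_trans _ _ ((1 + h) * (1 + k%:R * h))); last first.
    rewrite (_ : 1 + h = q^-1); last by rewrite /h; lra.
    by rewrite ler_wpM2l // invr_ge0 ltW.
  have : 0 <= k%:R * h * h by rewrite !mulr_ge0 // ltW.
  rewrite -natr1; lra.
pose D := (2 * d.+1%:R / h) ^+ d.+1 * C.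
exists (maxn (2 * d.+1) (Num.truncn D).+1) => n; rewrite geq_max => /andP[nd nD].
have Dn : D <= n%:R.
  by apply: le_trans (ltW (truncnS_gt D)) _; rewrite ler_nat.
pose k := (n %/ d.+1)%N.
have kn : n%:R <= 2 * d.+1%:R * k%:R :> R.
  rewrite -!natrM ler_nat /k; have := ltn_ceil n (ltn0Sn d).
  have : (0 < n %/ d.+1)%N by rewrite divn_gt0 //; lia.
  nia.
have hq : (h * k%:R) ^+ d.+1 <= q^-1 ^+ n.
  apply: (@le_trans _ _ ((q^-1 ^+ k) ^+ d.+1)).
    rewrite ler_pXn2r ?nnegrE ?mulr_ge0 ?exprn_ge0 ?invr_ge0 ?(ltW h0) ?(ltW q0) //.
    by apply: le_trans (bern k); rewrite mulrC lerDr.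
  have iq : 1 < q^-1 by rewrite invf_gt1.
  by rewrite -exprM ler_eXn2l // leq_trunc_div.
have n0 : 0 < n%:R :> R by rewrite ltr0n; lia.
rewrite -[q]invrK exprVn ler_pdivrMr ?exprn_gt0 ?invr_gt0 // mul1r; apply: le_trans hq.
rewrite -(ler_pM2r n0) -mulrA -exprSr.
apply: (@le_trans _ _ (C * (2 * d.+1%:R * k%:R) ^+ d.+1)).
  by rewrite ler_wpM2l ?(ltW C0) // ler_pXn2r ?nnegrE ?mulr_ge0.
apply: (@le_trans _ _ ((h * k%:R) ^+ d.+1 * D)); last first.
  by rewrite ler_wpM2l // exprn_ge0 // mulr_ge0 // ltW.
rewrite /D mulrA -exprMn (_ : h * k%:R * _ = 2 * d.+1%:R * k%:R) 1?mulrC //.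
by field; rewrite gt_eqF.
Qed.

(** The net of the first scale. As [n] is the integer root of [b], the factor [q^r] is of order
    [(q^n)^n] and the claim reduces to the [n]-th power of [C' n^11 q^n <= 1]. Ten factors of [n^11]
    come from [b^5], the last one from [b^10 <= 4^10 n^n]. At least [b - 3] rows are available
    because up to three may be left out. *)
Lemma eventually_inv_small (q C : R) (d : nat) : 0 <= q < 1 -> 0 < C ->
  exists n0, forall n, (n0 <= n)%N -> forall b, (n ^ 2 <= b < n.+1 ^ 2)%N -> forall r, (b - 3 <= r)%N ->
  (C * b%:R ^+ 5) ^+ n * q ^+ r <= 2^-1 * (b%:R^-1) ^+ 10.
Proof.
(* [q] may vanish; with [q' >= 1/2] the three missing rows cost at most the factor 8. *)
move=> /andP[q0 q1] C0; pose q' := Num.max q 2^-1.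
have q'P : 0 < q' < 1 by rewrite /q' lt_max gt_max q1 invf_lt1 ?ltr1n // invr_gt0 ltr0n orbT.
have /andP[q'0 q'1] := q'P.
have q'2 : 2^-1 <= q' by rewrite /q' le_max lexx orbT.
have [K KE K1] : exists2 K : R, K = 16 * 4 ^+ 10 & 1 <= K.
  by exists (16 * 4 ^+ 10) => //; lra.
pose C' := (C * 4 ^+ 5 + 1) * K.
have C'0 : 0 < C' by rewrite /C' mulr_gt0 //; lra.
have [n0 hn0] := exp_beats_poly 11 q'P C'0.
exists (maxn 20 n0) => n; rewrite geq_max => /andP[n20 /hn0 {}hn0] b /andP[nb bn] r br.
have nR : 1 <= n%:R :> R by rewrite ler1n; apply: leq_trans n20.
have n400 : (400 <= n ^ 2)%N by rewrite (_ : 400 = 20 ^ 2)%N // leq_exp2r.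
have b4 : b%:R <= 4 * n%:R ^+ 2 :> R.
  rewrite -natrX -natrM ler_nat; apply: (leq_trans (ltnW bn)).
  by clear -n20; nia.
have b0 : 0 < b%:R :> R by rewrite ltr0n; apply: leq_trans nb; apply: leq_trans n400.
have rn : (n ^ 2 - 3 <= r)%N by apply: leq_trans br; apply: leq_sub2r.
set N := n%:R in nR b4.
have N0 : 0 < N by apply: lt_le_trans nR.
have hb10 : b%:R ^+ 10 <= 4 ^+ 10 * N ^+ n :> R.
  apply: (@le_trans _ _ ((4 * N ^+ 2) ^+ 10)); first by rewrite ler_pXn2r ?nnegrE ?mulr_ge0 ?exprn_ge0 // ltW.
  by rewrite exprMn -exprM ler_wpM2l ?exprn_ge0 // ler_weXn2l.
have hq : q ^+ r <= 8 * (q' ^+ n) ^+ n.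
  apply: (@le_trans _ _ (q' ^+ (n ^ 2 - 3))).
    apply: (@le_trans _ _ (q' ^+ r)).
      by rewrite lerXn2r ?nnegrE ?(ltW q'0) // /q' le_max lexx.
    by rewrite ler_wiXn2l ?(ltW q'0) ?(ltW q'1).
  rewrite -exprM mulnn -{2}(@subnK 3 (n ^ 2)); last exact: leq_trans n400.
  rewrite exprD mulrCA -[leLHS]mulr1 ler_wpM2l ?exprn_ge0 ?(ltW q'0) //.
  apply: (@le_trans _ _ (8 * 2^-1 ^+ 3)); first by rewrite exprVn -natrX divff // pnatr_eq0.
  by rewrite ler_wpM2l // ler_pXn2r ?nnegrE ?invr_ge0 // ltW.
have hC : (C * b%:R ^+ 5) ^+ n <= (C * 4 ^+ 5 * N ^+ 10) ^+ n.
  rewrite lerXn2r ?nnegrE ?mulr_ge0 ?exprn_ge0 ?(ltW C0) ?(ltW b0) ?(ltW N0) //.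
  rewrite -mulrA ler_wpM2l ?(ltW C0) // (_ : N ^+ 10 = (N ^+ 2) ^+ 5); last by rewrite -exprM.
  rewrite -exprMn.
  by rewrite ler_pXn2r ?nnegrE ?mulr_ge0 ?exprn_ge0 ?(ltW b0) ?(ltW N0).
suff h : (C * b%:R ^+ 5) ^+ n * q ^+ r * (2 * b%:R ^+ 10) <= 1.
  by rewrite exprVn -invfM -[leRHS]mul1r ler_pdivlMr // mulr_gt0 ?exprn_gt0.
apply: (@le_trans _ _ ((C * 4 ^+ 5 * N ^+ 10) ^+ n * (8 * (q' ^+ n) ^+ n) * (2 * (4 ^+ 10 * N ^+ n)))).
  apply: ler_pM.
  - by rewrite !mulr_ge0 ?exprn_ge0 ?mulr_ge0 ?exprn_ge0 ?(ltW C0) ?(ltW b0).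
  - by rewrite mulr_ge0 ?exprn_ge0 ?(ltW b0).
  - by apply: ler_pM => //; rewrite ?exprn_ge0 ?mulr_ge0 ?exprn_ge0 ?(ltW C0) ?(ltW b0).
  - by rewrite ler_wpM2l.
rewrite (_ : _ * (8 * _) * _ = (C * 4 ^+ 5 * N ^+ 11 * q' ^+ n) ^+ n * (16 * 4 ^+ 10)); last first.
  rewrite (_ : C * 4 ^+ 5 * N ^+ 11 * q' ^+ n = (C * 4 ^+ 5 * N ^+ 10) * q' ^+ n * N); last by ring.
  rewrite !(exprMn n); ring.
rewrite -KE.
have Kn : K <= K ^+ n by rewrite -[leLHS]expr1 ler_weXn2l //; apply: leq_trans n20.
have P0 : 0 <= C * 4 ^+ 5 * N ^+ 11 * q' ^+ n.
  by rewrite !mulr_ge0 ?exprn_ge0 ?(ltW C0) ?(ltW N0) ?(ltW q'0).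
apply: (@le_trans _ _ ((C * 4 ^+ 5 * N ^+ 11 * q' ^+ n) ^+ n * K ^+ n)).
  by rewrite ler_wpM2l ?exprn_ge0.
rewrite -exprMn; apply: exprn_ile1; first by rewrite mulr_ge0 //; lra.
apply: le_trans hn0; rewrite /C'.
rewrite [leLHS](_ : _ = C * 4 ^+ 5 * (K * (N ^+ 11 * q' ^+ n))); last by ring.
rewrite [leRHS](_ : _ = (C * 4 ^+ 5 + 1) * (K * (N ^+ 11 * q' ^+ n))); last by ring.
rewrite ler_wpM2r ?lerDl // !mulr_ge0 ?exprn_ge0 ?(ltW N0) ?(ltW q'0) //.
exact: le_trans K1.
Qed.

(** The net of the second scale. With [X = n + 1], of the order of the root of [b], squaring turns
    the powers of [b] in the net into at most [X^(36 (b / 144))], hence at most [X^(b/4)], against a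
    small-ball factor of order [X^(-b)] up to constants to the power [b]. This is where the fraction
    144 is used. *)
Lemma eventually_root_small (A c : R) : 1 <= A -> 0 < c <= 1 ->
  exists n0, forall n, (n0 <= n)%N -> forall b, (n ^ 2 <= b < n.+1 ^ 2)%N -> forall r, (b - 3 <= r)%N ->
  (A * b%:R ^+ 9) ^+ (b %/ 144) * (Num.sqrt (n.+1%:R * c))^-1 ^+ r <= 2^-1 * (b%:R^-1) ^+ 10.
Proof.
move=> A1 /andP[cpos c1]; pose K := A * c^-1 * 4.
have A0 : 0 < A by apply: lt_le_trans A1.
have ic : 1 <= c^-1 by rewrite invf_ge1.
have K1 : 1 <= K by rewrite /K; nra.
exists (maxn 100 (Num.truncn (K ^+ 2)).+1) => n; rewrite geq_max => /andP[n100 nK] b /andP[nb bn] r br.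
set X := n.+1%:R.
have KX : K ^+ 2 <= X.
  by apply: le_trans (ltW (truncnS_gt _)) _; rewrite ler_nat; apply: leq_trans nK _.
have X1 : 1 <= X by rewrite ler1n.
have X0 : 0 < X by apply: lt_le_trans X1.
have bX : b%:R <= X ^+ 2 by rewrite -natrX ler_nat ltnW.
have n4 : (2500 <= n ^ 2)%N by rewrite (_ : 2500 = 50 ^ 2)%N // leq_exp2r //; apply: leq_trans n100.
have b10 : (2500 <= b)%N by apply: leq_trans nb.
have b0 : 0 < b%:R :> R by rewrite ltr0n; apply: leq_trans b10.
set u := Num.sqrt _.
have Xc1 : 1 <= X * c.
  have : c^-1 <= X.
    apply: le_trans KX; apply: (@le_trans _ _ K); last by rewrite expr2 ler_peMl //; lra.
    by rewrite /K; nra.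
  by rewrite -ler_pdivrMr // mul1r.
have u1 : 1 <= u by rewrite /u -sqrtr1 ler_wsqrtr.
have u0 : 0 < u by apply: lt_le_trans u1.
have u2 : u ^+ 2 = X * c by rewrite sqr_sqrtr // ltW // mulr_gt0.
apply: (@le_trans _ _ ((A * b%:R ^+ 9) ^+ (b %/ 144) * u^-1 ^+ (b - 3))).
  rewrite ler_wpM2l ?exprn_ge0 ?mulr_ge0 ?exprn_ge0 ?(ltW A0) ?(ltW b0) //.
  by rewrite ler_wiXn2l ?invr_ge0 ?(ltW u0) // invf_le1.
rewrite !exprVn -invfM ler_pdivrMr ?exprn_gt0 // ler_pdivlMl; last by rewrite mulr_gt0 ?exprn_gt0.
rewrite mulrC.
set a := (b %/ 144)%N.
rewrite -(ler_pXn2r (n := 2)) ?nnegrE ?mulr_ge0 ?exprn_ge0 ?mulr_ge0 ?exprn_ge0 ?(ltW A0) ?(ltW b0) ?(ltW u0) //.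
rewrite exprAC u2.
(* [v], about [3b/4], is the exponent left in [X^b] after the net and a factor [X^43]. Since
   [b <= 2 v] and [K^2 <= X], the power [X^v] absorbs [K^b]. *)
pose t := (b %/ 4)%N; pose v := (b - t - 43)%N.
have h1 : (b <= 2 * v)%N by clear -b10; rewrite /v /t; lia.
have h2 : (36 * a + 43 + v <= b)%N by clear -b10; rewrite /a /v /t; lia.
have h3 : (2 * a <= b)%N by clear -b10; rewrite /a; lia.
have h4 : (b = (b - 3) + 3)%N by clear -b10; lia.
apply: (@le_trans _ _ (A ^+ b * X ^+ (36 * a) * (4 * X ^+ 40))).
  rewrite (exprMn 2 ((A * b%:R ^+ 9) ^+ a)) (exprMn a A) (exprMn 2 (A ^+ a)) (exprMn 2 2); apply: ler_pM.
  - by rewrite !(mulr_ge0, exprn_ge0) ?(ltW A0) ?(ltW b0).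
  - by rewrite !(mulr_ge0, exprn_ge0) ?(ltW b0).
  - apply: ler_pM; rewrite ?(exprn_ge0, ltW A0, ltW b0) //.
      by rewrite -exprM mulnC ler_weXn2l.
    have -> : X ^+ (36 * a) = (X ^+ 2) ^+ (9 * a * 2).
      by rewrite -[RHS]exprM; congr (X ^+ _); clear; lia.
    rewrite -[b%:R ^+ 9 ^+ a]exprM -[leLHS]exprM.
    by rewrite lerXn2r ?nnegrE ?(exprn_ge0, ltW b0, ltW X0).
  - rewrite (_ : 2 ^+ 2 = 4); last by ring.
    rewrite ler_wpM2l // -[leLHS]exprM (_ : X ^+ 40 = (X ^+ 2) ^+ (10 * 2)); last by rewrite -exprM.
    by rewrite lerXn2r ?nnegrE ?(exprn_ge0, ltW b0, ltW X0).
have cb : 1 <= c^-1 ^+ (b - 3) by rewrite exprn_ege1.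
have -> : (X * c) ^+ (b - 3) = X ^+ (b - 3) / c^-1 ^+ (b - 3).
  by rewrite exprMn [c^-1 ^+ _]exprVn invrK.
rewrite ler_pdivlMr ?exprn_gt0 ?invr_gt0 //.
rewrite -(ler_pM2r (_ : 0 < X ^+ 3)) ?exprn_gt0 // -[leRHS]exprD -h4.
apply: (@le_trans _ _ (K ^+ b * X ^+ (36 * a + 43))).
  rewrite /K (exprMn b (A / c)) (exprMn b A) exprD (_ : X ^+ 43 = X ^+ 40 * X ^+ 3); last by rewrite -exprD.
  have hc : c^-1 ^+ (b - 3) <= c^-1 ^+ b by rewrite ler_weXn2l // leq_subr.
  have h5 : 4 <= 4 ^+ b :> R by rewrite -[leLHS]expr1 ler_weXn2l ?ler1n //; apply: leq_trans b10.
  have h6 : c^-1 ^+ (b - 3) * 4 <= c^-1 ^+ b * 4 ^+ b.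
    by apply: ler_pM => //; rewrite exprn_ge0 // invr_ge0 ltW.
  rewrite [leLHS](_ : _ = (c^-1 ^+ (b - 3) * 4) * (A ^+ b * X ^+ (36 * a) * (X ^+ 40 * X ^+ 3))); last by ring.
  rewrite [leRHS](_ : _ = (c^-1 ^+ b * 4 ^+ b) * (A ^+ b * X ^+ (36 * a) * (X ^+ 40 * X ^+ 3))); last by ring.
  by rewrite ler_wpM2r // !mulr_ge0 ?exprn_ge0 ?(ltW A0) ?(ltW X0).
apply: (@le_trans _ _ (X ^+ v * X ^+ (36 * a + 43))).
  rewrite ler_wpM2r ?exprn_ge0 ?(ltW X0) //.
  apply: (@le_trans _ _ (K ^+ (2 * v))); first by rewrite ler_weXn2l.
  by rewrite exprM lerXn2r ?nnegrE ?(ltW X0) // exprn_ge0 //; apply: le_trans K1.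
by rewrite -exprD ler_weXn2l //; clear -h2; lia.
Qed.

End Asymptotics.

Lemma nat_sqrt_exists b : exists n, (n ^ 2 <= b < n.+1 ^ 2)%N.
Proof.
elim: b => [|b [n nP]]; first by exists 0%N.
have [h|h] := ltnP b.+1 (n.+1 ^ 2)%N; first by exists n; case/andP: nP => h1 _; rewrite h andbT ltnW.
exists n.+1; rewrite h /=; case/andP: nP => h1 h2.
by apply: leq_ltn_trans h2 _; rewrite ltn_exp2r.
Qed.

Section CompressibleSmall.
Variables (R : realType) (c0 c1 : R) (kappa : nat).
Hypothesis c0P : 0 < c0 <= 1.
Hypothesis c1P : 0 < c1 <= 1.
Hypothesis kappaP : 40 <= kappa%:R * c0.

(** Rounding a vector by [2 r] moves a row by at most [18 b^2 r], as there are [3b] columns with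
    entries of modulus at most [3b]. The first scale [1/(kappa b^2)] makes this less than [c0 / 2];
    the second, [rho], must be below the first by a further factor [b^2] and a constant. [tol] has
    the order of the row error at scale [rho]. *)
Definition rho (b : nat) : R := (kappa%:R ^+ 3 * b%:R ^+ 4)^-1.
Definition tol (b : nat) : R := rho b * b%:R ^+ 2.

Let k_ge40 : 40 <= kappa%:R :> R.
Proof. by case/andP: c0P => p q; have : 0 <= kappa%:R :> R by []; have := kappaP; nra. Qed.

Lemma rho_gt0 b : (0 < b)%N -> 0 < rho b.
Proof.
move=> b0; rewrite invr_gt0 mulr_gt0 ?exprn_gt0 ?ltr0n //.
by rewrite -(ltr0n R); have := k_ge40; lra.
Qed.

Lemma eventually_incompressible : exists b0 : nat, forall b, (b0 <= b)%N ->
  forall (S : finType) (mu : S -> R) (val : S -> R[i]),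
  (forall s, 0 <= mu s) -> \sum_s mu s = 1 ->
  (forall z : R[i], \sum_s mu s * (nrm (val s - z) < c0)%R%:R <= 1 - c1) ->
  forall (I Rw Cl : finType) (e : Rw -> Cl -> I) (Z : Rw -> Cl -> R[i]),
  (forall r k r' k', e r k = e r' k' -> r = r' /\ k = k') ->
  (forall x r k, nrm (val x + Z r k) <= 3 * b%:R) ->
  forall RS : {set Rw}, (b - 3 <= #|RS|)%N -> (#|Cl| <= 3 * b)%N ->
  pr mu (compressible val e Z RS (rho b) (tol b) (b %/ 144)) <= b%:R^-1 ^+ 10.
Proof.
have /andP[c0_gt0 c0_le1] := c0P; have /andP[c1_gt0 c1_le1] := c1P.
have k40 := k_ge40; have k0 : 0 < kappa%:R :> R by lra.
have [q|q] := boolP (c1 < 0); first lra.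
have q01 : 0 <= 1 - c1 < 1 by apply/andP; split; lra.
(* The constants come from [|Cl| (2M+1)^2 <= 3b (3M)^2] with [M = kappa b^2] here and
   [M = kappa^3 b^4] for the second scale. *)
have [n1 hn1] := @eventually_inv_small R (1 - c1) (27 * kappa%:R ^+ 2) 5 q01
   ltac:(by rewrite mulr_gt0 ?exprn_gt0).
have A1 : 1 <= 27 * kappa%:R ^+ 6 :> R.
  by rewrite mulr_ege1 ?exprn_ege1 //; lra.
have [n2 hn2] := @eventually_root_small R (27 * kappa%:R ^+ 6) c1 A1 c1P.
exists (maxn 1 (maxn n1 n2 ^ 2)) => b; rewrite geq_max => /andP[b1 bn].
move=> S mu val mu_ge0 mu_sum1 spread I Rw Cl e Z e_inj entry RS RSb Clb.
have [n nP] := nat_sqrt_exists b.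
have nn : (maxn n1 n2 <= n)%N.
  case/andP: nP => _ h; have := leq_ltn_trans bn h.
  by rewrite ltn_exp2r // ltnS.
have /hn1 := leq_trans (leq_maxl _ _) nn => /(_ b nP #|RS| RSb) h1.
have /hn2 := leq_trans (leq_maxr _ _) nn => /(_ b nP #|RS| RSb) h2 {hn1 hn2}.
have B1 : 1 <= b%:R :> R by rewrite ler1n.
set B := b%:R in B1 h1 h2 *; set K := kappa%:R in k40 k0 A1 h1 h2 *.
have B0 : 0 < B by lra.
have K0 : K != 0 by rewrite gt_eqF.
have Bn0 : B != 0 by rewrite gt_eqF.
pose M1 := (kappa * b ^ 2)%N; pose M2 := (kappa ^ 3 * b ^ 4)%N.
have M1E : M1%:R = K * B ^+ 2 by rewrite natrM natrX.
have M2E : M2%:R = K ^+ 3 * B ^+ 4 by rewrite natrM !natrX.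
have rho1_gt0 : 0 < (K * B ^+ 2)^-1 by rewrite invr_gt0 mulr_gt0 ?exprn_gt0.
have Cl3 : #|Cl|%:R <= 3 * B :> R by rewrite -natrM ler_nat.
have KB : 40 <= K * B ^+ 2 by have := exprn_ege1 2 B1; nra.
have c0K : 40 / K <= c0 by rewrite ler_pdivrMr // mulrC; apply: kappaP.
have X0 : 0 < K^-1 by rewrite invr_gt0.
have X1 : K^-1 <= 40^-1 by rewrite lef_pV2 ?posrE.
have Y0 : 0 < (B ^+ 2)^-1 by rewrite invr_gt0 exprn_gt0.
have Y1 : (B ^+ 2)^-1 <= 1 by rewrite invf_le1 ?exprn_gt0 // exprn_ege1.
have rhoE : rho b = K^-1 ^+ 3 * (B ^+ 2)^-1 ^+ 2 by rewrite /rho invfM -/K -/B -!exprVn -exprM.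
have etaE : tol b = K^-1 ^+ 3 * (B ^+ 2)^-1.
  by rewrite /tol rhoE; field; rewrite Bn0 K0.
have r1E : (K * B ^+ 2)^-1 = K^-1 * (B ^+ 2)^-1 by rewrite invfM.
have cnt M Q : (2 * M).+1%:R <= Q -> (#|Cl| * (2 * M).+1 ^ 2)%:R <= 3 * B * Q ^+ 2 :> R.
  move=> h; rewrite natrM natrX ler_pM ?exprn_ge0 // lerXn2r ?nnegrE //.
  by apply: le_trans h.
have sp (d : R) : 0 <= d -> #|Cl|%:R * (3 * B * (2 * d)) <= 18 * (B ^+ 2 * d).
  move=> d0; apply: (@le_trans _ _ (3 * B * (3 * B * (2 * d)))).
    by rewrite ler_wpM2r // !mulr_ge0 // ltW.
  by rewrite le_eqVlt; apply/orP; left; apply/eqP; ring.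
have BY : B ^+ 2 * (B ^+ 2)^-1 = 1 by rewrite divff // expf_neq0.
have := @compressible_bound R S mu val c0 c1 mu_ge0 mu_sum1 c0_gt0 c1_gt0 spread I Rw Cl e Z
  (3 * B) e_inj entry RS (K * B ^+ 2)^-1 (rho b) (tol b) M1 M2 n (b %/ 144) rho1_gt0 (rho_gt0 b1).
rewrite M1E M2E /rho -/K -/B !mulVf ?mulf_neq0 ?expf_neq0 // -/(rho b).
have X2 : K^-1 ^+ 3 <= K^-1 * 1600^-1.
  rewrite exprS; apply: ler_wpM2l; first exact: ltW.
  by rewrite expr2; nra.
have X3 : 0 < K^-1 ^+ 3 by rewrite exprn_gt0.
set x := K^-1 in X0 X1 X2 X3 c0K rhoE etaE r1E *; set x3 := x ^+ 3 in X2 X3 rhoE etaE *.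
set y := (B ^+ 2)^-1 in Y0 Y1 rhoE etaE r1E BY *.
move=> cb; apply: le_trans (cb _ _ (lexx _) (lexx _) _ _) _ => {cb}.
- by rewrite r1E; nra.
- by rewrite rhoE r1E; nra.
- rewrite r1E; apply: le_lt_trans (_ : tol b + 18 * (B ^+ 2 * (x * y)) < _).
    by rewrite lerD2l sp // mulr_ge0 // ltW.
  rewrite (_ : B ^+ 2 * (x * y) = x * (B ^+ 2 * y)); last by ring.
  rewrite BY etaE mulr1.
  have : x3 * y <= x3 by rewrite ler_piMr // ltW.
  lra.
- rewrite r1E; apply: le_lt_trans (_ : tol b + 18 * (B ^+ 2 * rho b) < _).
    by rewrite lerD2l sp // ltW // rho_gt0.
  rewrite rhoE etaE expr2 (_ : B ^+ 2 * (x3 * (y * y)) = x3 * y * (B ^+ 2 * y)); last by ring.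
  rewrite BY mulr1.
  have xy : 0 < x * y by rewrite mulr_gt0.
  have : x3 * y <= x * y * 1600^-1 by rewrite [x * y * _]mulrAC ler_wpM2r // ltW.
  have : x * y * (40 * x) <= x * y * c0 by rewrite ler_wpM2l ?(ltW xy) //; lra.
  have : x3 * y = x * y * x * x by rewrite /x3; ring.
  have : x * y * x * x <= x * y * x * 40^-1 by rewrite ler_wpM2l // !mulr_ge0 // ltW.
  have : 0 < x * y * x by rewrite mulr_gt0.
  lra.
- rewrite [leRHS](_ : _ = 2^-1 * B^-1 ^+ 10 + 2^-1 * B^-1 ^+ 10); last by lra.
  apply: lerD.
    apply: le_trans h1; rewrite ler_wpM2r ?exprn_ge0 //; first by lra.
    rewrite lerXn2r ?nnegrE ?(mulr_ge0, exprn_ge0, ltW k0, ltW B0) //.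
    apply: le_trans (cnt _ (3 * (K * B ^+ 2)) _) _.
      by rewrite -natr1 natrM M1E; lra.
    by rewrite le_eqVlt; apply/orP; left; apply/eqP; ring.
  apply: le_trans h2; rewrite ler_wpM2r ?exprn_ge0 ?invr_ge0 ?sqrtr_ge0 //.
  rewrite lerXn2r ?nnegrE ?(mulr_ge0, exprn_ge0, ltW k0, ltW B0) //.
  apply: le_trans (cnt _ (3 * (K ^+ 3 * B ^+ 4)) _) _.
    rewrite -natr1 natrM M2E.
    have : 1 <= K ^+ 3 * B ^+ 4 by rewrite mulr_ege1 ?exprn_ege1 //; lra.
    lra.
  by rewrite le_eqVlt; apply/orP; left; apply/eqP; ring.
Qed.

End CompressibleSmall.

(** * One square block *)

Lemma homogeneous_system (F : fieldType) (X Y : finType) (Ys : {set Y}) (A : X -> Y -> F) :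
  (#|Ys| < #|X|)%N ->
  exists2 u : X -> F, exists i, u i != 0 & forall j, j \in Ys -> \sum_i A i j * u i = 0.
Proof.
move=> lt; pose M : 'M[F]_(#|X|, #|Ys|) := \matrix_(p, q) A (enum_val p) (enum_val q).
have : kermx M != 0.
  rewrite kermx_eq0 /row_free; apply: contraTneq lt => <-; rewrite -leqNgt.
  exact: rank_leq_col.
case/rowV0Pn => v /sub_kermxP vM v0.
exists (fun i => v 0 (enum_rank i)).
  by case/rV0Pn: v0 => p vp; exists (enum_val p); rewrite enum_valK.
move=> j jY; have := congr1 (fun B : matrix F _ _ => B 0 (enum_rank_in jY j)) vM.
rewrite !mxE => h; rewrite -[RHS]h (reindex_omap enum_val (fun i => Some (enum_rank i))) /=; last first.
  by move=> i _; rewrite enum_rankK.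
rewrite [LHS]big_mkcond; apply: eq_bigr => p _; rewrite enum_valK eqxx !mxE.
by rewrite enum_rankK_in // mulrC.
Qed.

Lemma normalize_max (R : realType) (X : finType) (u : X -> R[i]) :
  (exists i, u i != 0) ->
  exists2 c : R[i], c != 0 &
    (forall i, nrm (c * u i) <= 1) /\ exists i, nrm (c * u i) = 1.
Proof.
case=> i0 ui0.
have [i _ imax] : exists2 i, i \in X & forall j, nrm (u j) <= nrm (u i).
  have [i _ h] := seq_argmax (enum X) (fun j => nrm (u j)) i0.
  by exists i => // j; apply: h; rewrite inE mem_enum orbT.
have ui : u i != 0 by rewrite -nrm_gt0; apply: lt_le_trans (imax i0); rewrite nrm_gt0.
exists (u i)^-1; first by rewrite invr_neq0.
have ni : 0 < nrm (u i) by rewrite nrm_gt0.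
split=> [j|]; last by exists i; rewrite mulVf // nrm1.
by rewrite nrmM nrmV mulrC ler_pdivrMr // mul1r imax.
Qed.

Lemma unit_kernel_vector (R : realType) (X Y : finType) (Ys : {set Y}) (A : X -> Y -> R[i]) :
  (#|Ys| < #|X|)%N ->
  exists u : X -> R[i], [/\ forall i, nrm (u i) <= 1, exists i, nrm (u i) = 1 &
    forall j, j \in Ys -> \sum_i A i j * u i = 0].
Proof.
move=> /(homogeneous_system A)[u u0 uA].
have [c c0 [h1 h2]] := normalize_max u0.
exists (fun i => c * u i); split=> // j jY.
by under eq_bigr do rewrite mulrCA; rewrite -mulr_sumr uA // mulr0.
Qed.

Section Square.
Variables (R : realType) (S : finType) (mu : S -> R) (val : S -> R[i]) (c0 c1 : R).
Hypothesis mu_ge0 : forall s, 0 <= mu s.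
Hypothesis mu_sum1 : \sum_s mu s = 1.
Hypothesis c0_gt0 : 0 < c0.
Hypothesis c1_gt0 : 0 < c1.
Hypothesis spread : forall z : R[i], \sum_s mu s * (nrm (val s - z) < c0)%R%:R <= 1 - c1.
Variables (I : finType) (b w : nat) (rh et et4 dl : R).
Hypothesis rh_gt0 : 0 < rh.
Hypothesis et4_le : et4 <= et.
Hypothesis et_ge0 : 0 <= et.
Hypothesis et4_small : b%:R * et4 < rh * (rh * c0 / 2).

Local Notation Pr := (@pr R S I mu).
Local Notation ex := (@ex R S I mu).
Local Notation conf := {ffun I -> S}.

Hypothesis incompr : forall (e : 'I_b -> 'I_b -> I),
  (forall r k r' k', e r k = e r' k' -> r = r' /\ k = k') ->
  forall RS : {set 'I_b}, (b - 3 <= #|RS|)%N ->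
  Pr (compressible val e (fun _ _ => 0) RS rh et w) <= dl.

Definition lo_bound : R := (Num.sqrt (w.+2%:R * c1))^-1.

Lemma lo_bound_ge0 : 0 <= lo_bound.
Proof. by rewrite invr_ge0 sqrtr_ge0. Qed.

Lemma lo_bound_le n : (w < n)%N -> (Num.sqrt (n.+1%:R * c1))^-1 <= lo_bound.
Proof.
move=> wn; rewrite lef_pV2 ?posrE ?sqrtr_gt0 ?mulr_gt0 // ler_wsqrtr //.
by rewrite ler_wpM2r ?(ltW c1_gt0) // ler_nat.
Qed.

Variable e : 'I_b -> 'I_b -> I.
Hypothesis e_inj : forall r k r' k', e r k = e r' k' -> r = r' /\ k = k'.

Definition sq (s : conf) (x : 'I_b -> R[i]) (r : 'I_b) : R[i] :=
  \sum_k val (s (e r k)) * x k.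

Definition good (s : conf) (L : {set 'I_b}) : Prop := forall x : 'I_b -> R[i],
  (forall j, j \in L -> x j = 0) -> (forall k, nrm (x k) <= 1) -> (exists k, nrm (x k) = 1) ->
  exists r, et4 < nrm (sq s x r).

Definition bad (n : nat) (s : conf) : Prop :=
  forall L : {set 'I_b}, (#|L| <= n)%N -> ~ good s L.

(** Column [j] is close to the span of the columns outside [L] and [j]: a near null vector uses it
    with a coefficient that is not small. *)
Let evt (s : conf) (L : {set 'I_b}) (j : 'I_b) : Prop := exists x : 'I_b -> R[i],
  [/\ forall i, i \in L -> x i = 0, forall k, nrm (x k) <= 1, rh <= nrm (x j) &
      forall r, nrm (sq s x r) <= et4].

Let lgood (s : conf) (L : {set 'I_b}) : Prop :=
  ~ compressible val (fun k r => e r k) (fun _ _ => 0) (~: L) rh et w s.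

Let evt' s L j := evt s L j /\ lgood s (j |: L).

(** The number of sequences of [n] columns, each close to the span of the columns not yet used. The
    mean of this count factors: resampling column [j] does not affect the chains that start from
    [j |: L], so each step contributes at most [b * lo_bound]. *)
Fixpoint chains (s : conf) (n : nat) (L : {set 'I_b}) : R :=
  if n is n.+1 then \sum_j (`[< evt' s L j >])%:R * chains s n (j |: L) else 1.

Let colset j := [set e r j | r in setT].

Let col_out (s t : conf) j r k : k != j -> resample (colset j) s t (e r k) = s (e r k).
Proof.
move=> kj; rewrite resample_notin //; apply/imsetP => -[r' _ /e_inj[_ h]].
by rewrite h eqxx in kj.
Qed.

Let col_in (s t : conf) j r : resample (colset j) s t (e r j) = t (e r j).
Proof. by rewrite resample_in // imset_f. Qed.

Let lgood_inv (s t : conf) (L : {set 'I_b}) j : j \in L -> lgood (resample (colset j) s t) L = lgood s L.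
Proof.
move=> jL.
have E u k : k \in ~: L ->
    app val (fun k r => e r k) (fun _ _ => 0) (resample (colset j) s t) u k =
    app val (fun k r => e r k) (fun _ _ => 0) s u k.
  rewrite inE => kL; apply: eq_bigr => r _; rewrite col_out //.
  by apply: contraNneq kL => ->.
congr (~ _); apply/propext; split=> -[x [h1 h2 h3 h4]]; exists x; split=> // r rL.
  by rewrite -E // h3.
by rewrite E // h3.
Qed.

Let evt_inv (s t : conf) (L : {set 'I_b}) j i : j \in L -> evt (resample (colset j) s t) L i = evt s L i.
Proof.
move=> jL.
have E (x : 'I_b -> R[i]) r : (forall i, i \in L -> x i = 0) ->
    sq (resample (colset j) s t) x r = sq s x r.
  move=> xL; apply: eq_bigr => k _.
  have [->|kj] := eqVneq k j; first by rewrite xL // !mulr0.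
  by rewrite col_out.
apply/propext; split=> -[x [h1 h2 h3 h4]]; exists x; split=> // r.
  by rewrite -(E _ _ h1).
by rewrite E.
Qed.

Let chains_inv (s t : conf) n (L : {set 'I_b}) j : j \in L ->
  chains (resample (colset j) s t) n L = chains s n L.
Proof.
elim: n L => [//|n IH] L jL /=; apply: eq_bigr => i _; rewrite IH ?inE ?jL ?orbT //.
by rewrite /evt' evt_inv // lgood_inv // !inE jL orbT.
Qed.

Let chains_ge0 s n L : 0 <= chains s n L.
Proof. by elim: n L => [|n IH] L //=; apply: sumr_ge0 => j _; rewrite mulr_ge0. Qed.

(** A left null vector [u] of the columns outside [j |: L] exists by dimension and is spread out by
    [lgood]. Pairing [u] with the image of [x] leaves only [x j] times the form of [u] on column
    [j], which is therefore confined to a small disc. *)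
Let evt_prob (s : conf) L j : Pr (fun t => evt' (resample (colset j) s t) L j) <= lo_bound.
Proof.
have [lg|nlg] := pselect (lgood s (j |: L)); last first.
  apply: le_trans lo_bound_ge0; rewrite -(ex_cst I mu_sum1 0); apply: ex_le => // t.
  by rewrite asboolF // => -[_]; rewrite lgood_inv // !inE eqxx.
have card_lt : (#|~: (j |: L)| < #|'I_b|)%N.
  by rewrite -(cardsC (j |: L)) -[X in (X < _)%N]add0n ltn_add2r card_gt0;
      apply/set0Pn; exists j; rewrite !inE eqxx.
have [u [u1 u2 u3]] := unit_kernel_vector (fun r k => val (s (e r k))) card_lt.
have wK : (w < #|[set r | (rh <= nrm (u r))%R]|)%N.
  rewrite ltnNge; apply/negP => hw; apply: lg; exists u; split=> // k kL.
  rewrite /app (eq_bigr (fun r => val (s (e r k)) * u r)); last by move=> r _; rewrite addr0.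
  by rewrite u3 // nrm0.
have ej : injective (e^~ j) by move=> r r' /e_inj[].
apply: le_trans (lo_bound_le wK).
apply: le_trans (littlewood_offord_inj mu_ge0 mu_sum1 c0_gt0 c1_gt0 spread ej
  (K := [set r | (rh <= nrm (u r))%R]) (x := u) 0 rh_gt0 _); last by move=> k; rewrite inE.
apply: pr_le => // t -[[x [x1 x2 x3 x4]] _].
rewrite subr0 -(ltr_pM2l rh_gt0); apply: le_lt_trans et4_small.
apply: (@le_trans _ _ (nrm (\sum_r u r * sq (resample (colset j) s t) x r))).
  have -> : \sum_r u r * sq (resample (colset j) s t) x r =
      x j * \sum_r u r * val (t (e r j)).
    under eq_bigr do rewrite /sq mulr_sumr.
    rewrite exchange_big (bigD1 j) //= [X in _ + X]big1 ?addr0.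
      by rewrite mulr_sumr; apply: eq_bigr => r _; rewrite col_in; ring.
    move=> k kj; have [kL|kL] := boolP (k \in L).
      by rewrite big1 // => r _; rewrite x1 // !mulr0.
    transitivity (x k * \sum_r val (s (e r k)) * u r).
      by rewrite mulr_sumr; apply: eq_bigr => r _; rewrite col_out //; ring.
    by rewrite u3 ?mulr0 // !inE negb_or kj.
  by rewrite nrmM ler_wpM2r ?nrm_ge0.
apply: le_trans (nrm_sum _ _) _.
have -> : b%:R * et4 = \sum_(r < b) et4 by rewrite sumr_const card_ord mulr_natl.
apply: ler_sum => r _; rewrite nrmM; apply: le_trans (x4 r).
by rewrite ler_piMl ?nrm_ge0.
Qed.

Let chains_mean n L : ex (fun s => chains s n L) <= (b%:R * lo_bound) ^+ n.
Proof.
elim: n L => [|n IH] L /=; first by rewrite ex_cst ?expr0.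
rewrite (@ex_sum R S I mu 'I_b predT (fun j s => (`[< evt' s L j >])%:R * chains s n (j |: L))).
apply: (@le_trans _ _ (\sum_(j < b) lo_bound * (b%:R * lo_bound) ^+ n)).
  apply: ler_sum => j _.
  apply: (@le_trans _ _ (lo_bound * ex (fun s => chains s n (j |: L)))); last first.
    by rewrite ler_wpM2l ?lo_bound_ge0.
  rewrite (@eq_ex _ _ _ _ _ (fun s => chains s n (j |: L) * (`[< evt' s L j >])%:R)); last first.
    by move=> s; rewrite mulrC.
  apply: (ex_cond mu_ge0 mu_sum1 (J := colset j)).
  - by move=> s; apply: chains_ge0.
  - by move=> s t; apply: chains_inv; rewrite !inE eqxx.
  - by move=> s _; apply: evt_prob.
by rewrite sumr_const card_ord exprS -[leRHS]mulrA -[leLHS]mulr_natl.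
Qed.

(** On a bad matrix every [L] with at most [n] elements leaves a near null vector supported outside
    [L]; being incompressible, it offers more than [w] choices for the next column. *)
Let chains_lower (s : conf) n m (L : {set 'I_b}) :
  bad n s -> ~ compressible val e (fun _ _ => 0) setT rh et w s ->
  (forall L' : {set 'I_b}, (#|L'| <= n.+1)%N -> lgood s L') -> (#|L| + m <= n.+1)%N ->
  w.+1%:R ^+ m <= chains s m L.
Proof.
move=> bs cs lg; elim: m L => [|m IH] L Lm /=; first by rewrite expr0.
have Ln : (#|L| <= n)%N by lia.
have /bs := Ln; rewrite /good => /existsNP[x /not_implyP[x1 /not_implyP[x2 /not_implyP[x3 x4]]]].
have x5 r : nrm (sq s x r) <= et4.
  by rewrite leNgt; apply/negP => h; apply: x4; exists r.
have wK : (w < #|[set k | (rh <= nrm (x k))%R]|)%N.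
  rewrite ltnNge; apply/negP => hw; apply: cs; exists x; split=> // r _.
  rewrite /app (eq_bigr (fun k => val (s (e r k)) * x k)); last by move=> k _; rewrite addr0.
  exact: le_trans (x5 r) et4_le.
apply: (@le_trans _ _ (\sum_(j in [set k | (rh <= nrm (x k))%R]) w.+1%:R ^+ m)).
  by rewrite sumr_const exprS -[leRHS]mulr_natl ler_wpM2r ?exprn_ge0 // ler_nat.
rewrite big_mkcond; apply: ler_sum => j _; rewrite inE.
case: ifP => hj; last by rewrite mulr_ge0.
have jL : (#|j |: L| <= #|L|.+1)%N by rewrite cardsU1 -add1n leq_add2r leq_b1.
rewrite asboolT ?mul1r; first by apply: IH; apply: leq_trans Lm; rewrite addnS -addSn leq_add2r.
split; last by apply: lg; apply: leq_trans jL _; rewrite ltnS.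
by exists x.
Qed.

(** Markov's inequality for the number of chains of length [n + 1]. With [w] proportional to [b],
    each allowed exceptional column improves the last term by a further factor of order
    [b^(-1/2)]. *)
Lemma bad_prob n : (n < 3)%N -> (0 < b)%N ->
  Pr (bad n) <= dl + (b.+1 ^ n.+1)%:R * dl + (b%:R * lo_bound / w.+1%:R) ^+ n.+1.
Proof.
move=> n3 b0.
(* Sets with at most [n + 1] elements are listed by functions, the value [None] allowing smaller
   sets. As [n < 3], at least [b - 3] columns remain outside such a set. *)
pose Lf (f : {ffun 'I_n.+1 -> option 'I_b}) : {set 'I_b} := [set j | Some j \in codom f].
have LfP (L : {set 'I_b}) : (#|L| <= n.+1)%N -> exists f, Lf f = L.
  move=> Ln; exists [ffun i : 'I_n.+1 => nth None (map Some (enum L)) i]; apply/setP => j; rewrite inE.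
  apply/codomP/idP => [h|jL].
    case: h => i; rewrite ffunE; have [iL|iL] := ltnP i (size (enum L)).
      by rewrite (nth_map j) //; case=> ->; rewrite -mem_enum mem_nth.
    by rewrite nth_default // size_map.
  have jn : (index j (enum L) < n.+1)%N by apply: leq_trans Ln; rewrite cardE index_mem mem_enum.
  by exists (Ordinal jn); rewrite ffunE /= (nth_map j) ?nth_index ?index_mem ?mem_enum.
have card_Lf f : (#|Lf f| <= n.+1)%N.
  have -> : Lf f = [set j in pmap id (codom f)].
    by apply/setP => j; rewrite !inE mem_pmap map_id.
  rewrite cardsE; apply: leq_trans (card_size _) _; rewrite size_pmap.
  by apply: leq_trans (count_size _ _) _; rewrite size_map -cardE card_ord.
apply: (@le_trans _ _ (Pr (fun s => compressible val e (fun _ _ => 0) setT rh et w s \/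
   ((exists f, ~ lgood s (Lf f)) \/ w.+1%:R ^+ n.+1 <= chains s n.+1 set0)))).
  apply: pr_le => // s bs.
  have [|cs] := pselect (compressible val e (fun _ _ => 0) setT rh et w s); first by left.
  right; have [|nl] := pselect (exists f, ~ lgood s (Lf f)); first by left.
  right; apply: (chains_lower bs cs); last by rewrite cards0.
  move=> L' /LfP[f <-]; apply: contrapT => h; apply: nl; by exists f.
apply: le_trans (pr_or mu_ge0 _ _) _; rewrite -addrA; apply: lerD.
  by apply: incompr => //; rewrite cardsT card_ord leq_subr.
apply: le_trans (pr_or mu_ge0 _ _) _; apply: lerD.
  apply: le_trans (pr_exT mu_ge0 _) _.
  have -> : (b.+1 ^ n.+1)%:R * dl = \sum_(f : {ffun 'I_n.+1 -> option 'I_b}) dl.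
    by rewrite sumr_const card_ffun card_option !card_ord mulr_natl.
  apply: ler_sum => f _.
  apply: (@le_trans _ _ (Pr (compressible val (fun k r => e r k) (fun _ _ => 0) (~: Lf f) rh et w))).
    by apply: pr_le => // s /contrapT.
  apply: incompr => [r k r' k' /e_inj[]//|].
  by rewrite cardsCs setCK card_ord leq_sub2l // (leq_trans (card_Lf f)).
rewrite expr_div_n.
apply: le_trans (markov_ex mu_ge0 (f := fun s => chains s n.+1 set0)
  (c := w.+1%:R ^+ n.+1) _ _ _) _.
- by rewrite exprn_gt0.
- by move=> s; apply: chains_ge0.
- by [].
- by rewrite ler_wpM2r ?invr_ge0 ?exprn_ge0 // chains_mean.
Qed.

End Square.

(** * An arc of block columns *)

Section Arc.
Variables (R : realType) (S : finType) (mu : S -> R) (val : S -> R[i]) (c0 c1 : R).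
Hypothesis mu_ge0 : forall s, 0 <= mu s.
Hypothesis mu_sum1 : \sum_s mu s = 1.
Hypothesis c0_gt0 : 0 < c0.
Hypothesis c1_gt0 : 0 < c1.
Hypothesis spread : forall z : R[i], \sum_s mu s * (nrm (val s - z) < c0)%R%:R <= 1 - c1.
Variables (I : finType) (b w : nat) (rh et et4 dl p1 p3 : R).
Hypothesis b_gt0 : (0 < b)%N.
Hypothesis wb : (4 * w.+1 <= b)%N.
Hypothesis rh_gt0 : 0 < rh.
Hypothesis et_ge0 : 0 <= et.
Hypothesis et4_gt0 : 0 < et4.
Hypothesis et4_le1 : et4 <= 1.

Local Notation Pr := (@pr R S I mu).
Local Notation conf := {ffun I -> S}.
Local Notation lo := (lo_bound c1 w).

Hypothesis incompr : forall (Rw Cl : finType) (e : Rw -> Cl -> I) (Z : Rw -> Cl -> R[i]),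
  (forall r k r' k', e r k = e r' k' -> r = r' /\ k = k') ->
  (forall x r k, nrm (val x + Z r k) <= 3 * b%:R) ->
  forall RS : {set Rw}, (b - 3 <= #|RS|)%N -> (#|Cl| <= 3 * b)%N ->
  Pr (compressible val e Z RS rh et w) <= dl.

Hypothesis bad0 : forall e : 'I_b -> 'I_b -> I,
  (forall r k r' k', e r k = e r' k' -> r = r' /\ k = k') -> Pr (bad val et4 e 0) <= p1.
Hypothesis bad2 : forall e : 'I_b -> 'I_b -> I,
  (forall r k r' k', e r k = e r' k' -> r = r' /\ k = k') -> Pr (bad val et4 e 2) <= p3.

Lemma bad_ext (e : 'I_b -> 'I_b -> I) n (s s' : conf) :
  (forall r k, s (e r k) = s' (e r k)) -> bad val et4 e n s = bad val et4 e n s'.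
Proof.
move=> ss'; have E x r : sq val e s x r = sq val e s' x r.
  by apply: eq_bigr => k _; rewrite ss'.
by apply/propext; split=> h L Ln g; apply: (h L Ln) => x x1 x2 x3;
  have [r hr] := g x x1 x2 x3; exists r; rewrite ?E // -E.
Qed.

Lemma compressible_ext (Rw Cl : finType) (e : Rw -> Cl -> I) Z (RS : {set Rw}) (s s' : conf) :
  (forall r k, r \in RS -> s (e r k) = s' (e r k)) ->
  compressible val e Z RS rh et w s = compressible val e Z RS rh et w s'.
Proof.
move=> ss'; have E x r : r \in RS -> app val e Z s x r = app val e Z s' x r.
  by move=> rRS; apply: eq_bigr => k _; rewrite ss'.
by apply/propext; split=> -[x [h1 h2 h3 h4]]; exists x; split=> // r rRS; rewrite ?E ?h3 // -E ?h3.
Qed.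

Lemma good_scale (e : 'I_b -> 'I_b -> I) (s : conf) (L : {set 'I_b}) (x : 'I_b -> R[i]) B :
  good val et4 e s L -> (forall j, j \in L -> x j = 0) -> (forall r, nrm (sq val e s x r) <= B) ->
  forall k, et4 * nrm (x k) <= B.
Proof.
move=> g xL xB k.
have B0 : 0 <= B by apply: le_trans (xB k); exact: nrm_ge0.
have [->|xk] := eqVneq (x k) 0; first by rewrite nrm0 mulr0.
have [c cn0 [cx1 cx2]] := normalize_max (ex_intro _ k xk).
have [j jL|r hr] := g (fun i => c * x i) _ cx1 cx2; first by rewrite xL // mulr0.
have nc : 0 < nrm c by rewrite nrm_gt0.
have : et4 < nrm c * B.
  apply: lt_le_trans hr _; rewrite /sq.
  under eq_bigr do rewrite mulrCA.
  by rewrite -mulr_sumr nrmM ler_wpM2l ?nrm_ge0 // xB.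
move=> h; rewrite -(ler_pM2l nc) mulrCA; apply: le_trans (ltW h).
by rewrite ler_piMr ?(ltW et4_gt0) // -nrmM.
Qed.

(** Each vector vanishes on the index sets of the earlier ones, so event [q] ignores the coordinates
    [K p] with [p < q], the triangular form required by [pr_chain]. With all else frozen, event [q]
    is Littlewood-Offord on [K q]. *)
Lemma chain_concentration (Cl : finType) (f : Cl -> I) (n : nat) (x : nat -> Cl -> R[i])
    (K : nat -> {set Cl}) (z : nat -> R[i]) (a : R) :
  injective f -> 0 < a ->
  (forall q, (q < n)%N -> (w < #|K q|)%N /\ forall k, k \in K q -> a <= nrm (x q k)) ->
  (forall p q, (p < q < n)%N -> forall k, k \in K p -> x q k = 0) ->
  Pr (fun t => forall q, (q < n)%N -> nrm (\sum_k x q k * val (t (f k)) - z q) < a * c0 / 2)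
    <= lo ^+ n.
Proof.
move=> f_inj a0 hK hx.
apply: (pr_chain mu_ge0 mu_sum1 (J := fun q => f @: K q)
  (E := fun q t => nrm (\sum_k x q k * val (t (f k)) - z q) < a * c0 / 2)).
- exact: lo_bound_ge0.
- move=> q qn s; have [wK aK] := hK q qn.
  apply: le_trans (lo_bound_le c1_gt0 wK).
  pose x' k := if k \in K q then x q k else 0.
  pose z' := z q - \sum_(k | k \notin K q) x q k * val (s (f k)).
  apply: le_trans (littlewood_offord_inj mu_ge0 mu_sum1 c0_gt0 c1_gt0 spread f_inj
    (K := K q) (x := x') z' a0 _); last by move=> k kK; rewrite /x' kK aK.
  apply: pr_le => // t; set u := (X in nrm X); set v := (X in _ -> nrm X < _).
  pose A := \sum_(k in K q) x q k * val (t (f k)).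
  have uE : u = A + (z q - z') - z q.
    have -> : z q - z' = \sum_(k | k \notin K q) x q k * val (s (f k)) by rewrite /z'; ring.
    rewrite /u (bigID (mem (K q))) /=; congr (_ + _ - _).
      by apply: eq_bigr => k kK; rewrite resample_in // imset_f.
    by apply: eq_bigr => k kK; rewrite resample_notin // mem_imset.
  have vE : v = A - z'.
    rewrite /v (bigID (mem (K q))) /= [X in _ + X - _]big1 ?addr0; last first.
      by move=> k /negbTE kK; rewrite /x' kK mul0r.
    by congr (_ - _); apply: eq_bigr => k kK; rewrite /x' kK.
  by rewrite uE vE (_ : A + (z q - z') - z q = A - z') //; ring.
- move=> p q pq s t; congr (is_true (nrm (_ - _) < _)).
  apply: eq_bigr => k _; have [kK|kK] := boolP (k \in K p); first by rewrite (hx p q) ?mul0r.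
  by rewrite resample_notin // mem_imset.
Qed.

Variables (l : nat) (e : 'I_3 -> 'I_l -> 'I_b -> 'I_b -> I) (Z : 'I_3 -> 'I_b -> 'I_b -> R[i]).
Hypothesis e_inj : forall o t r k o' t' r' k',
  e o t r k = e o' t' r' k' -> [/\ o = o', t = t', r = r' & k = k'].
Hypothesis Z0 : forall r k, Z ord0 r k = 0.
Hypothesis Z2 : forall r k, Z ord_max r k = 0.
Hypothesis entry_le : forall x o r k, nrm (val x + Z o r k) <= 3 * b%:R.

Local Notation X := ('I_l.+2 * 'I_b)%type.
Local Notation Y := ('I_l * 'I_b)%type.

(** Block column [t] of the arc meets the block rows [t], [t+1] and [t+2], so [l] block columns face
    [l + 2] block rows. *)
Definition arow (t : 'I_l) (o : 'I_3) : 'I_l.+2 := inord (t + o).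

Lemma arowE t o : arow t o = (t + o)%N :> nat.
Proof.
rewrite inordK //; case: t => t ht; case: o => o ho /=; clear -ht ho; lia.
Qed.

Definition ent (s : conf) (x : X) (y : Y) : R[i] :=
  \sum_(p : 'I_3 * 'I_b | (arow y.1 p.1, p.2) == x) (val (s (e p.1 y.1 p.2 y.2)) + Z p.1 p.2 y.2).

Definition arc_bad (tau : R) (s : conf) : Prop := exists v : Y -> R[i],
  [/\ forall y, nrm (v y) <= 1, exists y, nrm (v y) = 1 &
      forall x, nrm (\sum_y ent s x y * v y) <= tau].

Definition acol (s : conf) (u : X -> R[i]) (y : Y) : R[i] :=
  \sum_p (val (s (e p.1 y.1 p.2 y.2)) + Z p.1 p.2 y.2) * u (arow y.1 p.1, p.2).

Lemma acolE s u y : \sum_x ent s x y * u x = acol s u y.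
Proof.
under eq_bigr do rewrite /ent mulr_suml.
rewrite (exchange_big_dep xpredT) //=; apply: eq_bigr => p _.
by rewrite (big_pred1 (arow y.1 p.1, p.2)) // => x; rewrite eq_sym.
Qed.

Lemma arc_pairing s u v :
  \sum_x u x * (\sum_y ent s x y * v y) = \sum_y v y * acol s u y.
Proof.
under eq_bigr do rewrite mulr_sumr.
rewrite exchange_big; apply: eq_bigr => y _ /=; rewrite -acolE mulr_sumr.
by apply: eq_bigr => x _; ring.
Qed.

Definition eU t (k r : 'I_b) := e ord0 t r k.
Definition eT t (k r : 'I_b) := e ord_max t r k.

Lemma eU_inj t r k r' k' : eU t r k = eU t r' k' -> r = r' /\ k = k'.
Proof. by move=> /e_inj[]. Qed.

Lemma eT_inj t r k r' k' : eT t r k = eT t r' k' -> r = r' /\ k = k'.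
Proof. by move=> /e_inj[]. Qed.

Lemma sum3 (G : 'I_3 -> R[i]) : \sum_o G o = G ord0 + G (inord 1) + G ord_max.
Proof.
rewrite !big_ord_recl big_ord0 addr0 addrA; congr (_ + _ + _); congr G; apply: val_inj => //=.
by rewrite inordK.
Qed.

Lemma acol3 s u t k : acol s u (t, k) =
  sq val (eU t) s (fun r => u (arow t ord0, r)) k
  + \sum_r (val (s (e (inord 1) t r k)) + Z (inord 1) r k) * u (arow t (inord 1), r)
  + sq val (eT t) s (fun r => u (arow t ord_max, r)) k.
Proof.
rewrite /acol -(pair_bigA _ (fun o r => (val (s (e o t r k)) + Z o r k) * u (arow t o, r))) /=.
rewrite sum3; congr (_ + _ + _); apply: eq_bigr => r _.
  by rewrite Z0 addr0.
by rewrite Z2 addr0.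
Qed.

(** Loss of one substitution step: two known blocks contribute [b] terms each, with entries of
    modulus at most [3b], over [b] coordinates of slack, and inverting the third block costs
    [1 / et4]. *)
Definition Q : R := 6 * b%:R ^+ 2 / et4.

Lemma Q_ge1 : 1 <= Q.
Proof.
rewrite /Q ler_pdivlMr // mul1r; apply: (le_trans et4_le1).
have b1 : 1 <= b%:R :> R by rewrite ler1n.
by have := exprn_ege1 2 b1; lra.
Qed.

Section Substitution.
Variables (s : conf) (t0 : 'I_l) (k0 : 'I_b) (u : X -> R[i]) (LU LT : 'I_l -> {set 'I_b}) (al : R).
Hypothesis goodU : forall t : 'I_l, (t < t0)%N -> good val et4 (eU t) s (LU t).
Hypothesis goodT : forall t : 'I_l, (t0 < t)%N -> good val et4 (eT t) s (LT t).
Hypothesis uU : forall (t : 'I_l) r, (t < t0)%N -> r \in LU t -> u (arow t ord0, r) = 0.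
Hypothesis uT : forall (t : 'I_l) r, (t0 < t)%N -> r \in LT t -> u (arow t ord_max, r) = 0.
Hypothesis u_ker : forall y, y != (t0, k0) -> acol s u y = 0.
Hypothesis u_al : forall o r, nrm (u (arow t0 o, r)) <= al.

Let al0 : 0 <= al.
Proof. exact: le_trans (nrm_ge0 _) (u_al ord0 k0). Qed.

Let Qmono d d' : (d <= d')%N -> Q ^+ d * al <= Q ^+ d' * al.
Proof. by move=> dd'; rewrite ler_wpM2r // ler_weXn2l // Q_ge1. Qed.

Let triple (i : 'I_l.+2) r : (t0 <= i <= t0.+2)%N -> nrm (u (i, r)) <= al.
Proof.
move=> /andP[h1 h2].
have ho : (i - t0 < 3)%N by clear -h1 h2; lia.
have -> : i = arow t0 (Ordinal ho) by apply: val_inj; rewrite [RHS]arowE /= subnKC.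
exact: u_al.
Qed.

Let row_le (o : 'I_3) (t : 'I_l) k (B : R) : (forall r, nrm (u (arow t o, r)) <= B) ->
  nrm (\sum_r (val (s (e o t r k)) + Z o r k) * u (arow t o, r)) <= 3 * b%:R ^+ 2 * B.
Proof.
move=> hB; apply: le_trans (nrm_sum _ _) _.
have -> : 3 * b%:R ^+ 2 * B = \sum_(r < b) (3 * b%:R * B).
  by rewrite sumr_const card_ord -[RHS]mulr_natl; ring.
by apply: ler_sum => r _; rewrite nrmM ler_pM ?nrm_ge0.
Qed.

(** The equations of block column [i] express block row [i] through the block rows [i+1] and [i+2],
    already bounded; the first block can be inverted because [u] vanishes on its exceptional set. *)
Let down (d : nat) (i : 'I_l.+2) r : (i <= t0.+2)%N -> (t0 <= i + d)%N -> nrm (u (i, r)) <= Q ^+ d * al.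
Proof.
elim: d i r => [|d IH] i r h1 h2.
  by rewrite expr0 mul1r triple // h1 andbT -(addn0 i).
have [h3|h3] := leqP t0 (i + d)%N.
  exact: le_trans (IH i r h1 h3) (Qmono (leqnSn d)).
have it : (i < t0)%N by clear -h2 h3; lia.
have il : (i < l)%N := ltn_trans it (ltn_ord t0).
pose t := Ordinal il.
have ei : i = arow t ord0 by apply: val_inj; rewrite [RHS]arowE addn0.
have tt0 : (t < t0)%N by [].
have hB (o : 'I_3) r' : (0 < o)%N -> nrm (u (arow t o, r')) <= Q ^+ d * al.
  move=> o0; apply: IH; rewrite arowE /=; last by clear -h2 o0; lia.
  by have := ltn_ord o; clear -it; lia.
have bound k : nrm (sq val (eU t) s (fun r => u (arow t ord0, r)) k) <= 6 * b%:R ^+ 2 * (Q ^+ d * al).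
  have := acol3 s u t k; rewrite u_ker; last first.
    by apply/eqP => -[h _]; move: tt0; rewrite h ltnn.
  move/esym/eqP; rewrite -addrA addr_eq0 => /eqP ->; rewrite nrmN.
  apply: le_trans (nrmD _ _) _.
  have -> : 6 * b%:R ^+ 2 * (Q ^+ d * al) =
     3 * b%:R ^+ 2 * (Q ^+ d * al) + 3 * b%:R ^+ 2 * (Q ^+ d * al) by ring.
  apply: lerD; first by apply: row_le => r'; apply: hB; rewrite inordK.
  rewrite (_ : sq _ _ _ _ _ = \sum_r (val (s (e ord_max t r k)) + Z ord_max r k) * u (arow t ord_max, r)).
    by apply: row_le => r'; apply: hB.
  by apply: eq_bigr => r' _; rewrite Z2 addr0.
have := good_scale (goodU tt0) (fun r => uU tt0 (r := r)) bound r.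
rewrite ei -ler_pdivlMl // => /le_trans; apply.
by rewrite (exprS Q d) -[leRHS]mulrA; move: (Q ^+ d * al) => y; rewrite /Q mulrA [et4^-1 * _]mulrC.
Qed.

(** The mirror image: beyond [t0], the last block of block column [i - 2] is inverted. *)
Let up (d : nat) (i : 'I_l.+2) r : (t0 <= i)%N -> (i <= t0.+2 + d)%N -> nrm (u (i, r)) <= Q ^+ d * al.
Proof.
elim: d i r => [|d IH] i r h1 h2.
  by rewrite expr0 mul1r triple // h1 -(addn0 t0.+2).
have [h3|h3] := leqP i (t0.+2 + d)%N.
  exact: le_trans (IH i r h1 h3) (Qmono (leqnSn d)).
have il : (i - 2 < l)%N by have := ltn_ord i; clear -h3; lia.
pose t := Ordinal il.
have ei : i = arow t ord_max by apply: val_inj; rewrite [RHS]arowE /=; clear -h3; lia.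
have tt0 : (t0 < t)%N by rewrite /=; clear -h3; lia.
have hB (o : 'I_3) r' : (o < 2)%N -> nrm (u (arow t o, r')) <= Q ^+ d * al.
  by move=> o0; apply: IH; rewrite arowE /=; clear -h2 h3 o0; lia.
have bound k : nrm (sq val (eT t) s (fun r => u (arow t ord_max, r)) k) <= 6 * b%:R ^+ 2 * (Q ^+ d * al).
  have := acol3 s u t k; rewrite u_ker; last first.
    by apply/eqP => -[h _]; move: tt0; rewrite h ltnn.
  move/esym/eqP; rewrite addrC addr_eq0 => /eqP ->; rewrite nrmN.
  apply: le_trans (nrmD _ _) _.
  have -> : 6 * b%:R ^+ 2 * (Q ^+ d * al) =
     3 * b%:R ^+ 2 * (Q ^+ d * al) + 3 * b%:R ^+ 2 * (Q ^+ d * al) by ring.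
  apply: lerD; last by apply: row_le => r'; apply: hB; rewrite inordK.
  rewrite (_ : sq _ _ _ _ _ = \sum_r (val (s (e ord0 t r k)) + Z ord0 r k) * u (arow t ord0, r)).
    by apply: row_le => r'; apply: hB.
  by apply: eq_bigr => r' _; rewrite Z0 addr0.
have := good_scale (goodT tt0) (fun r => uT tt0 (r := r)) bound r.
rewrite ei -ler_pdivlMl // => /le_trans; apply.
by rewrite (exprS Q d) -[leRHS]mulrA; move: (Q ^+ d * al) => y; rewrite /Q mulrA [et4^-1 * _]mulrC.
Qed.

Lemma substitution x : nrm (u x) <= Q ^+ l * al.
Proof.
case: x => i r; have [h|h] := leqP i t0.+2.
  apply: le_trans (@down t0 i r h (leq_addl _ _)) _.
  exact: Qmono (ltnW (ltn_ord t0)).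
apply: le_trans (@up (i - t0.+2) i r _ _) _.
- by clear -h; lia.
- by clear -h; lia.
- by apply: Qmono; have := ltn_ord i; clear -h; lia.
Qed.

End Substitution.
(** Conditions under which the null vectors for column [y] are built. None of them reads column [y],
    so it can be resampled given them. Block columns before [y.1] are solved through their first
    block, those after it through their last. *)
Definition arc_hyp (y : Y) (s : conf) : Prop :=
  [/\ forall t : 'I_l, (t < y.1)%N -> ~ bad val et4 (eU t) 2 s,
      forall t : 'I_l, (y.1 < t)%N -> ~ bad val et4 (eT t) 2 s,
      (2 * (#|[set t : 'I_l | (t < y.1)%N && `[< bad val et4 (eU t) 0 s >]]|
         + #|[set t : 'I_l | (y.1 < t)%N && `[< bad val et4 (eT t) 0 s >]]|) <= b)%N &
      ~ compressible val (fun k p => e p.1 y.1 p.2 k) (fun k p => Z p.1 p.2 k)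
          (~: [set y.2]) rh et w s].

Lemma card_bigcup_le (T J : finType) (P : pred J) (F : J -> {set T}) :
  (#|\bigcup_(j | P j) F j| <= \sum_(j | P j) #|F j|)%N.
Proof.
elim/big_rec2: _ => [|j B n _ IH]; first by rewrite cards0.
by apply: leq_trans (leq_card_setU _ _) _; rewrite leq_add2l.
Qed.

Lemma exceptional_sets (s : conf) (P : pred 'I_l) (eV : 'I_l -> 'I_b -> 'I_b -> I) :
  (forall t, P t -> ~ bad val et4 (eV t) 2 s) ->
  exists L : 'I_l -> {set 'I_b}, (forall t, P t -> good val et4 (eV t) s (L t)) /\
    (\sum_(t | P t) #|L t| <= 2 * #|[set t | P t && `[< bad val et4 (eV t) 0 s >]]|)%N.
Proof.
move=> hP.
have /choice[L LP] : forall t, exists L : {set 'I_b}, P t ->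
    good val et4 (eV t) s L /\ (#|L| <= 2 * `[< bad val et4 (eV t) 0 s >])%N.
  move=> t; have [Pt|_] := boolP (P t); last by exists set0.
  have [b0|nb0] := pselect (bad val et4 (eV t) 0 s).
    have /existsNP[L /not_implyP[L2 /contrapT g]] := hP t Pt.
    by exists L => _; rewrite asboolT.
  have /existsNP[L /not_implyP[L2 /contrapT g]] := nb0.
  by exists L => _; split=> //; apply: leq_trans L2 _.
exists L; split=> [t /LP[]//|].
rewrite -sum1_card big_distrr /= [leqRHS]big_mkcond [leqLHS]big_mkcond /=.
apply: leq_sum => t _; rewrite inE; case: ifP => //= Pt.
have [_] := LP t Pt; by case: (`[< _ >]).
Qed.

(** Dimension count: [(l+2) b] unknowns, against [l b - 1] column equations and at most [2b]
    prescribed zeros, half of them for the exceptional sets and half for [V1]. By substitution the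
    maximum of [u] on the three block rows of [y0.1] is at least [Q^(-l)], and incompressibility
    spreads [u] over more than [w] coordinates there. *)
Lemma arc_step (s : conf) (y0 : Y) (V1 : {set 'I_3 * 'I_b}) :
  arc_hyp y0 s -> (#|V1| <= 4 * w.+1)%N ->
  exists (u : X -> R[i]) (K : {set 'I_3 * 'I_b}),
    [/\ forall x, nrm (u x) <= 1, forall y, y != y0 -> acol s u y = 0,
        forall p, p \in V1 -> u (arow y0.1 p.1, p.2) = 0, #|K| = w.+1 &
        forall p, p \in K -> rh / Q ^+ l <= nrm (u (arow y0.1 p.1, p.2))].
Proof.
case: y0 => t0 k0 [/= hU hT hcnt hcomp] hV1.
have [LU [LUg LUc]] := exceptional_sets (P := fun t => (t < t0)%N) hU.
have [LT [LTg LTc]] := exceptional_sets (P := fun t => (t0 < t)%N) hT.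
pose V := \bigcup_(t : 'I_l | (t < t0)%N) [set (arow t ord0, r) | r in LU t]
   :|: \bigcup_(t : 'I_l | (t0 < t)%N) [set (arow t ord_max, r) | r in LT t]
   :|: [set (arow t0 p.1, p.2) | p in V1].
have cV : (#|V| <= 2 * b)%N.
  apply: leq_trans (leq_card_setU _ _) _; rewrite mul2n -addnn; apply: leq_add; last first.
    by apply: leq_trans (leq_imset_card _ _) _; apply: leq_trans hV1 wb.
  apply: leq_trans (leq_card_setU _ _) _; apply: leq_trans hcnt; rewrite mulnDr; apply: leq_add.
    apply: leq_trans (card_bigcup_le _ _) (leq_trans _ LUc).
    by apply: leq_sum => t _; apply: leq_imset_card.
  apply: leq_trans (card_bigcup_le _ _) (leq_trans _ LTc).
  by apply: leq_sum => t _; apply: leq_imset_card.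
pose Ys : {set Y + X} := [set inl y | y in [set~ (t0, k0)]] :|: [set inr v | v in V].
pose A (x : X) (z : Y + X) : R[i] :=
  match z with inl y => ent s x y | inr v => (x == v)%:R end.
have cYs : (#|Ys| < #|{: X}|)%N.
  apply: leq_ltn_trans (leq_card_setU _ _) _.
  rewrite !card_imset; [|by move=> ? ? []|by move=> ? ? []].
  have lb : (0 < #|{: Y}|)%N by apply/card_gt0P; exists (t0, k0).
  rewrite cardsC1; apply: (@leq_ltn_trans (#|{: Y}|.-1 + 2 * b)); first by rewrite leq_add2l.
  rewrite -ltnS -addSn prednK //; rewrite !card_prod !card_ord; clear; lia.
have [u [u1 [x1 ux1] uA]] := unit_kernel_vector A cYs.
have u_ker y : y != (t0, k0) -> acol s u y = 0.
  move=> yy; rewrite -acolE; apply: (uA (inl y)).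
  by rewrite !inE imset_f // !inE.
have uV v : v \in V -> u v = 0.
  move=> vV; have := uA (inr v) _; rewrite !inE /= (imset_f inr) ?orbT // => /(_ isT) <-.
  rewrite (bigD1 v) //= eqxx mul1r big1 ?addr0 // => x /negbTE ->.
  by rewrite mul0r.
have uU (t : 'I_l) r : (t < t0)%N -> r \in LU t -> u (arow t ord0, r) = 0.
  by move=> tt rL; apply: uV; rewrite /V !inE; apply/orP; left; apply/orP; left;
    apply/bigcupP; exists t => //; apply: imset_f.
have uT (t : 'I_l) r : (t0 < t)%N -> r \in LT t -> u (arow t ord_max, r) = 0.
  by move=> tt rL; apply: uV; rewrite /V !inE; apply/orP; left; apply/orP; right;
    apply/bigcupP; exists t => //; apply: imset_f.
have uV1 p : p \in V1 -> u (arow t0 p.1, p.2) = 0.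
  by move=> pV; apply: uV; rewrite /V !inE; apply/orP; right;
    apply/imsetP; exists p.
pose x p := u (arow t0 p.1, p.2).
(* If the three block rows vanished, substitution with [al = 0] would annihilate [u]. *)
have xn0 : exists p, x p != 0.
  apply: contrapT => no.
  have x0 p : x p = 0 by apply/eqP; apply: contrapT => /negP h; apply: no; exists p.
  have al0 o r : nrm (u (arow t0 o, r)) <= 0 by rewrite -[u _]/(x (o, r)) x0 nrm0.
  have := substitution LUg LTg uU uT u_ker al0 x1.
  by rewrite ux1 mulr0 ler10.
have [c cn0 [cx1 cx2]] := normalize_max xn0.
have nc : 0 < nrm c by rewrite nrm_gt0.
have Ql0 : 0 < Q ^+ l by rewrite exprn_gt0 //; apply: lt_le_trans Q_ge1.
have ual o r : nrm (u (arow t0 o, r)) <= (nrm c)^-1.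
  by rewrite -[leRHS]mulr1 ler_pdivlMl // -nrmM; apply: (cx1 (o, r)).
have ncQ : nrm c <= Q ^+ l.
  have := substitution LUg LTg uU uT u_ker ual x1.
  by rewrite ux1 ler_pdivlMr // mul1r.
have wK : (w < #|[set p | (rh <= nrm (c * x p))%R]|)%N.
  rewrite ltnNge; apply/negP => hw; apply: hcomp; exists (fun p => c * x p); split=> // k kk.
  rewrite /app; under eq_bigr do rewrite mulrCA.
  rewrite -mulr_sumr -/(acol s u (t0, k)) u_ker ?mulr0 ?nrm0 //.
  by apply: contraTneq kk => -[->]; rewrite !inE eqxx.
(* Exactly [w + 1] coordinates are kept, so that four such sets respect the bound [4 (w + 1)] on
   [V1]. *)
exists u, [set p in take w.+1 (enum [set p | (rh <= nrm (c * x p))%R])]; split=> //.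
  rewrite cardsE (card_uniqP _) ?take_uniq ?enum_uniq // size_take -cardE.
  by case: ltnP => // h; apply/eqP; rewrite eqn_leq h wK.
move=> p; rewrite inE => /mem_take; rewrite mem_enum inE nrmM => h.
rewrite ler_pdivrMr //; apply: le_trans h _; rewrite mulrC.
by rewrite ler_wpM2l ?nrm_ge0.
Qed.

Lemma arc_chain (s : conf) (y0 : Y) n : arc_hyp y0 s -> (n <= 5)%N ->
  exists (u : nat -> X -> R[i]) (K : nat -> {set 'I_3 * 'I_b}),
    (forall q, (q < n)%N ->
      [/\ forall x, nrm (u q x) <= 1, forall y, y != y0 -> acol s (u q) y = 0,
        #|K q| = w.+1 &
        forall p, p \in K q -> rh / Q ^+ l <= nrm (u q (arow y0.1 p.1, p.2))]) /\
    (forall p q, (p < q < n)%N -> forall k, k \in K p -> u q (arow y0.1 k.1, k.2) = 0).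
Proof.
move=> hy; elim: n => [|n IH] n5.
  by exists (fun _ _ => 0), (fun=> set0); split=> // p q; rewrite andbC.
have [u [K [h1 h2]]] := IH (ltnW n5).
pose V1 := \bigcup_(q < n) K q.
have cV1 : (#|V1| <= 4 * w.+1)%N.
  apply: leq_trans (card_bigcup_le _ _) _.
  apply: (@leq_trans (\sum_(q < n) w.+1)).
    by apply: leq_sum => q _; have [_ _ -> _] := h1 q (ltn_ord q).
  by rewrite sum_nat_const card_ord leq_mul2r -ltnS n5 orbT.
have [u' [K' [a1 a2 a3 a4 a5]]] := arc_step hy cV1.
exists (fun q => if q == n then u' else u q), (fun q => if q == n then K' else K q); split.
  move=> q; rewrite ltnS leq_eqVlt; case: eqP => [-> _|_ /= qn]; first by split.
  exact: h1.
move=> p q /andP[pq qn] k.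
have pn : (p == n) = false by apply/eqP => pn; move: pq; rewrite pn; clear -qn; lia.
rewrite pn; have [qe|qe] := eqVneq q n => kK; last first.
  by apply: (h2 p q) => //; rewrite pq ltn_neqAle qe -ltnS qn.
apply: a3; apply/bigcupP; rewrite qe in pq.
by exists (Ordinal pq).
Qed.

Section ArcProbability.
Variable tau : R.
Hypothesis tau_small : l.+2%:R * b%:R * tau < rh / Q ^+ l * c0 / 2.

Let colset (y : Y) : {set I} := [set e p.1 y.1 p.2 y.2 | p in [set: 'I_3 * 'I_b]].

Let out_col (s t : conf) (y : Y) o t' r k :
  (t', k) != y -> resample (colset y) s t (e o t' r k) = s (e o t' r k).
Proof.
move=> yy; rewrite resample_notin //; apply/imsetP => -[p _ /e_inj[_ h1 _ h2]].
by case/eqP: yy; case: y h1 h2 => y1 y2 /= -> ->.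
Qed.

Let arc_hyp_inv (s t : conf) (y : Y) : arc_hyp y (resample (colset y) s t) = arc_hyp y s.
Proof.
have bU n (t' : 'I_l) : (t' != y.1) ->
    bad val et4 (eU t') n (resample (colset y) s t) = bad val et4 (eU t') n s.
  move=> ty; apply: bad_ext => r k; rewrite out_col //.
  by apply: contraNneq ty => <-.
have bT n (t' : 'I_l) : (t' != y.1) ->
    bad val et4 (eT t') n (resample (colset y) s t) = bad val et4 (eT t') n s.
  move=> ty; apply: bad_ext => r k; rewrite out_col //.
  by apply: contraNneq ty => <-.
have lt_ne (t' : 'I_l) : (t' < y.1)%N -> t' != y.1.
  by move=> h; apply: contraTneq h => ->; rewrite ltnn.
have gt_ne (t' : 'I_l) : (y.1 < t')%N -> t' != y.1.
  by move=> h; apply: contraTneq h => ->; rewrite ltnn.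
rewrite /arc_hyp.
have -> : [set t' : 'I_l | (t' < y.1)%N && `[< bad val et4 (eU t') 0 (resample (colset y) s t) >]]
   = [set t' : 'I_l | (t' < y.1)%N && `[< bad val et4 (eU t') 0 s >]].
  by apply/setP => t'; rewrite !inE; case: ltnP => //= /lt_ne h; rewrite bU.
have -> : [set t' : 'I_l | (y.1 < t')%N && `[< bad val et4 (eT t') 0 (resample (colset y) s t) >]]
   = [set t' : 'I_l | (y.1 < t')%N && `[< bad val et4 (eT t') 0 s >]].
  by apply/setP => t'; rewrite !inE; case: ltnP => //= /gt_ne h; rewrite bT.
rewrite (@compressible_ext _ _ _ _ _ (resample (colset y) s t) s); last first.
  move=> k p; rewrite !inE => ky; apply: out_col.
  by apply: contraNneq ky => <-.
apply/propext; split=> -[h1 h2 h3 h4]; split=> // t' ht'.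
- by rewrite -(bU 2%N t' (lt_ne _ ht')); apply: h1.
- by rewrite -(bT 2%N t' (gt_ne _ ht')); apply: h2.
- by rewrite (bU 2%N t' (lt_ne _ ht')); apply: h1.
- by rewrite (bT 2%N t' (gt_ne _ ht')); apply: h2.
Qed.

Let close_col (y : Y) (s : conf) : Prop := exists v : Y -> R[i],
  [/\ forall y, nrm (v y) <= 1, nrm (v y) = 1 & forall x, nrm (\sum_y ent s x y * v y) <= tau].

(** Each of the five null vectors annihilates the other columns, so pairing it with the near null
    vector isolates its form on column [y]; the five small discs are then chained. *)
Let close_col_prob (s : conf) (y : Y) : arc_hyp y s ->
  Pr (fun t => close_col y (resample (colset y) s t)) <= lo ^+ 5.
Proof.
move=> hy; have [u [K [h1 h2]]] := arc_chain hy (leqnn 5).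
pose f (p : 'I_3 * 'I_b) := e p.1 y.1 p.2 y.2.
have f_inj : injective f.
  by case=> [ o r] [ o' r'] /e_inj[/= -> _ -> _].
pose x q (p : 'I_3 * 'I_b) := u q (arow y.1 p.1, p.2).
pose z q := - \sum_p Z p.1 p.2 y.2 * x q p.
have a0 : 0 < rh / Q ^+ l.
  by rewrite divr_gt0 // exprn_gt0 //; apply: lt_le_trans Q_ge1.
apply: le_trans (chain_concentration (K := K) (x := x) z f_inj a0 _ h2); last first.
  by move=> q /h1[_ _ -> h]; split.
apply: pr_le => // t [v [v1 vy vt]] q /h1[u1 uk _ _].
apply: le_lt_trans tau_small.
have -> : \sum_p x q p * val (t (f p)) - z q = acol (resample (colset y) s t) (u q) y.
  rewrite /z opprK -big_split; apply: eq_bigr => p _ /=.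
  by rewrite resample_in ?imset_f // /f /x; ring.
rewrite -[leLHS]mul1r -[X in X * nrm _]vy -nrmM.
have -> : v y * acol (resample (colset y) s t) (u q) y =
    \sum_y' v y' * acol (resample (colset y) s t) (u q) y'.
  rewrite (bigD1 y) //= big1 ?addr0 // => y' yy.
  have -> : acol (resample (colset y) s t) (u q) y' = acol s (u q) y'.
    by apply: eq_bigr => p _; rewrite out_col // -surjective_pairing.
  by rewrite uk // mulr0.
rewrite -arc_pairing; apply: le_trans (nrm_sum _ _) _.
have -> : l.+2%:R * b%:R * tau = \sum_(i : X) tau.
  by rewrite sumr_const card_prod !card_ord -[RHS]mulr_natl natrM.
apply: ler_sum => i _; rewrite nrmM; apply: le_trans (vt i).
by rewrite ler_piMl ?nrm_ge0.
Qed.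

Lemma arc_prob :
  Pr (arc_bad tau) <= 2 * l%:R * p3 + 4 * l%:R * p1 / b%:R + l%:R * b%:R * (dl + lo ^+ 5).
Proof.
pose eV (h : bool) t := if h then eU t else eT t.
have eV_inj h t r k r' k' : eV h t r k = eV h t r' k' -> r = r' /\ k = k'.
  by case: h => /=; [apply: eU_inj|apply: eT_inj].
pose E1 s := exists ht : bool * 'I_l, bad val et4 (eV ht.1 ht.2) 2 s.
(* The level of Markov's inequality is the number [b / 2] of blocks with exceptional columns that
   [arc_hyp] tolerates. *)
pose E2 s := b%:R / 2 <= \sum_(ht : bool * 'I_l) (`[< bad val et4 (eV ht.1 ht.2) 0 s >])%:R :> R.
pose comp (y : Y) := compressible val (fun k p => e p.1 y.1 p.2 k) (fun k p => Z p.1 p.2 k)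
          (~: [set y.2]) rh et w.
pose E3 s := exists y : Y, comp y s \/ (arc_hyp y s /\ close_col y s).
apply: (@le_trans _ _ (Pr (fun s => E1 s \/ (E2 s \/ E3 s)))).
  apply: pr_le => // s [v [v1 [y vy] vt]].
  have [|n1] := pselect (E1 s); first by left.
  have [|n2] := pselect (E2 s); first by right; left.
  right; right; exists y.
  have [|nc] := pselect (comp y s); first by left.
  right; split; last by exists v.
  split=> //.
  - by move=> t _ h; apply: n1; exists (true, t).
  - by move=> t _ h; apply: n1; exists (false, t).
  - move/negP: n2; rewrite -ltNge -(pair_big xpredT xpredT
      (fun h t => (`[< bad val et4 (eV h t) 0 s >])%:R)) /= big_bool /=.
    rewrite ltr_pdivlMr // -!natr_sum -natrD -natrM ltr_nat => h.
    apply: leq_trans (ltnW h); rewrite mulnC leq_mul2r /=.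
    apply: leq_add; rewrite -sum1_card big_mkcond; apply: leq_sum => t _; rewrite inE.
      by case: (t < y.1)%N => //=; case: (`[< _ >]).
    by case: (y.1 < t)%N => //=; case: (`[< _ >]).
apply: le_trans (pr_or mu_ge0 _ _) _; rewrite -addrA; apply: lerD.
  apply: le_trans (pr_exT mu_ge0 _) _.
  apply: (@le_trans _ _ (\sum_(ht : bool * 'I_l) p3)).
    by apply: ler_sum => -[h t] _; apply: bad2; apply: eV_inj.
  by rewrite sumr_const card_prod card_bool card_ord -[leLHS]mulr_natl natrM.
apply: le_trans (pr_or mu_ge0 _ _) _; apply: lerD.
  apply: le_trans (markov_count mu_ge0 predT _ _) _; first by rewrite divr_gt0 // ltr0n.
  apply: (@le_trans _ _ ((\sum_(ht : bool * 'I_l) p1) / (b%:R / 2))).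
    rewrite ler_wpM2r ?invr_ge0 ?divr_ge0 //.
    by apply: ler_sum => -[h t] _; apply: bad0; apply: eV_inj.
  rewrite sumr_const card_prod card_bool card_ord -[_ *+ _]mulr_natl natrM invf_div.
  by rewrite le_eqVlt; apply/orP; left; apply/eqP; ring.
apply: le_trans (pr_exT mu_ge0 _) _.
apply: (@le_trans _ _ (\sum_(y : Y) (dl + lo ^+ 5))); last first.
  by rewrite sumr_const card_prod !card_ord -[leLHS]mulr_natl natrM.
apply: ler_sum => y _; apply: le_trans (pr_or mu_ge0 _ _) _; apply: lerD.
  apply: incompr.
  - by move=> k p k' p' /e_inj[h1 _ h2 ->]; split=> //; case: p p' h1 h2 => [? ?] [? ?] /= -> ->.
  - by move=> x k p; apply: entry_le.
  - by rewrite cardsC1 card_ord; clear; lia.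
  - by rewrite card_prod !card_ord.
apply: (pr_cond_le mu_ge0 mu_sum1 (J := colset y)).
- by rewrite exprn_ge0 // lo_bound_ge0.
- by move=> s t; apply: arc_hyp_inv.
- by move=> s; apply: close_col_prob.
Qed.

End ArcProbability.
End Arc.

(** * The periodic band *)

Section Cyclic.
Variable l : nat.
Local Open Scope nat_scope.
Local Notation m := l.+3.

Definition cyc (j : 'I_m) (a : nat) : 'I_m := inord ((j + a) %% m).

Lemma cycE j a : cyc j a = (j + a) %% m :> nat.
Proof. by rewrite inordK // ltn_mod. Qed.

Lemma cyc_eq j a a' : (cyc j a == cyc j a') = (a == a' %[mod m]).
Proof. by rewrite -val_eqE /= !cycE eqn_modDl. Qed.

Lemma cyc_eq_small j a a' : (a < m)%N -> (a' < m)%N -> (cyc j a == cyc j a') = (a == a').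
Proof. by move=> am a'm; rewrite cyc_eq !modn_small. Qed.

Lemma cyc_cyc j a a' : cyc (cyc j a) a' = cyc j (a + a').
Proof. by apply: val_inj; rewrite /= !cycE modnDml addnA. Qed.

Lemma cycDm j a : cyc j (a + m) = cyc j a.
Proof. by apply: val_inj; rewrite /= !cycE addnA modnDr. Qed.

Lemma cyc0 j : cyc j 0 = j.
Proof. by apply: val_inj; rewrite /= cycE addn0 modn_small. Qed.

Lemma cyc_surj j i : exists2 d, (d < m)%N & i = cyc j d.
Proof.
exists ((i + (m - j)) %% m); first by rewrite ltn_mod.
apply: val_inj; rewrite /= cycE modnDmr addnCA subnKC; last exact: ltnW.
by rewrite modnDr modn_small.
Qed.

(** Block row [j - 1 + o] modulo [m], with [l + 2] standing for [-1]. Dually, [rpos i o] is the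
    block column [i + 1 - o]. *)
Definition pos (j : 'I_m) (o : 'I_3) : 'I_m := cyc j (l.+2 + o).
Definition rpos (i : 'I_m) (o : 'I_3) : 'I_m := cyc i (l.+4 - o).

Lemma pos_rpos i o : pos (rpos i o) o = i.
Proof.
rewrite /pos /rpos cyc_cyc (_ : _ + _ = 0 + m + m)%N ?cycDm ?cyc0 //.
by have := ltn_ord o; clear; lia.
Qed.

Lemma rpos_pos i o : rpos (pos i o) o = i.
Proof.
rewrite /pos /rpos cyc_cyc (_ : _ + _ = 0 + m + m)%N ?cycDm ?cyc0 //.
by have := ltn_ord o; clear; lia.
Qed.

Lemma cyc_arc_or_triple j i :
  (exists t : 'I_l, i = cyc j (2 + t)) \/ (exists o : 'I_3, i = pos j o).
Proof.
have [d dm ->] := cyc_surj j i.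
have [d2|d2] := leqP 2 d; last first.
  right; have h : (d.+1 < 3)%N by [].
  exists (Ordinal h); rewrite /pos /= (_ : l.+2 + d.+1 = d + m)%N ?cycDm //; clear; lia.
have [dl|dl] := ltnP d l.+2.
  have h : (d - 2 < l)%N by clear -d2 dl; lia.
  by left; exists (Ordinal h); rewrite /= subnKC.
right; exists ord0; rewrite /pos addn0 (_ : d = l.+2) //; clear -dm dl; lia.
Qed.

Lemma pos_rev j o : pos j (rev_ord o) = rpos j o.
Proof.
by rewrite /pos /rpos; congr cyc; rewrite /=; have := ltn_ord o; clear; lia.
Qed.

End Cyclic.

Section Periodic.
Variables (R : realType) (S : finType) (mu : S -> R) (val : S -> R[i]) (c0 c1 : R).
Hypothesis mu_ge0 : forall s, 0 <= mu s.
Hypothesis mu_sum1 : \sum_s mu s = 1.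
Hypothesis c0_gt0 : 0 < c0.
Hypothesis c1_gt0 : 0 < c1.
Hypothesis spread : forall z : R[i], \sum_s mu s * (nrm (val s - z) < c0)%R%:R <= 1 - c1.
Variables (l b w : nat) (rh et dl taA PA al tau : R) (zeta : R[i]).
Local Notation m := l.+3.
Local Notation I := ('I_3 * 'I_m * 'I_b * 'I_b)%type.
Local Notation V := ('I_m * 'I_b)%type.
Local Notation Pr := (@pr R S I mu).
Local Notation conf := {ffun I -> S}.
Local Notation lo := (lo_bound c1 w).

Hypothesis b_gt0 : (0 < b)%N.
Hypothesis rh_gt0 : 0 < rh.
Hypothesis et_ge0 : 0 <= et.
Hypothesis al_gt0 : 0 < al.
Hypothesis al_lt1 : al < 1.
Hypothesis tau_ge0 : 0 <= tau.
Hypothesis tau_taA : tau + m%:R * b%:R * (9 * b%:R * al) <= taA.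
Hypothesis tau_et : tau <= et * al.
Hypothesis tau_small : m%:R * b%:R * tau < (rh * al) * (rh * al * c0 / 2).
Hypothesis val_le : forall x, nrm (val x) <= 3 * b%:R.
Hypothesis val_shift_le : forall x, nrm (val x - zeta) <= 3 * b%:R.

Hypothesis incompr : forall (Rw Cl : finType) (e : Rw -> Cl -> I) (Z : Rw -> Cl -> R[i]),
  (forall r k r' k', e r k = e r' k' -> r = r' /\ k = k') ->
  (forall x r k, nrm (val x + Z r k) <= 3 * b%:R) ->
  forall RS : {set Rw}, (b - 3 <= #|RS|)%N -> (#|Cl| <= 3 * b)%N ->
  Pr (compressible val e Z RS rh et w) <= dl.

Hypothesis arcP : forall (e : 'I_3 -> 'I_l -> 'I_b -> 'I_b -> I) (Z : 'I_3 -> 'I_b -> 'I_b -> R[i]),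
  (forall o t r k o' t' r' k', e o t r k = e o' t' r' k' -> [/\ o = o', t = t', r = r' & k = k']) ->
  (forall r k, Z ord0 r k = 0) -> (forall r k, Z ord_max r k = 0) ->
  (forall x o r k, nrm (val x + Z o r k) <= 3 * b%:R) ->
  Pr (arc_bad val e Z taA) <= PA.

(* Block type met at offset o: the column block j meets U_j, D_j, T_j in the row blocks
   j-1, j, j+1, and these have labels 1, 0, 2. *)
Definition ty (o : 'I_3) : 'I_3 := if o == ord0 then inord 1 else if o == ord_max then ord_max else ord0.

Lemma ty_inj : injective ty.
Proof.
have E (o : 'I_3) : ty o = (if (o : nat) == 0 then 1 else if (o : nat) == 2 then 2 else 0)%N :> nat.
  by rewrite /ty -!val_eqE /=; case: ifP => _; [rewrite inordK|case: ifP].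
move=> o o' /(congr1 (@nat_of_ord 3)); rewrite !E => h; apply: val_inj => /=.
move: h; case: o => -[|[|[|//]]] ?; case: o' => -[|[|[|//]]] ? //.
Qed.

Definition diag_shift (o : 'I_3) (r k : 'I_b) : R[i] :=
  if ((o : nat) == 1%N) && (r == k) then - zeta else 0.

Lemma diag_shift0 r k : diag_shift ord0 r k = 0. Proof. by []. Qed.
Lemma diag_shift2 r k : diag_shift ord_max r k = 0. Proof. by []. Qed.

Lemma diag_shift_sym o r k : diag_shift (rev_ord o) k r = diag_shift o r k.
Proof.
have h : (nat_of_ord (rev_ord o) == 1)%N = (nat_of_ord o == 1)%N.
  by case: o => -[|[|[|//]]].
by rewrite /diag_shift h (eq_sym k).
Qed.

Lemma entry_le x o r k : nrm (val x + diag_shift o r k) <= 3 * b%:R.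
Proof. by rewrite /diag_shift; case: ifP => _; rewrite ?addr0. Qed.

(** The unnormalized band matrix minus [zeta] times the identity, as a sum over offsets; since [m]
    is at least 3, at most one offset contributes to an entry. *)
Definition ment (s : conf) (x y : V) : R[i] :=
  \sum_(p : 'I_3 * 'I_b | (pos y.1 p.1, p.2) == x)
    (val (s (ty p.1, y.1, p.2, y.2)) + diag_shift p.1 p.2 y.2).

Lemma mentE s i r j k : ment s (i, r) (j, k) =
  \sum_(o | pos j o == i) (val (s (ty o, j, r, k)) + diag_shift o r k).
Proof.
rewrite /ment (reindex_onto (fun o => (o, r)) fst) /=; last first.
  by move=> [ o r'] /eqP[_ /= ->].
by apply: eq_bigl => o; rewrite xpair_eqE !eqxx !andbT.
Qed.

Lemma ment_le s x y : nrm (ment s x y) <= 9 * b%:R.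
Proof.
case: x y => i r [j k]; rewrite mentE; apply: le_trans (nrm_sum _ _) _.
apply: (@le_trans _ _ (\sum_(o < 3) 3 * b%:R)).
  rewrite big_mkcond; apply: ler_sum => o _; case: ifP => _; first exact: entry_le.
  by rewrite mulr_ge0.
by rewrite sumr_const card_ord -[leLHS]mulr_natl mulrA -natrM.
Qed.

Lemma col_sum s (u : V -> R[i]) j k : \sum_x ment s x (j, k) * u x =
  \sum_p (val (s (ty p.1, j, p.2, k)) + diag_shift p.1 p.2 k) * u (pos j p.1, p.2).
Proof.
under eq_bigr do rewrite /ment mulr_suml.
rewrite (exchange_big_dep xpredT) //=; apply: eq_bigr => p _.
by rewrite (big_pred1 (pos j p.1, p.2)) // => x; rewrite eq_sym.
Qed.

Lemma row_sum s (v : V -> R[i]) i r : \sum_y ment s (i, r) y * v y =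
  \sum_p (val (s (ty p.1, rpos i p.1, r, p.2)) + diag_shift p.1 r p.2) * v (rpos i p.1, p.2).
Proof.
transitivity (\sum_j \sum_k ment s (i, r) (j, k) * v (j, k)).
  by rewrite pair_bigA /=; apply: eq_bigr => -[].
transitivity (\sum_o \sum_k (val (s (ty o, rpos i o, r, k)) + diag_shift o r k) * v (rpos i o, k)); last first.
  by rewrite pair_bigA.
rewrite exchange_big [RHS]exchange_big /=; apply: eq_bigr => k _.
under eq_bigr do rewrite mentE mulr_suml.
rewrite (exchange_big_dep xpredT) //=; apply: eq_bigr => o _.
rewrite (big_pred1 (rpos i o)) // => j; apply/eqP/eqP => [<-|->]; first by rewrite rpos_pos.
exact: pos_rpos.
Qed.

Definition near_null (s : conf) (v : V -> R[i]) : Prop :=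
  (forall y, nrm (v y) <= 1) /\ forall x, nrm (\sum_y ment s x y * v y) <= tau.

Definition periodic_bad (s : conf) : Prop :=
  exists2 v, near_null s v & exists y, nrm (v y) = 1.

(** The arc opposite [j0] has block columns [j0 + 2, ..., j0 + l + 1] and block rows
    [j0 + 1, ..., j0 + l + 2]. In [eL] rows and columns are exchanged, which reverses the offsets;
    it reads the block columns [j0 + 1, ..., j0 + l + 2] of the matrix, hence never block column
    [j0]. *)
Definition eR (j0 : 'I_m) (o : 'I_3) (t : 'I_l) (r k : 'I_b) : I := (ty o, cyc j0 (2 + t), r, k).
Definition eL (j0 : 'I_m) (o : 'I_3) (t : 'I_l) (r k : 'I_b) : I :=
  (ty (rev_ord o), cyc j0 (t + o).+1, k, r).

Lemma cyc_arc_inj (j0 : 'I_m) : injective (fun t : 'I_l => cyc j0 (2 + t)).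
Proof.
have h (t : 'I_l) : (2 + t < m)%N by rewrite add2n !ltnS ltnW.
by move=> t t' /eqP; rewrite cyc_eq_small ?h // eqn_add2l => /eqP/val_inj.
Qed.

Lemma eR_inj j0 o t r k o' t' r' k' :
  eR j0 o t r k = eR j0 o' t' r' k' -> [/\ o = o', t = t', r = r' & k = k'].
Proof. by case=> /ty_inj -> h -> ->; split=> //; apply: (@cyc_arc_inj j0). Qed.

Lemma eL_inj j0 o t r k o' t' r' k' :
  eL j0 o t r k = eL j0 o' t' r' k' -> [/\ o = o', t = t', r = r' & k = k'].
Proof.
case=> /ty_inj/rev_ord_inj oo /eqP h -> ->; split=> //; move: h; rewrite -{}oo.
have lt_m (i : 'I_l) : ((i + o).+1 < m)%N.
  by rewrite ltnS -(addn2 l) -addSn leq_add // -ltnS.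
by rewrite cyc_eq_small ?lt_m // eqSS eqn_add2r => /eqP/val_inj.
Qed.

Lemma arow_pos (j0 : 'I_m) (t : 'I_l) (o : 'I_3) : pos (cyc j0 (2 + t)) o = cyc j0 (arow t o).+1.
Proof.
rewrite /pos cyc_cyc arowE -(cycDm _ (t + o).+1); congr cyc; clear; lia.
Qed.

Lemma cyc_arow_eq (j0 : 'I_m) (i i' : 'I_l.+2) : (cyc j0 i.+1 == cyc j0 i'.+1) = (i == i').
Proof.
rewrite cyc_eq_small ?eqSS //; by rewrite ltnS ltn_ord.
Qed.

Lemma ent_right s (j0 : 'I_m) (i : 'I_l.+2) r (t : 'I_l) k :
  ment s (cyc j0 i.+1, r) (cyc j0 (2 + t), k) = ent val (eR j0) diag_shift s (i, r) (t, k).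
Proof.
rewrite /ment /ent; apply: eq_bigl => p /=.
by rewrite arow_pos !xpair_eqE cyc_arow_eq.
Qed.

Lemma ent_left s (j0 : 'I_m) (i : 'I_l.+2) r (t : 'I_l) k :
  ment s (cyc j0 (2 + t), k) (cyc j0 i.+1, r) = ent val (eL j0) diag_shift s (i, r) (t, k).
Proof.
rewrite mentE (reindex_inj rev_ord_inj) /=.
rewrite /ent (reindex_onto (fun o => (o, r)) fst) /=; last first.
  by move=> [ o r'] /eqP[_ /= ->].
rewrite [RHS](eq_bigl (fun o => arow t o == i)); last first.
  by move=> o; rewrite /= xpair_eqE !eqxx !andbT.
have posE o : (pos (cyc j0 i.+1) (rev_ord o) == cyc j0 (2 + t)) = (arow t o == i).
  have -> : cyc j0 (2 + t) = pos (pos (cyc j0 (2 + t)) o) (rev_ord o).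
    by rewrite pos_rev rpos_pos.
  rewrite arow_pos !pos_rev.
  apply/eqP/eqP => [h|<- //]; apply/eqP; rewrite -(cyc_arow_eq j0).
  by rewrite -(pos_rpos (cyc j0 i.+1) o) h pos_rpos.
rewrite (eq_bigl _ _ posE); apply: eq_bigr => o /eqP <-.
by rewrite /eL arowE diag_shift_sym.
Qed.

Lemma sum_arc_split (j0 : 'I_m) (F : 'I_m -> R[i]) : \sum_j F j =
  \sum_(t < l) F (cyc j0 (2 + t)) + \sum_(j | j \notin [set cyc j0 (2 + t) | t : 'I_l]) F j.
Proof.
rewrite (bigID (mem [set cyc j0 (2 + t) | t : 'I_l])) /=; congr (_ + _).
by rewrite big_imset //=; move=> t t' _ _; apply: cyc_arc_inj.
Qed.

(* If a near null vector is small on the three central blocks, then its restriction to the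
   complementary arc is nearly null for the arc. *)
Lemma central_triple (e : 'I_3 -> 'I_l -> 'I_b -> 'I_b -> I) (M : V -> V -> R[i])
    (s : conf) (j0 : 'I_m) (v : V -> R[i]) th :
  (forall x y, nrm (M x y) <= 9 * b%:R) ->
  (forall (i : 'I_l.+2) r (t : 'I_l) k, M (cyc j0 i.+1, r) (cyc j0 (2 + t), k) =
    ent val e diag_shift s (i, r) (t, k)) ->
  ~ arc_bad val e diag_shift taA s ->
  (forall y, nrm (v y) <= 1) -> (exists y, nrm (v y) = 1) -> th <= tau ->
  (forall (i : 'I_l.+2) r, nrm (\sum_y M (cyc j0 i.+1, r) y * v y) <= th) ->
  exists o k, al < nrm (v (pos j0 o, k)).
Proof.
move=> Mle Ment arcN v1 [[j1 k1] vy1] th_tau vres; apply: contrapT => no.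
have small o k : nrm (v (pos j0 o, k)) <= al.
  by rewrite leNgt; apply/negP => h; apply: no; exists o, k.
apply: arcN; exists (fun y : 'I_l * 'I_b => v (cyc j0 (2 + y.1), y.2)); split=> //.
  have [[t ht]|[ o ho]] := cyc_arc_or_triple j0 j1; first by exists (t, k1); rewrite -ht.
  by have := small o k1; rewrite -ho vy1 leNgt al_lt1.
move=> [i r].
pose F j := \sum_k M (cyc j0 i.+1, r) (j, k) * v (j, k).
have e1 : \sum_y M (cyc j0 i.+1, r) y * v y = \sum_j F j.
  by rewrite pair_bigA /=; apply: eq_bigr => -[].
have e2 : \sum_y ent val e diag_shift s (i, r) y * v (cyc j0 (2 + y.1), y.2) =
    \sum_(t < l) F (cyc j0 (2 + t)).
  rewrite pair_bigA /=; apply: eq_bigr => -[t k] _ /=.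
  by rewrite -Ment.
pose rest := \sum_(j | j \notin [set cyc j0 (2 + t) | t : 'I_l]) F j.
have hrest : nrm rest <= m%:R * b%:R * (9 * b%:R * al).
  apply: le_trans (nrm_sum _ _) _.
  apply: (@le_trans _ _ (\sum_(j < m) \sum_(k < b) 9 * b%:R * al)); last first.
    by rewrite !sumr_const !card_ord -mulrnA -[leLHS]mulr_natl mulnC natrM.
  rewrite big_mkcond; apply: ler_sum => j _; case: ifP => hj; last first.
    by apply: sumr_ge0 => k _; rewrite !mulr_ge0 // ltW.
  apply: le_trans (nrm_sum _ _) _; apply: ler_sum => k _; rewrite nrmM ler_pM ?nrm_ge0 //.
  have [[t ht]|[ o ->//]] := cyc_arc_or_triple j0 j.
  by case/imsetP: hj; exists t.
have -> : \sum_y ent val e diag_shift s (i, r) y * v (cyc j0 (2 + y.1), y.2) =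
    \sum_y M (cyc j0 i.+1, r) y * v y - rest.
  by rewrite e1 e2 (sum_arc_split j0) -/rest addrK.
apply: le_trans (nrmB _ _) _; apply: le_trans tau_taA; apply: lerD => //.
exact: le_trans (vres i r) th_tau.
Qed.

Lemma normalize_large (X : finType) (x : X -> R[i]) : (exists p, al < nrm (x p)) ->
  exists c : R[i], [/\ nrm c * al <= 1, forall p, nrm (c * x p) <= 1, exists p, nrm (c * x p) = 1 &
    forall p, rh <= nrm (c * x p) -> rh * al <= nrm (x p)].
Proof.
case=> p0 hp0; have xp0 : x p0 != 0 by rewrite -nrm_gt0; apply: lt_trans hp0.
have [c c0' [cx1 cx2]] := normalize_max (ex_intro _ p0 xp0).
have cal : nrm c * al <= 1.
  by apply: le_trans (cx1 p0); rewrite nrmM ler_wpM2l ?nrm_ge0 // ltW.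
exists c; split=> // p h.
apply: (@le_trans _ _ (nrm (c * x p) * al)); first by rewrite ler_wpM2r // ltW.
by rewrite nrmM mulrAC ler_piMl ?nrm_ge0.
Qed.

Lemma arc_bad_ext (e : 'I_3 -> 'I_l -> 'I_b -> 'I_b -> I) (s s' : conf) :
  (forall o t r k, s (e o t r k) = s' (e o t r k)) ->
  arc_bad val e diag_shift taA s = arc_bad val e diag_shift taA s'.
Proof.
move=> ss'; have E : ent val e diag_shift s = ent val e diag_shift s'.
  by apply: funext => x; apply: funext => y; apply: eq_bigr => p _; rewrite ss'.
by rewrite /arc_bad E.
Qed.

Definition large_at (y0 : V) (s : conf) : Prop :=
  exists2 v, near_null s v & rh * al <= nrm (v y0).

(** A left null vector [u] of all columns but [y0] exists by dimension. The transposed arc forces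
    [u] to be large next to block [j], and incompressibility of the other columns of this block
    spreads it there. Pairing with [v] isolates [v y0] times the form of [u] on column [y0]; both
    [v y0] and the spread coefficients of [u] are at least [rh al], whence the shape of
    [tau_small]. *)
Lemma large_at_prob (y0 : V) : Pr (large_at y0) <= PA + dl + lo.
Proof.
case: y0 => j k.
pose arcL := arc_bad val (eL j) diag_shift taA.
pose f (k' : 'I_b) (p : 'I_3 * 'I_b) : I := (ty p.1, j, p.2, k').
have f_inj r p r' p' : f r p = f r' p' -> r = r' /\ p = p'.
  by case: p p' => [ o q] [ o' q'] [/ty_inj /= -> -> ->].
pose compC := compressible val f (fun k' p => diag_shift p.1 p.2 k') (~: [set k]) rh et w.
apply: (@le_trans _ _ (Pr (fun s => arcL s \/ (compC s \/ ((~ arcL s /\ ~ compC s) /\ large_at (j, k) s))))).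
  apply: pr_le => // s h; have [|n1] := pselect (arcL s); first by left.
  by have [|n2] := pselect (compC s); right; [left|right].
rewrite -addrA; apply: le_trans (pr_or mu_ge0 _ _) _; apply: lerD.
  by apply: arcP => *; [apply: eL_inj; eassumption|apply: diag_shift0|apply: diag_shift2|apply: entry_le].
apply: le_trans (pr_or mu_ge0 _ _) _; apply: lerD.
  apply: incompr => //.
  - by move=> x r p; apply: entry_le.
  - by rewrite cardsC1 card_ord; clear; lia.
  - by rewrite card_prod !card_ord.
pose J := [set f k p | p in [set: 'I_3 * 'I_b]].
have out (s t : conf) o j' r k' : (j', k') != (j, k) ->
    resample J s t (o, j', r, k') = s (o, j', r, k').
  move=> jk; rewrite resample_notin //; apply/imsetP => -[p _ [_ h1 _ h2]].
  by case/eqP: jk; rewrite h1 h2.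
have cyc_ne (i : 'I_l.+2) : cyc j i.+1 != j.
  by rewrite -[X in _ != X]cyc0 cyc_eq_small // ltnS ltn_ord.
apply: (pr_cond_le mu_ge0 mu_sum1 (J := J)); first exact: lo_bound_ge0.
- move=> s t; congr (~ _ /\ ~ _).
    apply: arc_bad_ext => o t' r k'; apply: out; apply: contraNneq (cyc_ne (arow t' o)) => -[h _].
    by rewrite arowE h.
  apply: compressible_ext => k' p; rewrite !inE => kk; apply: out.
  by apply: contraNneq kk => -[->].
move=> s [narc ncomp].
have cY : (#|[set~ (j, k)]| < #|{: V}|)%N.
  by rewrite cardsC1 prednK //; apply/card_gt0P; exists (j, k).
have [u [u1 u2 u3]] := unit_kernel_vector (ment s) cY.
have u_ker y : y != (j, k) -> \sum_x ment s x y * u x = 0.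
  by move=> yy; apply: u3; rewrite !inE.
have [ o [q oq]] : exists o q, al < nrm (u (pos j o, q)).
  apply: (@central_triple (eL j) (fun x y => ment s y x) s j u 0) => //.
  - by move=> x y; apply: ment_le.
  - by move=> i r t k'; apply: ent_left.
  - move=> i r; rewrite u_ker ?nrm0 //.
    by apply: contraNneq (cyc_ne i) => -[->].
pose x (p : 'I_3 * 'I_b) := u (pos j p.1, p.2).
have [c [cal cx1 cx2 cx3]] := normalize_large (ex_intro (fun p => al < nrm (x p)) (o, q) oq).
have wK : (w < #|[set p | (rh <= nrm (c * x p))%R]|)%N.
  rewrite ltnNge; apply/negP => hw; apply: ncomp; exists (fun p => c * x p); split=> // k' kk.
  rewrite /app; under eq_bigr do rewrite mulrCA.
  rewrite -mulr_sumr -(col_sum s u j k') u_ker ?mulr0 ?nrm0 //.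
  by apply: contraTneq kk => -[->]; rewrite !inE eqxx.
apply: le_trans (lo_bound_le c1_gt0 wK).
have a0 : 0 < rh * al by rewrite mulr_gt0.
have fk_inj : injective (f k) by move=> p p' /f_inj[].
pose z := - \sum_p diag_shift p.1 p.2 k * x p.
apply: le_trans (littlewood_offord_inj mu_ge0 mu_sum1 c0_gt0 c1_gt0 spread fk_inj
  (K := [set p | (rh <= nrm (c * x p))%R]) (x := x) z a0 _); last by move=> p; rewrite inE => /cx3.
apply: pr_le => // t [v [v1 vres] vjk].
have -> : \sum_p x p * val (t (f k p)) - z = \sum_y ment (resample J s t) y (j, k) * u y.
  rewrite col_sum /z opprK -big_split; apply: eq_bigr => p _ /=.
  by rewrite resample_in ?(imset_f (f k)) // /f /x; ring.
rewrite -(ltr_pM2l a0); apply: le_lt_trans tau_small.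
apply: (@le_trans _ _ (nrm (v (j, k) * \sum_y ment (resample J s t) y (j, k) * u y))).
  by rewrite nrmM ler_wpM2r ?nrm_ge0.
have -> : v (j, k) * (\sum_y ment (resample J s t) y (j, k) * u y) =
    \sum_y u y * \sum_z ment (resample J s t) y z * v z.
  under [RHS]eq_bigr do rewrite mulr_sumr.
  rewrite [RHS]exchange_big [RHS](bigD1 (j, k)) //= [X in _ = _ + X]big1 ?addr0.
    by rewrite mulr_sumr; apply: eq_bigr => y _; ring.
  move=> [j' k'] jk; transitivity (v (j', k') * \sum_y ment s y (j', k') * u y); last by rewrite u_ker ?mulr0.
  rewrite mulr_sumr; apply: eq_bigr => y _.
  have -> : ment (resample J s t) y (j', k') = ment s y (j', k').
    by apply: eq_bigr => p _; rewrite out.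
  by ring.
apply: le_trans (nrm_sum _ _) _.
have -> : m%:R * b%:R * tau = \sum_(y : V) tau.
  by rewrite sumr_const card_prod !card_ord -[RHS]mulr_natl natrM.
apply: ler_sum => y _; rewrite nrmM; apply: le_trans (vres y).
by rewrite ler_piMl ?nrm_ge0.
Qed.

(** Any [j0] serves. Block row [j0] reads exactly the three blocks where [v] has a large coordinate,
    so incompressibility gives more than [w] such coordinates. Markov's inequality on their number
    then costs [3b / (w+1)] instead of the [3b] of a union bound. *)
Lemma periodic_prob :
  Pr periodic_bad <= PA + dl + 3 * b%:R * (PA + dl + lo) / w.+1%:R.
Proof.
pose j0 : 'I_m := ord0.
pose arcR := arc_bad val (eR j0) diag_shift taA.
pose f (r : 'I_b) (p : 'I_3 * 'I_b) : I := (ty p.1, rpos j0 p.1, r, p.2).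
pose compR := compressible val f (fun r p => diag_shift p.1 r p.2) setT rh et w.
pose many s := w.+1%:R <= \sum_(p : 'I_3 * 'I_b) (`[< large_at (rpos j0 p.1, p.2) s >])%:R :> R.
apply: (@le_trans _ _ (Pr (fun s => arcR s \/ (compR s \/ many s)))).
  apply: pr_le => // s [v [v1 vres] vy].
  have [|n1] := pselect (arcR s); first by left.
  have [|n2] := pselect (compR s); first by right; left.
  right; right.
  have [ o [q oq]] : exists o q, al < nrm (v (pos j0 o, q)).
    apply: (@central_triple (eR j0) (ment s) s j0 v tau) => //.
    - by move=> x y; apply: ment_le.
    - by move=> i r t k'; apply: ent_right.
  pose x (p : 'I_3 * 'I_b) := v (rpos j0 p.1, p.2).
  have [|c [cal cx1 cx2 cx3]] := @normalize_large _ x.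
    by exists (rev_ord o, q); rewrite /x /= -pos_rev rev_ordK.
  have wK : (w < #|[set p | (rh <= nrm (c * x p))%R]|)%N.
    rewrite ltnNge; apply/negP => hw; apply: n2; exists (fun p => c * x p); split=> // r _.
    rewrite /app; under eq_bigr do rewrite mulrCA.
    rewrite -mulr_sumr -(row_sum s v j0 r) nrmM.
    apply: (@le_trans _ _ (nrm c * (et * al))).
      by rewrite ler_wpM2l ?nrm_ge0 //; apply: le_trans tau_et.
    by rewrite mulrCA ler_piMr.
  rewrite /many; apply: (@le_trans _ _ (#|[set p | (rh <= nrm (c * x p))%R]|)%:R).
    by rewrite ler_nat.
  rewrite -sum1_card natr_sum big_mkcond; apply: ler_sum => p _; rewrite inE.
  case: ifP => // /cx3 h; rewrite asboolT //.
  by exists v.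
rewrite -addrA; apply: le_trans (pr_or mu_ge0 _ _) _; apply: lerD.
  by apply: arcP => *; [apply: eR_inj; eassumption|apply: diag_shift0|apply: diag_shift2|apply: entry_le].
apply: le_trans (pr_or mu_ge0 _ _) _; apply: lerD.
  apply: incompr => //.
  - by move=> r [ o q] r' [ o' q'] [/ty_inj /= -> _ -> ->].
  - by move=> x r p; apply: entry_le.
  - by rewrite cardsT card_ord leq_subr.
  - by rewrite card_prod !card_ord.
apply: le_trans (markov_count mu_ge0 predT _ _) _; first by rewrite ltr0n.
rewrite ler_wpM2r ?invr_ge0 //.
apply: (@le_trans _ _ (\sum_(p : 'I_3 * 'I_b) (PA + dl + lo))).
  by apply: ler_sum => p _; apply: large_at_prob.
by rewrite sumr_const card_prod !card_ord -[leLHS]mulr_natl natrM.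
Qed.

End Periodic.

(** * Numerical bounds for tolerances and probabilities *)

Section Numerics.
Variable R : realType.

(** Here [q = G B^11], and the right-hand side is the inverse of [H m^5 B^23 q^(2l)]. Once [G], [H]
    and [m] are at most [B], that product is at most [B^(24 l + 29)], below the available
    [B^(24 l + 72)]. The exponent 24 is twice the 12 of [q <= B^12]. *)
Lemma scale_bound (k c B rh et4 q taA al : R) (l : nat) :
  1 <= k -> 0 < c <= 1 -> 1 <= B -> l.+3%:R <= B ->
  24 * k ^+ 6 / c + 20736 * k ^+ 12 / c ^+ 3 <= B ->
  rh = (k ^+ 3 * B ^+ 4)^-1 -> et4 = rh ^+ 2 * c / (4 * B) -> q = 6 * B ^+ 2 / et4 ->
  taA = rh * c / (4 * l.+3%:R * B * q ^+ l) -> al = taA / (18 * l.+3%:R * B ^+ 2) ->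
  (3 * B) ^- (24 * l.+3) <= (rh * al) ^+ 2 * c / (4 * l.+3%:R * B).
Proof.
move=> k1 /andP[cpos c_le1] B1 mB GH rhE et4E qE taAE alE.
have k0 : 0 < k by apply: lt_le_trans k1.
have B0 : 0 < B by apply: lt_le_trans B1.
set m : R := l.+3%:R in mB taAE alE *.
have m0 : 0 < m by rewrite ltr0n.
clearbody m.
set G := 24 * k ^+ 6 / c in GH; set H := 20736 * k ^+ 12 / c ^+ 3 in GH.
have G0 : 0 < G by rewrite divr_gt0 // mulr_gt0 ?exprn_gt0.
have H0 : 0 < H.
  by apply: divr_gt0; [apply: mulr_gt0; [rewrite ltr0n|exact: exprn_gt0]|exact: exprn_gt0].
have GB : G <= B by apply: le_trans GH; rewrite lerDl ltW.
have HB : H <= B by apply: le_trans GH; rewrite lerDr ltW.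
have qG : q = G * B ^+ 11.
  by rewrite qE et4E rhE /G; field; rewrite !gt_eqF.
have q0 : 0 < q by rewrite qG mulr_gt0 ?exprn_gt0.
have qB : q <= B ^+ 12 by rewrite qG (exprS B 11) ler_wpM2r ?exprn_ge0 // ltW.
have ql0 : 0 < q ^+ l by rewrite exprn_gt0.
have ql : q ^+ l <= B ^+ (12 * l) by rewrite exprM lerXn2r ?nnegrE ?exprn_ge0 // ltW.
have -> : (rh * al) ^+ 2 * c / (4 * m * B) = (H * m ^+ 5 * B ^+ 23 * (q ^+ l) ^+ 2)^-1.
  by rewrite alE taAE rhE /H; field; rewrite !gt_eqF.
rewrite lef_pV2 ?posrE; [|by rewrite exprn_gt0 // mulr_gt0|].
  2: exact: (mulr_gt0 (mulr_gt0 (mulr_gt0 H0 (exprn_gt0 5 m0)) (exprn_gt0 23 B0)) (exprn_gt0 2 ql0)).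
apply: (@le_trans _ _ (B ^+ (24 * l.+3))); last first.
  by rewrite lerXn2r ?nnegrE ?mulr_ge0 ?(ltW B0) // ler_peMl ?(ltW B0) // ler1n.
apply: (@le_trans _ _ (B * B ^+ 5 * B ^+ 23 * (B ^+ (12 * l)) ^+ 2)).
  have m5 : m ^+ 5 <= B ^+ 5 by rewrite lerXn2r ?nnegrE ?(ltW B0) ?(ltW m0).
  have Hm : H * m ^+ 5 <= B * B ^+ 5.
    exact: (ler_pM (ltW H0) (ltW (exprn_gt0 5 m0)) HB m5).
  have HmB : H * m ^+ 5 * B ^+ 23 <= B * B ^+ 5 * B ^+ 23.
    by apply: ler_wpM2r Hm; apply: exprn_ge0; apply: ltW.
  have ql2 : (q ^+ l) ^+ 2 <= (B ^+ (12 * l)) ^+ 2.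
    by rewrite lerXn2r ?nnegrE ?exprn_ge0 ?(ltW B0) ?(ltW q0).
  apply: ler_pM HmB ql2; last by rewrite exprn_ge0 // ltW.
  exact: ltW (mulr_gt0 (mulr_gt0 H0 (exprn_gt0 5 m0)) (exprn_gt0 23 B0)).
rewrite -exprM -[X in X * _ * _ * _]expr1 -!exprD ler_weXn2l //; clear; lia.
Qed.

Lemma lo_bound_sqrt (c B : R) (w : nat) : 0 < c -> 1 <= B -> B <= 144 * w.+1%:R ->
  lo_bound c w <= 12 / Num.sqrt c * (Num.sqrt B)^-1.
Proof.
move=> cpos B1 wB; have B0 : 0 < B by lra.
have sc : 0 < Num.sqrt c by rewrite sqrtr_gt0.
have sB : 0 < Num.sqrt B by rewrite sqrtr_gt0.
have -> : 12 / Num.sqrt c * (Num.sqrt B)^-1 = (Num.sqrt c * Num.sqrt B / 12)^-1.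
  by field; rewrite !gt_eqF.
rewrite lef_pV2 ?posrE ?divr_gt0 ?mulr_gt0 ?sqrtr_gt0 ?mulr_gt0 //.
have w1 : B <= 144 * w.+2%:R.
  by apply: le_trans wB _; rewrite ler_wpM2l // ler_nat.
rewrite -sqrtrM ?(ltW cpos) // ler_pdivrMr // -[leRHS]ger0_norm ?mulr_ge0 ?sqrtr_ge0 //.
rewrite -sqrtr_sqr ler_wsqrtr // exprMn sqr_sqrtr ?mulr_ge0 ?(ltW cpos) //.
have -> : w.+2%:R * c * 12 ^+ 2 = c * (144 * w.+2%:R) by ring.
by rewrite ler_wpM2l // ltW.
Qed.

(** Everything is measured in powers of [e = B^(-1/2)]: [lo] and [p1] are [O(e)], [p3] is [O(e^3)],
    [dl] is [e^20], and each factor [l] or [B] costs at most [e^(-2)]. *)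
Lemma total_bound (B e lo dl L w1 b1 b3 p1 p3 PA l : R) :
  1 <= B -> 0 < e -> B * e ^+ 2 = 1 -> 0 <= lo -> lo <= L * e -> 1 <= L ->
  dl = B^-1 ^+ 10 -> 0 < w1 -> B <= 144 * w1 -> 0 <= l -> l <= B ->
  0 <= b1 -> b1 <= 2 * B -> 0 <= b3 -> b3 <= (2 * B) ^+ 3 ->
  p1 = dl + b1 * dl + (B * lo / w1) ^+ 1 ->
  p3 = dl + b3 * dl + (B * lo / w1) ^+ 3 ->
  PA = 2 * l * p3 + 4 * l * p1 / B + l * B * (dl + lo ^+ 5) ->
  let C1 := 3 + 144 * L in let C3 := 9 + (144 * L) ^+ 3 in
  let CA := 2 * C3 + 4 * C1 + 1 + L ^+ 5 in
  PA + dl + 3 * B * (PA + dl + lo) / w1 <= (CA + 1 + 432 * (CA + 1 + L)) * e.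
Proof.
move=> B1 e0 Be lo0 loL L1 dlE w0 Bw l0 lB b10 b1B b30 b3B p1E p3E PAE; cbv zeta.
set C1 := 3 + 144 * L; set C3 := 9 + (144 * L) ^+ 3; set CA := 2 * C3 + 4 * C1 + 1 + L ^+ 5.
have B0 : 0 < B by lra.
have e1 : e <= 1.
  rewrite -(ler_pXn2r (n := 2)) ?nnegrE ?(ltW e0) // expr1n -Be.
  by rewrite ler_peMl // exprn_ge0 // ltW.
have ek (i j : nat) : (i <= j)%N -> e ^+ j <= e ^+ i.
  by move=> ij; rewrite ler_wiXn2l // ltW.
have ep (i : nat) : 0 <= e ^+ i by rewrite exprn_ge0 // ltW.
have Bn0 : B != 0 by rewrite gt_eqF.
have iB : B^-1 = e ^+ 2 by apply: (mulfI Bn0); rewrite Be divff.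
have dlE' : dl = e ^+ 20 by rewrite dlE iB -exprM.
have dl0 : 0 <= dl by rewrite dlE'.
have L0 : 0 <= L by lra.
have r0 : 0 <= B * lo / w1 by rewrite divr_ge0 ?mulr_ge0 // ltW.
have rL : B * lo / w1 <= 144 * L * e.
  rewrite ler_pdivrMr //; apply: (@le_trans _ _ (144 * w1 * (L * e))); last first.
    by rewrite le_eqVlt; apply/orP; left; apply/eqP; ring.
  by apply: ler_pM => //; rewrite ltW.
have Be3 : B ^+ 3 * e ^+ 6 = 1.
  have -> : B ^+ 3 * e ^+ 6 = (B * e ^+ 2) ^+ 3 by ring.
  by rewrite Be expr1n.
have b1dl : b1 * dl <= 2 * e.
  apply: (@le_trans _ _ (2 * B * dl)); first by rewrite ler_wpM2r.
  rewrite dlE' (_ : 2 * B * e ^+ 20 = 2 * (B * e ^+ 2) * e ^+ 18); last by ring.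
  by rewrite Be mulr1 ler_wpM2l // -[leRHS]expr1 ek.
have b3dl : b3 * dl <= 8 * e ^+ 3.
  apply: (@le_trans _ _ ((2 * B) ^+ 3 * dl)); first by rewrite ler_wpM2r.
  rewrite dlE' (_ : (2 * B) ^+ 3 * e ^+ 20 = 8 * (B ^+ 3 * e ^+ 6) * e ^+ 14); last by ring.
  by rewrite Be3 mulr1 ler_wpM2l // ek.
have p1b : p1 <= C1 * e.
  rewrite p1E expr1 /C1.
  have : dl <= e by rewrite dlE' -[leRHS]expr1 ek.
  by move: b1dl rL; clear; lra.
have p10 : 0 <= p1 by rewrite p1E; apply: addr_ge0; [apply: addr_ge0 => //; apply: mulr_ge0|apply: exprn_ge0].
have p3b : p3 <= C3 * e ^+ 3.
  rewrite p3E /C3 mulrDl -exprMn.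
  have : dl <= e ^+ 3 by rewrite dlE' ek.
  have : (B * lo / w1) ^+ 3 <= (144 * L * e) ^+ 3.
    have Le0 : 0 <= 144 * L * e by rewrite !mulr_ge0 // ltW.
    by rewrite lerXn2r ?nnegrE.
  by move: b3dl; clear; lra.
have p30 : 0 <= p3 by rewrite p3E; apply: addr_ge0; [apply: addr_ge0 => //; apply: mulr_ge0|apply: exprn_ge0].
have t1 : 2 * l * p3 <= 2 * C3 * e.
  apply: (@le_trans _ _ (2 * B * (C3 * e ^+ 3))).
    by apply: ler_pM => //; rewrite ?mulr_ge0 // ler_wpM2l.
  rewrite (_ : 2 * B * (C3 * e ^+ 3) = 2 * C3 * e * (B * e ^+ 2)); last by ring.
  by rewrite Be mulr1.
have t2 : 4 * l * p1 / B <= 4 * C1 * e.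
  rewrite ler_pdivrMr // (_ : 4 * C1 * e * B = 4 * B * (C1 * e)); last by ring.
  by apply: ler_pM => //; rewrite ?mulr_ge0 // ler_wpM2l.
have t3 : l * B * (dl + lo ^+ 5) <= (1 + L ^+ 5) * e.
  have h : dl + lo ^+ 5 <= (1 + L ^+ 5) * e ^+ 5.
    rewrite mulrDl mul1r; apply: lerD; first by rewrite dlE' ek.
    by rewrite -exprMn lerXn2r ?nnegrE // mulr_ge0 // ltW.
  apply: (@le_trans _ _ (B * B * ((1 + L ^+ 5) * e ^+ 5))).
    apply: ler_pM => //; rewrite ?mulr_ge0 ?addr_ge0 ?exprn_ge0 ?(ltW B0) //.
    by rewrite ler_wpM2r // ltW.
  rewrite (_ : B * B * ((1 + L ^+ 5) * e ^+ 5) = (1 + L ^+ 5) * e * (B * e ^+ 2) * (B * e ^+ 2)); last by ring.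
  by rewrite Be !mulr1.
have PAb : PA <= CA * e by rewrite PAE /CA; move: t1 t2 t3; clear; lra.
have dle : dl <= e by rewrite dlE' -[leRHS]expr1 ek.
have t4 : 3 * B * (PA + dl + lo) / w1 <= 432 * (CA + 1 + L) * e.
  have PA0 : 0 <= PA.
    rewrite PAE; apply: addr_ge0; first apply: addr_ge0.
    - by rewrite !mulr_ge0.
    - by rewrite divr_ge0 ?mulr_ge0 // ltW.
    - by apply: mulr_ge0; [rewrite mulr_ge0 // ltW|rewrite addr_ge0 // exprn_ge0].
  rewrite ler_pdivrMr //.
  apply: (@le_trans _ _ (3 * (144 * w1) * ((CA + 1 + L) * e))); last first.
    by rewrite le_eqVlt; apply/orP; left; apply/eqP; ring.
  apply: ler_pM; rewrite ?mulr_ge0 ?addr_ge0 ?(ltW B0) //.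
    by rewrite ler_wpM2l.
  by move: PAb dle loL; clear; lra.
by move: PAb dle t4; clear; lra.
Qed.

End Numerics.

Section FiniteMain.
Variables (R : realType) (c0 c1 : R).
Hypothesis c0P : 0 < c0 <= 1.
Hypothesis c1P : 0 < c1 <= 1.

Lemma periodic_prob_small : exists (m0 : nat) (C : R), forall l b : nat,
  (m0 <= l.+3)%N -> (l.+3 <= b)%N ->
  forall (S : finType) (mu : S -> R) (val : S -> R[i]) (zeta : R[i]),
  (forall s, 0 <= mu s) -> \sum_s mu s = 1 ->
  (forall z : R[i], \sum_s mu s * (nrm (val s - z) < c0)%R%:R <= 1 - c1) ->
  (forall x, nrm (val x) <= 3 * b%:R) -> (forall x, nrm (val x - zeta) <= 3 * b%:R) ->
  pr mu (periodic_bad (l := l) (b := b) val ((3 * b)%:R ^- (24 * l.+3)) zeta) <= C / Num.sqrt b%:R.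
Proof.
have /andP[c0_gt0 c0_le1] := c0P; have /andP[c1_gt0 c1_le1] := c1P.
pose kappa := (Num.truncn (40 / c0)).+1.
have kappaP : 40 <= kappa%:R * c0.
  by rewrite -ler_pdivrMr // ltW // truncnS_gt.
have k1 : 1 <= kappa%:R :> R by rewrite ler1n.
have [b0 hb0] := eventually_incompressible c0P c1P kappaP.
pose G := 24 * kappa%:R ^+ 6 / c0.
pose H := 20736 * kappa%:R ^+ 12 / c0 ^+ 3.
pose L := 12 / Num.sqrt c1.
pose C1 := 3 + 144 * L; pose C3 := 9 + (144 * L) ^+ 3.
pose CA := 2 * C3 + 4 * C1 + 1 + L ^+ 5.
(* The last entry makes [b] exceed [G + H], which absorbs the constants in [scale_bound]. *)
exists (maxn (maxn b0 8) (Num.truncn (G + H)).+1), (CA + 1 + 432 * (CA + 1 + L)).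
move=> l b; rewrite !geq_max -andbA => /and3P[b0m m8 GHm] mb.
move=> S mu val zeta mu_ge0 mu_sum1 spread val_le val_shift_le.
have b8 : (8 <= b)%N := leq_trans m8 mb.
have b_gt0 : (0 < b)%N by apply: leq_trans b8.
have incompr := hb0 b (leq_trans b0m mb) S mu val mu_ge0 mu_sum1 spread.
set m := l.+3 in b0m m8 GHm mb *.
pose B : R := b%:R; pose w := (b %/ 144)%N.
have B1 : 1 <= B by rewrite ler1n.
have B0 : 0 < B by apply: lt_le_trans B1.
have mB : m%:R <= B by rewrite ler_nat.
have m1 : 1 <= m%:R :> R by rewrite ler1n.
have m_gt0 : 0 < m%:R :> R by apply: lt_le_trans m1.
have wb : (4 * w.+1 <= b)%N by rewrite /w; clear -b8; lia.
have wB : B <= 144 * w.+1%:R.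
  by rewrite -natrM ler_nat mulnC; apply: ltnW; apply: ltn_ceil.
pose rh := rho R kappa b; pose et := tol R kappa b.
have rh_gt0 : 0 < rh by apply: (rho_gt0 c0P kappaP).
have K0 : 0 < kappa%:R :> R by apply: lt_le_trans k1.
have rh_le1 : rh <= 1.
  by rewrite /rh /rho invf_le1 ?mulr_gt0 ?exprn_gt0 // mulr_ege1 ?exprn_ege1.
have et_rh : rh <= et by rewrite /et /tol ler_peMr ?exprn_ege1 // ltW.
have et_ge0 : 0 <= et by apply: le_trans et_rh; apply: ltW.
(* Half of what the pairing for a square block allows: [b et4 = rh (rh c0 / 4)]. *)
pose et4 := rh ^+ 2 * c0 / (4 * B).
have et4_gt0 : 0 < et4 by rewrite divr_gt0 ?mulr_gt0 ?exprn_gt0.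
have rh2 : rh ^+ 2 <= rh by rewrite expr2 ler_piMl // ltW.
have et4_le : et4 <= rh.
  rewrite /et4 ler_pdivrMr ?mulr_gt0 //; apply: (@le_trans _ _ (rh * 1)).
    by apply: ler_pM => //; rewrite ?exprn_ge0 // ltW.
  by rewrite ler_wpM2l ?(ltW rh_gt0) // mulr_ege1 // ler1n.
have et4_small : b%:R * et4 < rh * (rh * c0 / 2).
  have -> : b%:R * et4 = rh * (rh * c0 / 4) by rewrite /et4 -/B; field; rewrite gt_eqF.
  by rewrite ltr_pM2l // ltr_pM2l ?mulr_gt0 // ltf_pV2 ?posrE // ltr_nat.
pose I := ('I_3 * 'I_m * 'I_b * 'I_b)%type.
pose dl : R := b%:R^-1 ^+ 10.
have hbad n : (n < 3)%N -> forall e : 'I_b -> 'I_b -> I,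
    (forall r k r' k', e r k = e r' k' -> r = r' /\ k = k') ->
    pr mu (bad val et4 e n) <= dl + (b.+1 ^ n.+1)%:R * dl + (b%:R * lo_bound c1 w / w.+1%:R) ^+ n.+1.
  move=> n3 e e_inj.
  apply: (bad_prob mu_ge0 mu_sum1 c0_gt0 c1_gt0 spread rh_gt0 (le_trans et4_le et_rh)
      et_ge0 et4_small _ e_inj n3 b_gt0).
  move=> e' e'_inj RS RSb; apply: incompr => //.
    by move=> x r k; rewrite addr0.
  by rewrite card_ord leq_pmull.
have hbad0 := hbad 0%N isT; have hbad2 := hbad 2%N isT.
pose p1 := dl + (b.+1 ^ 1)%:R * dl + (b%:R * lo_bound c1 w / w.+1%:R) ^+ 1.
pose p3 := dl + (b.+1 ^ 3)%:R * dl + (b%:R * lo_bound c1 w / w.+1%:R) ^+ 3.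
pose q := Q b et4.
have q_ge1 : 1 <= q := Q_ge1 b_gt0 et4_gt0 (le_trans et4_le rh_le1).
have ql_gt0 : 0 < q ^+ l by rewrite exprn_gt0 //; apply: lt_le_trans q_ge1.
have ql_ge1 : 1 <= q ^+ l by rewrite exprn_ege1.
(* Chosen so that [m b taA] is half the disc radius [rh / q^l * c0 / 2] for the arc. *)
pose taA := rh * c0 / (4 * m%:R * B * q ^+ l).
have taA_gt0 : 0 < taA by rewrite divr_gt0 // !mulr_gt0.
have taA_le1 : taA <= 1.
  rewrite /taA ler_pdivrMr ?mul1r ?mulr_gt0 //; apply: (@le_trans _ _ 1).
    by rewrite mulr_ile1 // ltW.
  by rewrite !mulr_ege1 // ler1n.
have taA_small : l.+2%:R * b%:R * taA < rh / q ^+ l * c0 / 2.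
  have e : m%:R * B * taA = rh / q ^+ l * c0 / 4.
    by rewrite /taA; field; rewrite !gt_eqF.
  apply: (@le_lt_trans _ _ (m%:R * B * taA)).
    by rewrite ler_wpM2r ?(ltW taA_gt0) // ler_wpM2r ?(ltW B0) // ler_nat.
  rewrite e ltr_pM2l; last by rewrite mulr_gt0 // divr_gt0.
  by rewrite ltf_pV2 ?posrE // ltr_nat.
pose PA := 2 * l%:R * p3 + 4 * l%:R * p1 / b%:R + l%:R * b%:R * (dl + lo_bound c1 w ^+ 5).
have arcP : forall (e : 'I_3 -> 'I_l -> 'I_b -> 'I_b -> I) (Z : 'I_3 -> 'I_b -> 'I_b -> R[i]),
  (forall o t r k o' t' r' k', e o t r k = e o' t' r' k' -> [/\ o = o', t = t', r = r' & k = k']) ->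
  (forall r k, Z ord0 r k = 0) -> (forall r k, Z ord_max r k = 0) ->
  (forall x o r k, nrm (val x + Z o r k) <= 3 * b%:R) ->
  pr mu (arc_bad val e Z taA) <= PA.
  move=> e Z e_inj Z0 Z2 hZ.
  exact: (arc_prob mu_ge0 mu_sum1 c0_gt0 c1_gt0 spread b_gt0 wb rh_gt0 et_ge0 et4_gt0
    (le_trans et4_le rh_le1) (incompr I) hbad0 hbad2 e_inj Z0 Z2 hZ taA_small).
(* With this [al] the three central blocks perturb a row of the arc by at most
   [m b (9 b al) = taA / 2]. *)
pose al := taA / (18 * m%:R * B ^+ 2).
have mB2 : 1 <= m%:R * B ^+ 2 by rewrite mulr_ege1 // exprn_ege1.
have al_gt0 : 0 < al by rewrite divr_gt0 // !mulr_gt0 // exprn_gt0.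
have al_taA : al <= taA / 2.
  rewrite ler_pdivrMr ?mulr_gt0 ?exprn_gt0 //.
  have -> : taA / 2 * (18 * m%:R * B ^+ 2) = taA * (9 * (m%:R * B ^+ 2)) by field.
  by rewrite ler_peMr ?(ltW taA_gt0) // mulr_ege1 // ler1n.
have al_lt1 : al < 1 by move: al_taA taA_le1; clear; lra.
(* Half of the residual that the last pairing admits; the actual [tau], a power of [3b], lies below
   it by [scale_bound]. *)
pose taus := (rh * al) ^+ 2 * c0 / (4 * m%:R * B).
pose tau : R := (3 * b)%:R ^- (24 * m).
have tau_gt0 : 0 < tau by rewrite invr_gt0 exprn_gt0 // ltr0n muln_gt0.
have tau_taus : tau <= taus.
  rewrite /tau natrM; apply: (@scale_bound R kappa%:R c0 B rh et4 q taA al l) => //.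
  apply: le_trans mB; apply: ltW; apply: lt_le_trans (truncnS_gt _) _.
  by rewrite ler_nat.
have ra_gt0 : 0 < rh * al by rewrite mulr_gt0.
have taus_gt0 : 0 < taus.
  by apply: divr_gt0; apply: mulr_gt0 => //; [exact: exprn_gt0|exact: mulr_gt0].
have ra_le1 : rh * al <= 1 by rewrite mulr_ile1 // ltW.
have taus_ra : taus <= rh * al.
  rewrite /taus ler_pdivrMr ?mulr_gt0 //; apply: (@le_trans _ _ (rh * al * 1)).
    apply: ler_pM => //; [exact: exprn_ge0 (ltW ra_gt0)|exact: ltW|].
    by rewrite expr2 ler_piMl // ltW.
  by rewrite ler_wpM2l ?(ltW ra_gt0) // !mulr_ege1 // ler1n.
have tau_et : tau <= et * al.
  apply: le_trans tau_taus (le_trans taus_ra _).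
  by rewrite ler_wpM2r // ltW.
have tau_al : tau <= al.
  apply: le_trans tau_taus (le_trans taus_ra _).
  by rewrite ler_piMl // ltW.
have tau_taA : tau + m%:R * b%:R * (9 * b%:R * al) <= taA.
  have -> : m%:R * b%:R * (9 * b%:R * al) = taA / 2.
    by rewrite /al -/B; field; rewrite !gt_eqF.
  by move: tau_al al_taA; clear; lra.
have tau_small : m%:R * b%:R * tau < (rh * al) * (rh * al * c0 / 2).
  apply: (@le_lt_trans _ _ (m%:R * B * taus)).
    by rewrite ler_wpM2l // mulr_ge0 // ltW.
  have -> : m%:R * B * taus = (rh * al) * (rh * al * c0 / 4).
    by rewrite /taus; field; rewrite !gt_eqF.
  rewrite ltr_pM2l // ltr_pM2l; last exact: mulr_gt0.
  by rewrite ltf_pV2 ?posrE // ltr_nat.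
apply: le_trans (periodic_prob mu_ge0 mu_sum1 c0_gt0 c1_gt0 spread rh_gt0 et_ge0 al_gt0 al_lt1
  (ltW tau_gt0) tau_taA tau_et tau_small val_le val_shift_le (incompr _) arcP) _.
have sB0 : 0 < Num.sqrt B by rewrite sqrtr_gt0.
apply: (@total_bound R B (Num.sqrt B)^-1 (lo_bound c1 w) dl L w.+1%:R (b.+1 ^ 1)%:R (b.+1 ^ 3)%:R
   p1 p3 PA l%:R) => //.
- by rewrite invr_gt0.
- by rewrite exprVn sqr_sqrtr ?divff ?gt_eqF // ltW.
- exact: lo_bound_ge0.
- exact: lo_bound_sqrt.
- rewrite /L ler_pdivlMr ?sqrtr_gt0 // mul1r; apply: (@le_trans _ _ 1); last by rewrite ler1n.
  by rewrite -sqrtr1 ler_wsqrtr.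
- by apply: le_trans mB; rewrite ler_nat; clear; lia.
- by rewrite expn1 -natrM ler_nat; clear -b8; lia.
- by rewrite -natrM -natrX ler_nat leq_exp2r //; clear -b8; lia.
Qed.

End FiniteMain.

(* The analysis library shadows [inE] and other finite-set lemmas used so far. *)
From mathcomp Require Import all_classical all_reals all_analysis measurable_realfun.

(** * The smallest singular value *)

Section SingularValues.
Variables (R : realType) (n : nat).
Implicit Types (A H : 'M[R[i]]_n).
Local Open Scope complex_scope.

Lemma size_eigenvalues A : size (eigenvalues A) = n.
Proof.
rewrite /eigenvalues; case: closed_field_poly_normal => r /= rE.
have := size_char_poly A; rewrite {}rE (monicP (char_poly_monic A)) scale1r.
by rewrite size_prod_XsubC => -[].
Qed.

Lemma mem_eigenvalues A l : (l \in eigenvalues A) = eigenvalue A l.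
Proof.
rewrite eigenvalue_root_char /eigenvalues; case: closed_field_poly_normal => r /= rE.
by rewrite [in RHS]rE (monicP (char_poly_monic A)) scale1r root_prod_XsubC.
Qed.

Lemma last_sing_val_le A t : (0 < n)%N ->
  sing_val A n <= t <-> exists2 l, eigenvalue (conjT A *m A) l & Num.sqrt (complex.Re l) <= t.
Proof.
move=> n0; set s := [seq Num.sqrt (complex.Re l) | l <- eigenvalues (conjT A *m A)].
have ss : size s = n by rewrite size_map size_eigenvalues.
pose leT (x y : R) := y <= x.
have szs : size (sort leT s) = n by rewrite size_sort.
have mem_s x : (x \in sort leT s) = (x \in s) by rewrite mem_sort.
have nn : (n.-1 < n)%N by rewrite prednK.
rewrite /sing_val /singular_values -/s -/leT; split=> [h|[l le lt]].
  have : nth 0 (sort leT s) n.-1 \in s by rewrite -mem_s mem_nth // szs.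
  move=> /mapP[l ll e]; exists l; first by rewrite -mem_eigenvalues.
  by rewrite -e.
have ls : Num.sqrt (complex.Re l) \in sort leT s.
  by rewrite mem_s; apply: (map_f (fun l => Num.sqrt (complex.Re l))); rewrite mem_eigenvalues.
have tot : total leT by move=> x y; rewrite /leT le_total.
have tr : transitive leT by move=> x y z h1 h2; apply: le_trans h2 h1.
have rf : reflexive leT by move=> x; rewrite /leT.
have idx : (index (Num.sqrt (complex.Re l)) (sort leT s) < n)%N by rewrite -szs index_mem.
have := sorted_leq_nth tr rf 0 (sort_sorted tot s).
move=> /(_ (index (Num.sqrt (complex.Re l)) (sort leT s)) n.-1).
rewrite !unfold_in /= szs idx nn -ltnS prednK // idx nth_index // => /(_ isT isT isT) h.
exact: le_trans h lt.
Qed.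

Lemma mul_conjc (x : R[i]) : x * x^* = ((nrm x) ^+ 2)%:C.
Proof.
rewrite nrmE sqr_sqrtr ?addr_ge0 ?sqr_ge0 //; case: x => a b.
by apply/eqP; rewrite eq_complex /=; apply/andP; split; apply/eqP; ring.
Qed.

(** Eigenvectors are row vectors here, so the column vector is the conjugate [x] of [v]: multiplying
    [v A^* A = l v] by [x] on the right gives [|A x|^2 = l |x|^2]. *)
Lemma eigen_gram A l : eigenvalue (conjT A *m A) l ->
  exists2 v : 'I_n -> R[i], exists i, v i != 0 &
    (\sum_i nrm (\sum_j A i j * v j) ^+ 2)%:C = l * (\sum_j nrm (v j) ^+ 2)%:C.
Proof.
move=> /eigenvalueP[v ev v0].
exists (fun j => (v 0 j)^*).
  by case/rV0Pn: v0 => j vj; exists j; rewrite conjc_eq0.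
have ex : v *m conjT A *m A = l *: v by rewrite -mulmxA.
pose x : 'cV[R[i]]_n := \col_j (v 0 j)^*.
have := congr1 (fun M : 'rV_n => (M *m x) 0 0) ex.
rewrite -!mulmxA -scalemxAl [in RHS]mxE !mxE => h.
have e1 j : (v 0 j) * (v 0 j)^* = ((nrm ((v 0 j)^*)) ^+ 2)%:C.
  by rewrite mul_conjc !nrmE; case: (v 0 j) => a b /=; rewrite sqrrN.
transitivity (\sum_i (v *m conjT A) 0 i * (A *m x) i 0).
  rewrite rmorph_sum; apply: eq_bigr => i _; rewrite /= !mxE.
  rewrite (_ : \sum_j A i j * x j 0 = \sum_j A i j * (v 0 j)^*); last by apply: eq_bigr => j _; rewrite mxE.
  have -> : \sum_j v 0 j * (conjT A) j i = (\sum_j A i j * (v 0 j)^*)^*.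
    rewrite rmorph_sum; apply: eq_bigr => j _.
    by rewrite rmorphM /= conjcK !mxE mulrC.
  by rewrite mulrC mul_conjc.
transitivity ((v *m conjT A *m (A *m x)) 0 0); first by rewrite [RHS]mxE.
rewrite mulmxA ex -scalemxAl mxE; congr (_ * _).
rewrite mxE rmorph_sum; apply: eq_bigr => j _; rewrite /= mxE e1 //.
Qed.

Lemma eigen_gram_ge0 A l : eigenvalue (conjT A *m A) l -> 0 <= l.
Proof.
move=> /eigen_gram[v [i vi]]; set a := \sum_i _; set c := \sum_j _ => h.
have c0 : 0 < c.
  rewrite /c (bigD1 i) //= ltr_pwDl ?exprn_gt0 ?nrm_gt0 //.
  by apply: sumr_ge0 => j _; apply: sqr_ge0.
have a0 : 0 <= a by apply: sumr_ge0 => j _; apply: sqr_ge0.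
have -> : l = (a / c)%:C.
  rewrite rmorphM /= h fmorphV -mulrA divff ?mulr1 //.
  by rewrite fmorph_eq0 gt_eqF.
by rewrite ler0c divr_ge0 // ltW.
Qed.

Lemma sing_val_vector A t : (0 < n)%N -> 0 <= t -> sing_val A n <= t ->
  exists2 v : 'I_n -> R[i], exists i, v i != 0 &
    \sum_i nrm (\sum_j A i j * v j) ^+ 2 <= t ^+ 2 * \sum_j nrm (v j) ^+ 2.
Proof.
move=> n0 t0 /(last_sing_val_le A t n0)[l el lt].
have l0 := eigen_gram_ge0 el.
have [v v0 h] := eigen_gram el; exists v => //.
have := congr1 (@complex.Re R) h; rewrite /= -(RRe_real (ger0_real l0)) -rmorphM /= => ->.
have rl0 : 0 <= complex.Re l by move: l0; rewrite lecE => /andP[].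
rewrite ler_wpM2r ?sumr_ge0 // => [j _|]; first exact: sqr_ge0.
by rewrite -(sqr_sqrtr rl0) lerXn2r ?nnegrE ?sqrtr_ge0.
Qed.

Lemma prod_XaddC_coef_gt0 (r : seq R[i]) : all (fun x => x < 0) r ->
  (forall i, (i <= size r)%N -> 0 < (\prod_(z <- r) ('X - z%:P))`_i).
Proof.
elim: r => [|x r IH] /=.
  by move=> _ i; rewrite leqn0 => /eqP ->; rewrite big_nil coef1.
move=> /andP[x0 /IH {}IH] i ir; rewrite big_cons mulrBl coefB coefXM coefCM.
have nx : 0 < - x by rewrite oppr_gt0.
case: i ir => [|i] ir; first by rewrite /= sub0r -mulNr mulr_gt0 // IH.
rewrite /= -mulNr; have [h|h] := leqP i.+1 (size r).
  by rewrite addr_gt0 ?mulr_gt0 ?IH // ltnW.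
have -> : (\prod_(z <- r) ('X - z%:P))`_i.+1 = 0.
  by rewrite nth_default // size_prod_XsubC.
by rewrite mulr0 addr0 IH.
Qed.

(** The purpose is measurability: these coefficients are polynomials in the entries and their
    conjugates. If [s_n > t], all eigenvalues of [t^2 - A^* A] are negative and the coefficients are
    positive; conversely a polynomial with positive coefficients has no root in [[0, +oo)]. *)
Lemma sing_val_gt_coef A t : (0 < n)%N -> 0 <= t ->
  ~ sing_val A n <= t <->
  forall i : 'I_n.+1, 0 < (char_poly ((t ^+ 2)%:C%:M - conjT A *m A))`_i.
Proof.
move=> n0 t0; set H := conjT A *m A; set B := _ - H.
have eB l : eigenvalue B l = eigenvalue H ((t ^+ 2)%:C - l).
  apply/eigenvalueP/eigenvalueP => -[v ev v0]; exists v => //.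
    have -> : H = (t ^+ 2)%:C%:M - B by rewrite /B opprB addrC subrK.
    by rewrite mulmxBr mul_mx_scalar ev scalerBl.
  by rewrite /B mulmxBr mul_mx_scalar ev scalerBl opprB addrC subrK.
split=> [ns i|pos /(last_sing_val_le A t n0)[l el lt]].
  have : char_poly B = \prod_(z <- eigenvalues B) ('X - z%:P).
    rewrite /eigenvalues; case: closed_field_poly_normal => r /= rE.
    by rewrite [LHS]rE (monicP (char_poly_monic B)) scale1r.
  move=> ->; apply: prod_XaddC_coef_gt0; last by rewrite size_eigenvalues -ltnS.
  apply/allP => l; rewrite mem_eigenvalues eB => el.
  have l0 := eigen_gram_ge0 el.
  rewrite -oppr_gt0 -(ltrDl (t ^+ 2)%:C) -(RRe_real (ger0_real l0)) ltcR.
  rewrite ltNge; apply/negP => h; apply: ns; apply/(last_sing_val_le A t n0).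
  exists ((t ^+ 2)%:C - l) => //.
  by rewrite -[leRHS](ger0_norm t0) -sqrtr_sqr ler_wsqrtr.
have l0 := eigen_gram_ge0 el.
have rl0 : 0 <= complex.Re l by move: l0; rewrite lecE => /andP[].
have lE := RRe_real (ger0_real l0).
have lt2 : l <= (t ^+ 2)%:C.
  by rewrite -lE lecR -(sqr_sqrtr rl0) lerXn2r ?nnegrE ?sqrtr_ge0.
have : eigenvalue B ((t ^+ 2)%:C - l) by rewrite eB subKr.
rewrite eigenvalue_root_char => /rootP; rewrite horner_coef size_char_poly.
rewrite big_ord_recl /= expr0 mulr1 => /eqP; rewrite gt_eqF //.
rewrite ltr_wpDr ?(pos ord0) //; apply: sumr_ge0 => i _.
by rewrite mulr_ge0 ?exprn_ge0 ?subr_ge0 // ltW // (pos (lift ord0 i)).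
Qed.

End SingularValues.

(** * Measurability of singular value events *)

Section ComplexMeasurability.
Variables (d : measure_display) (T : measurableType d) (R : realType).
Local Open Scope complex_scope.
Implicit Types f g : T -> R[i].

Definition cmeas f :=
  measurable_fun setT (fun w => complex.Re (f w)) /\
  measurable_fun setT (fun w => complex.Im (f w)).

Lemma cmeas_ext f g : f =1 g -> cmeas f -> cmeas g.
Proof. by move=> /funext ->. Qed.

Lemma cmeas_cst c : cmeas (fun=> c).
Proof. by split; apply: measurable_cst. Qed.

Lemma cmeasD f g : cmeas f -> cmeas g -> cmeas (fun w => f w + g w).
Proof.
move=> [f1 f2] [g1 g2]; split.
  by under eq_fun do rewrite raddfD; apply: measurable_funD.
by under eq_fun do rewrite raddfD; apply: measurable_funD.
Qed.

Lemma cmeasM f g : cmeas f -> cmeas g -> cmeas (fun w => f w * g w).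
Proof.
move=> [f1 f2] [g1 g2]; split.
  rewrite (_ : (fun w => _) =
      (fun w => complex.Re (f w) * complex.Re (g w) - complex.Im (f w) * complex.Im (g w))).
    by apply: measurable_funB; apply: measurable_funM.
  by apply: funext => w; case: (f w) => a b; case: (g w).
rewrite (_ : (fun w => _) =
    (fun w => complex.Re (f w) * complex.Im (g w) + complex.Im (f w) * complex.Re (g w))).
  by apply: measurable_funD; apply: measurable_funM.
by apply: funext => w; case: (f w) => a b; case: (g w) => a' b' /=; rewrite addrC (mulrC b).
Qed.

Lemma cmeas_conj f : cmeas f -> cmeas (fun w => (f w)^*).
Proof.
move=> [f1 f2]; split.
  by rewrite (_ : (fun w => _) = (fun w => complex.Re (f w))) //; apply: funext => w; case: (f w).
rewrite (_ : (fun w => _) = (fun w => - complex.Im (f w))); first exact: measurable_funN.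
by apply: funext => w; case: (f w).
Qed.

Lemma cmeasN f : cmeas f -> cmeas (fun w => - f w).
Proof.
move=> hf; apply: (cmeas_ext (f := fun w => (-1) * f w)); first by move=> w; rewrite mulN1r.
by apply/cmeasM/hf/cmeas_cst.
Qed.

Lemma cmeas_sum (J : Type) (r : seq J) (F : J -> T -> R[i]) :
  (forall j, cmeas (F j)) -> cmeas (fun w => \sum_(j <- r) F j w).
Proof.
move=> hF; elim: r => [|j r IH]; first by under eq_fun do rewrite big_nil; apply: cmeas_cst.
by under eq_fun do rewrite big_cons; apply: cmeasD.
Qed.

Definition pmeas (p : T -> {poly R[i]}) := forall k, cmeas (fun w => (p w)`_k).

Lemma pmeas_cst c : pmeas (fun=> c).
Proof. by move=> k; apply: cmeas_cst. Qed.

Lemma pmeasC f : cmeas f -> pmeas (fun w => (f w)%:P).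
Proof.
move=> hf k; under eq_fun do rewrite coefC.
by case: (k == 0)%N; [|apply: cmeas_cst].
Qed.

Lemma pmeasD p q : pmeas p -> pmeas q -> pmeas (fun w => p w + q w).
Proof. by move=> hp hq k; under eq_fun do rewrite coefD; apply: cmeasD. Qed.

Lemma pmeasM p q : pmeas p -> pmeas q -> pmeas (fun w => p w * q w).
Proof.
move=> hp hq k; under eq_fun do rewrite coefM.
by apply: cmeas_sum => j; apply: cmeasM.
Qed.

Lemma pmeas_sum (J : Type) (r : seq J) (F : J -> T -> {poly R[i]}) :
  (forall j, pmeas (F j)) -> pmeas (fun w => \sum_(j <- r) F j w).
Proof.
move=> hF; elim: r => [|j r IH]; first by under eq_fun do rewrite big_nil; apply: pmeas_cst.
by under eq_fun do rewrite big_cons; apply: pmeasD.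
Qed.

Lemma pmeas_prod (J : Type) (r : seq J) (F : J -> T -> {poly R[i]}) :
  (forall j, pmeas (F j)) -> pmeas (fun w => \prod_(j <- r) F j w).
Proof.
move=> hF; elim: r => [|j r IH]; first by under eq_fun do rewrite big_nil; apply: pmeas_cst.
by under eq_fun do rewrite big_cons; apply: pmeasM.
Qed.

Lemma pmeas_char_poly n (M : T -> 'M[R[i]]_n) :
  (forall i j, cmeas (fun w => M w i j)) -> pmeas (fun w => char_poly (M w)).
Proof.
move=> hM.
have entry i j : pmeas (fun w => char_poly_mx (M w) i j).
  rewrite (_ : (fun w => _) = (fun w => ('X *+ (i == j)) + (- M w i j)%:P)).
    by apply: pmeasD; [apply: pmeas_cst|apply/pmeasC/cmeasN].
  by apply: funext => w; rewrite !mxE polyCN.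
by apply: pmeas_sum => s; apply: pmeasM; [exact: pmeas_cst|exact: pmeas_prod].
Qed.

Lemma measurable_gt0 f : cmeas f -> measurable [set w | 0 < f w]%classic.
Proof.
move=> [f1 f2].
rewrite (_ : [set w | _]%classic = ((fun w => complex.Im (f w)) @^-1` [set 0] `&`
   (fun w => complex.Re (f w)) @^-1` [set x | 0 < x])%classic).
  apply: measurableI; rewrite -[X in measurable X]setTI; [exact: f2|apply: f1 => //].
  have -> : [set x : R | 0 < x]%classic = `]0, +oo[%classic; last exact: measurable_itv.
  by apply/seteqP; split=> x /=; rewrite in_itv /= andbT.
apply/seteqP; split=> w /=; rewrite ltcE /=; first by move=> /andP[/eqP].
by move=> [-> ->]; rewrite eqxx.
Qed.

Lemma measurable_sing_val_le n (A : T -> 'M[R[i]]_n) t : (0 < n)%N -> 0 <= t ->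
  (forall i j, cmeas (fun w => A w i j)) ->
  measurable [set w | sing_val (A w) n <= t]%classic.
Proof.
move=> n0 t0 hA; rewrite -[X in measurable X]setCK; apply: measurableC.
pose p w := char_poly ((t ^+ 2)%:C%:M - conjT (A w) *m A w).
have hp : pmeas p.
  apply: pmeas_char_poly => i j.
  apply: (cmeas_ext (f := fun w => ((t ^+ 2)%:C%:M : 'M[R[i]]_n) i j + - \sum_k (A w k i)^* * A w k j)).
    by move=> w; rewrite !mxE; congr (_ - _); apply: eq_bigr => k _; rewrite !mxE.
  apply: cmeasD; first exact: cmeas_cst.
  by apply/cmeasN/cmeas_sum => k; apply: cmeasM; first exact: cmeas_conj.
rewrite (_ : (~` _)%classic = (\bigcap_(i in [set: 'I_n.+1]) [set w | (0 < (p w)`_i)%R])%classic).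
  by apply: fin_bigcap_measurable => // i _; apply: measurable_gt0.
apply/seteqP; split=> w /=; first by move=> /(sing_val_gt_coef (A w) n0 t0) h i _; apply: h.
by move=> h; apply/(sing_val_gt_coef (A w) n0 t0) => i; apply: h.
Qed.

End ComplexMeasurability.

(** * Moments and discretization *)

Section Moments.
Variables (d : measure_display) (T : measurableType d) (R : realType).
Variable P : probability T R.
Implicit Types f g : T -> R.

Notation intg f := (P.-integrable setT (EFin \o f)).

Lemma integrable_of_ge0 f (M : R) : measurable_fun setT f -> (forall w, 0 <= f w) ->
  (\int[P]_w (f w)%:E <= M%:E)%E -> intg f.
Proof.
move=> mf f0 fM; apply/integrableP; split; first exact/measurable_EFinP.
rewrite (eq_integral (fun w => (f w)%:E)); first by apply: le_lt_trans fM _; rewrite ltry.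
by move=> w _ /=; rewrite ger0_norm.
Qed.

Lemma intgD f g : intg f -> intg g -> intg (fun w => f w + g w).
Proof. exact: integrableD. Qed.

Lemma intgZ c f : intg f -> intg (fun w => c * f w).
Proof. exact: integrableZl. Qed.

Lemma intg_cst c : intg (fun=> c).
Proof. exact: finite_measure_integrable_cst. Qed.

Lemma intg_indic (A : set T) : measurable A -> intg (\1_A : T -> R).
Proof. exact: integrable_indic. Qed.

Lemma intg_le f g : measurable_fun setT f -> (forall w, `|f w| <= g w) -> intg g -> intg f.
Proof.
move=> mf fg; apply: le_integrable => //; first exact/measurable_EFinP.
by move=> w _ /=; rewrite lee_fin (le_trans (fg w)) // ler_norm.
Qed.

Lemma markov_ge0 f (c M : R) : measurable_fun setT f -> (forall w, 0 <= f w) -> 0 < c ->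
  (\int[P]_w (f w)%:E <= M%:E)%E -> (P [set w | (c <= f w)%R]%classic <= (M / c)%:E)%E.
Proof.
move=> mf f0 c0 fM; set A := [set w | _]%classic.
have mA : measurable A.
  rewrite -[A]setTI; have -> : A = (f @^-1` `[c, +oo[)%classic.
    by apply/seteqP; split=> w /=; rewrite in_itv /= andbT.
  by apply: mf => //; exact: measurable_itv.
have h : (c%:E * P A <= M%:E)%E.
  apply: le_trans fM; rewrite -[A in P A]setIT -integral_indic // -ge0_integralZl //=.
  - apply: ge0_le_integral => //.
    + by move=> w _; rewrite mule_ge0 // lee_fin ?ltW.
    + by apply: measurable_funeM; apply/measurable_EFinP; apply: measurable_indic.
    + exact/measurable_EFinP.
    + move=> w _ /=; rewrite indicE -EFinM lee_fin.
      by have [/set_mem h|_] := boolP (w \in A); rewrite ?mulr1 ?mulr0.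
  - by apply/measurable_EFinP; apply: measurable_indic.
  - by rewrite lee_fin ltW.
have fA : P A = (fine (P A))%:E by rewrite fineK // fin_num_measure.
by move: h; rewrite fA -EFinM !lee_fin ler_pdivlMr // mulrC.
Qed.

Lemma norm_le_1Dsqr (u v : R) : `|u| <= 1 + (u ^+ 2 + v ^+ 2).
Proof.
rewrite ler_norml; have := sqr_ge0 v; have := sqr_ge0 (u - 1); have := sqr_ge0 (u + 1).
by rewrite !sqrrD !sqrrN; nra.
Qed.

Lemma sqr_dist_le (u v a b : R) :
  (u - a) ^+ 2 + (v - b) ^+ 2 <= 2 * (u ^+ 2 + v ^+ 2) + 2 * (a ^+ 2 + b ^+ 2).
Proof.
rewrite -subr_ge0 [leRHS](_ : _ = (u + a) ^+ 2 + (v + b) ^+ 2); last by ring.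
by rewrite addr_ge0 ?sqr_ge0.
Qed.

Variables (x y : T -> R) (eps C : R).
Hypothesis eps0 : 0 < eps.
Hypotheses (mx : measurable_fun setT x) (my : measurable_fun setT y).
Hypotheses (x0 : (\int[P]_w (x w)%:E = 0)%E) (y0 : (\int[P]_w (y w)%:E = 0)%E).
Hypothesis var1 : (\int[P]_w ((x w) ^+ 2 + (y w) ^+ 2)%:E = 1)%E.
Hypothesis mom : (\int[P]_w ((Num.sqrt ((x w) ^+ 2 + (y w) ^+ 2)) `^ (4 + eps))%:E <= C%:E)%E.

Let q w := (x w) ^+ 2 + (y w) ^+ 2.
Let s w := Num.sqrt (q w) `^ (4 + eps).

Lemma q_ge0 w : 0 <= q w.
Proof. by rewrite addr_ge0 ?sqr_ge0. Qed.

Lemma mq : measurable_fun setT q.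
Proof. by apply: measurable_funD; apply: measurable_funX. Qed.

Lemma ms : measurable_fun setT s.
Proof.
apply: (measurableT_comp (measurable_powR _)).
apply: measurableT_comp mq; apply: continuous_measurable_fun; exact: sqrt_continuous.
Qed.

Lemma sq_le_s w : 1 <= q w -> q w ^+ 2 <= s w.
Proof.
move=> q1; have s1 : 1 <= Num.sqrt (q w) by rewrite -sqrtr1 ler_wsqrtr.
have -> : q w ^+ 2 = Num.sqrt (q w) `^ 4.
  by rewrite -{1}(sqr_sqrtr (q_ge0 w)) -exprM powR_mulrn ?sqrtr_ge0.
by rewrite ler_powR // lerDl ltW.
Qed.

(** Markov's inequality for the moment of order [4 + eps]. The power 4 matters: at most [3 b^3]
    entries have to stay below [b], which leaves a total of [O(1/b)]. *)
Lemma tail_le (b : R) : 1 <= b -> (P [set w | (b ^+ 2 < q w)%R]%classic <= (C / b ^+ 4)%:E)%E.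
Proof.
move=> b1; have b0 : 0 < b by apply: lt_le_trans b1.
apply: (le_trans _ (markov_ge0 ms _ _ mom)).
- apply: le_measure; rewrite ?inE.
  + rewrite -[X in measurable X]setTI.
    have -> : [set w | b ^+ 2 < q w]%classic = (q @^-1` `]b ^+ 2, +oo[)%classic.
      by apply/seteqP; split=> w /=; rewrite in_itv /= andbT.
    by apply: mq => //; exact: measurable_itv.
  + rewrite -[X in measurable X]setTI.
    have -> : [set w | b ^+ 4 <= s w]%classic = (s @^-1` `[b ^+ 4, +oo[)%classic.
      by apply/seteqP; split=> w /=; rewrite in_itv /= andbT.
    by apply: ms => //; exact: measurable_itv.
  + move=> w /= h; apply: le_trans (sq_le_s _); last first.
      by apply: le_trans (ltW h); rewrite exprn_ege1.
    by rewrite (exprM b 2 2) lerXn2r ?nnegrE ?q_ge0 ?sqr_ge0 // ltW.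
- by move=> w; apply: powR_ge0.
- exact: exprn_gt0.
Qed.

(** The second moment about [(a, b)] is [1 + a^2 + b^2]; the disc contributes at most [1/4] and the
    higher moment caps the share of large values, so the complement must carry mass. Both sides grow
    with [a^2 + b^2], which makes the bound uniform in the centre. *)
Lemma small_ball (a b : R) :
  let K := Num.max 1 (8 * C) in
  (P [set w | ((x w - a) ^+ 2 + (y w - b) ^+ 2 <= 1/4)%R]%classic <= (1 - (4 * K)^-1)%:E)%E.
Proof.
rewrite /=; set K := Num.max 1 _; have K1 : 1 <= K by rewrite le_max lexx.
have K8 : 8 * C <= K by rewrite le_max lexx orbT.
have K0 : 0 < K by apply: lt_le_trans K1.
pose g w := (x w - a) ^+ 2 + (y w - b) ^+ 2.
have mg : measurable_fun setT g.
  by apply: measurable_funD; apply: measurable_funX; apply: measurable_funB.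
set A := [set w | _]%classic.
have mA : measurable A.
  rewrite -[A]setTI; have -> : A = (g @^-1` `]-oo, (1/4)%R])%classic.
    by apply/seteqP; split=> w /=; rewrite in_itv.
  by apply: mg => //; exact: measurable_itv.
pose B := (~` A)%classic; have mB : measurable B by apply: measurableC.
pose c := 2 * K + 2 * (a ^+ 2 + b ^+ 2).
have iq : intg q by apply: (@integrable_of_ge0 _ 1 mq) => //; [exact: q_ge0|rewrite var1].
have isf : intg s by apply: (@integrable_of_ge0 _ C ms) => // w; apply: powR_ge0.
have ix : intg x.
  apply: (@intg_le _ (fun w => 1 + q w)) => //; last by apply: intgD => //; apply: intg_cst.
  by move=> w; apply: norm_le_1Dsqr.
have iy : intg y.
  apply: (@intg_le _ (fun w => 1 + q w)) => //; last by apply: intgD => //; apply: intg_cst.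
  by move=> w; rewrite /q [_ ^+ 2 + _]addrC; apply: norm_le_1Dsqr.
(* Outside the disc the squared distance is at most [2 q + 2 (a^2 + b^2)], where [q <= K] or else
   [q <= q^2 / K <= s / K]. The linear terms have mean zero. *)
have ptw w : q w + (a ^+ 2 + b ^+ 2) <=
    1 / 4 + (c * \1_B w + (2 / K * s w + (2 * a * x w + 2 * b * y w))).
  have e : g w = q w + (a ^+ 2 + b ^+ 2) - (2 * a * x w + 2 * b * y w) by rewrite /g /q; ring.
  have s0 : 0 <= s w by apply: powR_ge0.
  have t0 : 0 <= 2 / K * s w by rewrite mulr_ge0 // divr_ge0 // ltW.
  rewrite indicE; have [/set_mem|/negP nB] := boolP (w \in B); last first.
    have : w \in A by apply: contrapT => h; apply: nB; rewrite inE => /mem_set.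
    move=> /set_mem h0; have h : g w <= 1 / 4 := h0.
    by rewrite mulr0 add0r; move: e h t0; lra.
  move=> _; rewrite mulr1.
  suff : g w <= c + 2 / K * s w by move: e; lra.
  have g2 : g w <= 2 * q w + 2 * (a ^+ 2 + b ^+ 2).
    exact: sqr_dist_le.
  have [qK|/ltW Kq] := leP (q w) K; first by move: g2 qK t0; rewrite /c; lra.
  have q1 := le_trans K1 Kq.
  have : q w <= s w / K.
    rewrite ler_pdivlMr //; apply: le_trans (sq_le_s q1).
    by rewrite expr2 ler_wpM2l // q_ge0.
  by rewrite /c mulrAC -mulrA; move: g2 K0; lra.
have i1 : intg (fun w => q w + (a ^+ 2 + b ^+ 2)) by apply: intgD => //; apply: intg_cst.
have i5 : intg (fun w => 2 * a * x w + 2 * b * y w) by apply: intgD; apply: intgZ.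
have i4 : intg (fun w => 2 / K * s w + (2 * a * x w + 2 * b * y w)).
  by apply: intgD => //; apply: intgZ.
have i6 : intg (fun w => c * \1_B w) by apply/intgZ/intg_indic.
have i3 : intg (fun w => c * \1_B w + (2 / K * s w + (2 * a * x w + 2 * b * y w))) by apply: intgD.
have i2 : intg (fun w => 1 / 4 + (c * \1_B w + (2 / K * s w + (2 * a * x w + 2 * b * y w)))).
  by apply: intgD => //; apply: intg_cst.
have := le_Rintegral measurableT i1 i2 (fun w _ => ptw w).
have PT : fine (P [set: T]%classic) = 1 by rewrite probability_setT.
rewrite (RintegralD measurableT iq (intg_cst _)) (RintegralD measurableT (intg_cst _) i3).
rewrite (RintegralD measurableT i6 i4) (RintegralD measurableT (intgZ _ isf) i5).
rewrite (RintegralD measurableT (intgZ _ ix) (intgZ _ iy)).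
rewrite !(RintegralZl _ _ ix, RintegralZl _ _ iy, RintegralZl _ _ isf, RintegralZl _ _ (intg_indic mB)) //.
rewrite !Rintegral_cst // PT !mulr1.
have -> : (\int[P]_w q w)%R = 1 by rewrite /Rintegral var1.
have -> : (\int[P]_w x w)%R = 0 by rewrite /Rintegral x0.
have -> : (\int[P]_w y w)%R = 0 by rewrite /Rintegral y0.
have -> : (\int[P]_w \1_B w)%R = fine (P B) by rewrite /Rintegral integral_indic // setIT.
have sC : (\int[P]_w s w)%R <= C.
  rewrite /Rintegral -lee_fin fineK //.
  exact: (integrable_fin_num _ isf).
rewrite !mulr0 !addr0 => h.
have PA : P A = (1 - fine (P B))%:E.
  have fA : P A = (fine (P A))%:E by rewrite fineK // fin_num_measure.
  by rewrite /B probability_setC // fA -EFinB /= subKr.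
rewrite PA lee_fin lerD2l lerN2.
have h2 : 2 / K * (\int[P]_w s w)%R <= 1 / 4.
  apply: (@le_trans _ _ (2 / K * C)); first by rewrite ler_wpM2l // divr_ge0 // ltW.
  by rewrite mulrAC ler_pdivrMr //; move: K8; lra.
have {h2}h : 1 / 2 + (a ^+ 2 + b ^+ 2) <= c * fine (P B) by move: h h2; lra.
have ab : 0 <= a ^+ 2 + b ^+ 2 by rewrite addr_ge0 ?sqr_ge0.
have p0 : 0 <= fine (P B) by apply: fine_ge0.
have c0 : 0 < c by move: ab K0; rewrite /c; lra.
set v := (4 * K)^-1; have vK : 4 * K * v = 1 by rewrite /v mulfV // mulf_neq0 // gt_eqF.
have v4 : v <= 1 / 4.
  by rewrite /v div1r lef_pV2 ?posrE ?mulr_gt0 // ler_peMr.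
rewrite leNgt; apply/negP => pv.
have := lt_le_trans (le_lt_trans h _) (lexx (c * v)); rewrite ltr_pM2l // => /(_ pv).
by rewrite /c => h'; have := ler_wpM2l ab v4; move: h' vK ab; nra.
Qed.

End Moments.

(** * Finite codings of random variables *)

Section FiniteAdditivity.
Variables (d : measure_display) (T : measurableType d) (R : realType).
Variable P : probability T R.

Lemma measurable_fibers (X : finType) (F : T -> X) (Q : pred X) :
  (forall x, measurable (F @^-1` [set x])%classic) -> measurable [set w | Q (F w)]%classic.
Proof.
move=> mF; rewrite (_ : [set w | _]%classic = \bigcup_(x in [set x | Q x]) (F @^-1` [set x]))%classic.
  by apply: fin_bigcup_measurable => // x _; apply: mF.
by apply/seteqP; split=> w /=; [move=> Qw; exists (F w)|move=> [x Qx] ->].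
Qed.

Lemma prob_fibers (X : finType) (F : T -> X) (Q : pred X) :
  (forall x, measurable (F @^-1` [set x])%classic) ->
  P [set w | Q (F w)]%classic = (\sum_(x | Q x) P (F @^-1` [set x])%classic)%E.
Proof.
move=> mF.
have H (r : seq X) : uniq r ->
    P [set w | F w \in r]%classic = (\sum_(x <- r) P (F @^-1` [set x])%classic)%E.
  elim: r => [_|x r IH /= /andP[xr ur]].
    by rewrite big_nil -(measure0 P); congr (P _); apply/seteqP; split.
  rewrite big_cons -(IH ur) -measureU //.
  - congr (P _); apply/seteqP; split=> w /=; rewrite in_cons.
      by move=> /orP[/eqP h|h]; [left|right].
    by case=> ->; rewrite ?eqxx ?orbT.
  - exact: (@measurable_fibers _ _ (mem r)).
  - by apply/seteqP; split=> w //= -[->]; rewrite (negbTE xr).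
have := H [seq x <- index_enum X | Q x]; rewrite big_filter => <-.
  congr (P _); apply/seteqP; split=> w /=; rewrite mem_filter mem_index_enum andbT //.
by rewrite filter_uniq // index_enum_uniq.
Qed.

Lemma union_bound (J : finType) (A : J -> set T) (p : R) :
  (forall j, measurable (A j)) -> (forall j, (P (A j) <= p%:E)%E) ->
  (P [set w | exists j, A j w]%classic <= (#|J|%:R * p)%:E)%E.
Proof.
move=> mA pA.
have H (r : seq J) : measurable [set w | exists2 j, j \in r & A j w]%classic /\
    (P [set w | exists2 j, j \in r & A j w]%classic <= ((size r)%:R * p)%:E)%E.
  elim: r => [|j r [mr IH]].
    rewrite mul0r (_ : [set w | _]%classic = set0); first by rewrite measure0.
    by apply/seteqP; split=> w //= [].
  rewrite (_ : [set w | _]%classic = (A j `|` [set w | exists2 j, j \in r & A j w])%classic).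
    split; first exact: measurableU.
    apply: le_trans (measureU2 _ (mA j) mr) _.
    by rewrite /= -natr1 addrC mulrDl mul1r EFinD leeD.
  apply/seteqP; split=> w /=.
    by move=> [k]; rewrite inE => /orP[/eqP ->|kr kw]; [left|right; exists k].
  by move=> [h|[k kr kw]]; [exists j; rewrite ?mem_head|exists k; rewrite // inE kr orbT].
have [_] := H (enum J); rewrite -cardE; congr (P _ <= _)%E.
by apply/seteqP; split=> w /= [j]; [move=> _ h; exists j|exists j; rewrite ?mem_enum].
Qed.

End FiniteAdditivity.

Section Coding.
Variables (d : measure_display) (T : measurableType d) (R : realType).
Variables (P : probability T R) (I : finType) (Y : I -> T -> R * R).
Hypothesis mY : forall k, measurable_fun setT (Y k).
Hypothesis indep : mutually_independent P Y.
Hypothesis ident : identically_distributed P Y.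
Variables (S : finType) (code : R * R -> S) (k0 : I).
Hypothesis mcode : forall s, measurable (code @^-1` [set s])%classic.

Definition cell_prob (s : S) : R := fine (P (Y k0 @^-1` (code @^-1` [set s]))%classic).

Lemma measurable_cell k s : measurable (Y k @^-1` (code @^-1` [set s]))%classic.
Proof. by rewrite -[X in measurable X]setTI; apply: mY. Qed.

Lemma cell_probE k s : P (Y k @^-1` (code @^-1` [set s]))%classic = (cell_prob s)%:E.
Proof. by rewrite (ident k k0 (mcode s)) /cell_prob fineK // fin_num_measure //; apply: measurable_cell. Qed.

Lemma cell_prob_ge0 s : 0 <= cell_prob s.
Proof. exact: fine_ge0. Qed.

Lemma prob_code (Q : pred S) :
  P [set w | Q (code (Y k0 w))]%classic = (\sum_s cell_prob s * (Q s)%:R)%:E.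
Proof.
rewrite (prob_fibers P (F := code \o Y k0) Q) => [|s]; last exact: measurable_cell.
rewrite big_mkcond -sumEFin; apply: eq_bigr => s _.
rewrite [P _](_ : _ = (cell_prob s)%:E); last exact: (cell_probE k0 s).
by case: (Q s); rewrite ?mulr1 ?mulr0.
Qed.

Lemma cell_prob_sum1 : \sum_s cell_prob s = 1.
Proof.
have := prob_code predT; rewrite [LHS](_ : _ = P setT); last by congr (P _); apply/seteqP; split.
rewrite probability_setT => -[->]; apply: eq_bigr => s _; by rewrite mulr1.
Qed.

(** The bridge between the two settings: every [Q] defines a finite union of cells, and independence
    gives each cell its weight in the product measure. *)
Lemma prob_code_all (Q : {ffun I -> S} -> Prop) :
  measurable [set w | Q [ffun k => code (Y k w)]]%classic /\
  P [set w | Q [ffun k => code (Y k w)]]%classic = (pr cell_prob Q)%:E.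
Proof.
pose F w : {ffun I -> S} := [ffun k => code (Y k w)].
have FE s : (F @^-1` [set s] = \bigcap_(k in [set: I]) (Y k @^-1` (code @^-1` [set s k])))%classic.
  apply/seteqP; split=> w /=; first by move=> <- k _ /=; rewrite ffunE.
  by move=> h; apply/ffunP => k; rewrite ffunE; apply: h.
have mF s : measurable (F @^-1` [set s])%classic.
  by rewrite FE; apply: fin_bigcap_measurable => // k _; apply: measurable_cell.
have -> : [set w | Q [ffun k => code (Y k w)]]%classic = [set w | `[< Q (F w) >]]%classic.
  by apply/seteqP; split=> w /= /asboolP.
split; first exact: (measurable_fibers (fun s => `[< Q s >]) mF).
rewrite (prob_fibers P (fun s => `[< Q s >]) mF) big_mkcond /pr /ex -sumEFin.
apply: eq_bigr => s _; rewrite FE (indep (A := fun k => (code @^-1` [set s k])%classic)) //.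
rewrite (eq_bigr (fun k => (cell_prob (s k))%:E)) => [|k _]; last exact: cell_probE.
by rewrite prodEFin /weight; case: `[< _ >]; rewrite ?mulr1 ?mulr0.
Qed.

End Coding.

(** * Linear and block indices of the band matrix *)

Section BlockIndex.
Variables m b : nat.
Local Open Scope nat_scope.

Lemma blk_lt (y : 'I_m * 'I_b) : y.1 * b + y.2 < m * b.
Proof.
case: y => i r /=; have ib : i.+1 * b <= m * b by rewrite leq_mul2r ltn_ord orbT.
by apply: leq_trans ib; rewrite mulSn addnC ltn_add2r.
Qed.

Definition blk (y : 'I_m * 'I_b) : 'I_(m * b) := Ordinal (blk_lt y).
Definition unblk (p : 'I_(m * b)) : 'I_m * 'I_b := (blkq p, blkr p).

Lemma unblkK : cancel unblk blk.
Proof. by move=> p; apply: val_inj; rewrite /= -divn_eq. Qed.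

Lemma blkK : cancel blk unblk.
Proof.
move=> [i r]; have b0 : 0 < b := leq_ltn_trans (leq0n r) (ltn_ord r).
congr pair; apply: val_inj; rewrite /=; first by rewrite divnMDl // divn_small ?addn0.
by rewrite modnMDl modn_small.
Qed.

End BlockIndex.

Section Band.
Variables (R : realType) (l b : nat).
Local Notation m := l.+3.
Local Notation I := ('I_3 * 'I_m * 'I_b * 'I_b)%type.
Local Open Scope complex_scope.

Lemma pos_eq (j i : 'I_m) (o : 'I_3) : (pos j o == i) = (j == rpos i o).
Proof. by apply/eqP/eqP => [<-|->]; rewrite ?rpos_pos ?pos_rpos. Qed.

(** The tests in [block_band] are, in order, the offsets 1, 2 and 0. With at least three blocks they
    exclude each other, so the nested conditionals become a sum. *)
Lemma block_band_pos (W : I -> R[i]) p q :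
  block_band (fun t j => \matrix_(r, k) W (t, j, r, k)) p q =
  \sum_(o | pos (blkq q) o == blkq p) W (ty o, blkq q, blkr p, blkr q).
Proof.
rewrite mxE big_mkcond sum3; cbv zeta; set i := blkq p; set j := blkq q.
have p0 : (pos j ord0 == i) = (j == i.+1 %% m :> nat)%N.
  rewrite pos_eq -val_eqE /= cycE subn0.
  by rewrite -addSnnS modnDr.
have p1 : (pos j (inord 1) == i) = (j == i :> nat).
  rewrite -val_eqE /= cycE inordK //.
  by rewrite addn1 modnDr modn_small // ltn_ord.
have p2 : (pos j ord_max == i) = (j.+1 %% m == i)%N.
  rewrite -val_eqE /= cycE.
  by rewrite addn2 -addSnnS modnDr.
have inj o o' : pos j o = i -> pos j o' = i -> o = o'.
  have small (u : 'I_3) : (u %% m = u)%N by rewrite modn_small // (leq_trans (ltn_ord u)).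
  by move=> <- /eqP; rewrite cyc_eq eqn_modDl !small => /eqP /val_inj.
have t0 : ty ord0 = 1 by apply: val_inj; rewrite /= inordK.
have t1 : ty (inord 1) = 0 by rewrite /ty -!val_eqE /= inordK.
have t2 : ty ord_max = 2 by apply: val_inj.
rewrite -p0 -p1 -p2 t0 t1 t2 !mxE.
case: eqP => [h1|_]; last case: eqP => [h2|_].
- case: eqP => [h|_]; first by have /(congr1 val) := inj _ _ h1 h; rewrite /= inordK.
  case: eqP => [h|_]; rewrite ?add0r ?addr0 //.
  by have /(congr1 val) := inj _ _ h1 h; rewrite /= inordK.
- case: eqP => [h|_]; last by rewrite !add0r.
  by have /(congr1 val) := inj _ _ h2 h.
- by case: eqP => _; rewrite ?mxE ?addr0 ?add0r.
Qed.

Lemma sum_diag_shift (zeta : R[i]) (p q : 'I_(m * b)) :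
  \sum_(o | pos (blkq q) o == blkq p) diag_shift zeta o (blkr p) (blkr q) = - (zeta *+ (p == q)).
Proof.
have e : (p == q) = (blkq q == blkq p) && (blkr p == blkr q).
  by rewrite -(can_eq (@unblkK m b)) xpair_eqE [_ == blkq q]eq_sym.
rewrite big_mkcond (bigD1 (inord 1)) //= big1 ?addr0 => [|o o1]; last first.
  rewrite /diag_shift; case: ifP => // _; case: ifP => // /andP[/eqP o1' _].
  by case/eqP: o1; apply: val_inj; rewrite /= inordK.
have -> : pos (blkq q) (inord 1) = blkq q.
  apply: val_inj; rewrite /= cycE inordK //.
  by rewrite addn1 modnDr modn_small // ltn_ord.
rewrite e /diag_shift inordK //=.
by case: (blkq q == _); case: (blkr p == _); rewrite ?mulr1n ?mulr0n ?oppr0.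
Qed.

Lemma ment_approx (S : finType) (val : S -> R[i]) zeta (W : I -> R[i])
    (s : {ffun I -> S}) dl (p q : 'I_(m * b)) :
  (forall k, nrm (W k - val (s k)) <= dl) ->
  nrm (ment val zeta s (unblk p) (unblk q)
    - (block_band (fun t j => \matrix_(r, k) W (t, j, r, k)) - zeta%:M) p q) <= 3 * dl.
Proof.
move=> h; rewrite mentE mxE block_band_pos big_split /= sum_diag_shift !mxE.
rewrite opprD opprK addrACA addNr addr0 -sumrB.
have dl0 : 0 <= dl by apply: le_trans (h (0, ord0, blkr p, blkr p)); apply: nrm_ge0.
apply: le_trans (nrm_sum _ _) _; rewrite big_mkcond /=.
apply: le_trans (_ : _ <= \sum_(o < 3) dl) _; last by rewrite sumr_const card_ord mulr_natl.
by apply: ler_sum => o _; case: ifP => // _; rewrite nrmBC.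
Qed.

(** Multiplying by [c] undoes the normalization and turns [z] into [zeta]. Passing from the
    Euclidean to the maximum norm costs at most the factor [m b], and discretization adds at most
    [3 dl] per entry. *)
Lemma sing_val_periodic_bad (S : finType) (val : S -> R[i]) zeta (W : I -> R[i])
    (s : {ffun I -> S}) (c t dl tau : R) (z : R[i]) :
  (0 < b)%N -> 0 < c -> 0 <= t -> zeta = c%:C * z ->
  (forall k, nrm (W k - val (s k)) <= dl) ->
  c * t * (m * b)%:R + 3 * dl * (m * b)%:R <= tau ->
  sing_val (c%:C^-1 *: block_band (fun t j => \matrix_(r, k) W (t, j, r, k)) - z%:M) (m * b) <= t ->
  periodic_bad (l := l) val tau zeta s.
Proof.
move=> b0 c0 t0 zE approx small; set BB := block_band _; set A := _ - _.
have N0 : (0 < m * b)%N by rewrite muln_gt0.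
have N1 : 1 <= (m * b)%:R :> R by rewrite ler1n.
move=> /(sing_val_vector N0 t0)[v0 v00 h].
have [k k0 [u1 [q1 uq1]]] := normalize_max v00.
pose u q := k * v0 q.
have cA p q : c%:C * A p q = (BB - zeta%:M) p q.
  rewrite /A !mxE zE mulrDr mulrA divff ?mul1r; last by rewrite fmorph_eq0 gt_eqF.
  by rewrite mulrN mulrnAr.
have res p : nrm (\sum_q A p q * u q) <= t * (m * b)%:R.
  have su : \sum_q nrm (u q) ^+ 2 <= (m * b)%:R.
    apply: le_trans (_ : _ <= \sum_(q < m * b) 1) _; last by rewrite sumr_const card_ord.
    by apply: ler_sum => q _; rewrite expr_le1 ?nrm_ge0 //; exact: u1.
  have h2 : nrm (\sum_q A p q * u q) ^+ 2 <= t ^+ 2 * (m * b)%:R.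
    apply: le_trans (_ : _ <= t ^+ 2 * \sum_q nrm (u q) ^+ 2) _; last by rewrite ler_wpM2l ?sqr_ge0.
    have -> : \sum_q A p q * u q = k * \sum_q A p q * v0 q.
      by rewrite mulr_sumr; apply: eq_bigr => q _; rewrite /u mulrCA.
    have -> : \sum_q nrm (u q) ^+ 2 = nrm k ^+ 2 * \sum_q nrm (v0 q) ^+ 2.
      by rewrite mulr_sumr; apply: eq_bigr => q _; rewrite /u nrmM -exprMn.
    rewrite nrmM exprMn [leRHS]mulrCA ler_wpM2l ?sqr_ge0 //; apply: le_trans h.
    by rewrite [leRHS](bigD1 p) //= lerDl; apply: sumr_ge0 => *; apply: sqr_ge0.
  rewrite -(ler_pXn2r (_ : 0 < 2)%N) ?nnegrE ?nrm_ge0 ?mulr_ge0 //.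
  apply: le_trans h2 _; rewrite exprMn ler_wpM2l ?sqr_ge0 // expr2.
  by rewrite ler_peMr.
exists (fun y => u (blk y)); last by exists (unblk q1); rewrite unblkK.
split=> [y|x]; first exact: u1.
rewrite -(blkK x); set p := blk x; apply: le_trans small.
have -> : \sum_y ment val zeta s (unblk p) y * u (blk y) =
    c%:C * (\sum_q A p q * u q) +
    \sum_q (ment val zeta s (unblk p) (unblk q) - (BB - zeta%:M) p q) * u q.
  rewrite mulr_sumr -big_split /= (reindex (@unblk m b)) /=; last first.
    by exists (@blk m b) => y _; [exact: unblkK|exact: blkK].
  apply: eq_bigr => q _; rewrite unblkK [c%:C * _]mulrA cA -mulrDl; congr (_ * _).
  by rewrite addrC subrK.
apply: le_trans (nrmD _ _) _; apply: lerD.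
  by rewrite nrmM (nrm_real (ltW c0)) -mulrA ler_wpM2l //; exact: ltW.
apply: le_trans (nrm_sum _ _) _.
apply: le_trans (_ : _ <= \sum_(q < m * b) (3 * dl)) _; last by rewrite sumr_const card_ord mulr_natr.
apply: ler_sum => q _; rewrite nrmM; apply: le_trans (_ : _ <= 3 * dl * 1) _; last by rewrite mulr1.
by apply: ler_pM; rewrite ?nrm_ge0 //; [exact: ment_approx|exact: u1].
Qed.

End Band.

(** * Discretization of the atom *)

Section Grid.
Variables (R : realType) (B del : R) (M : nat).
Hypothesis B_gt0 : 0 < B.
Hypothesis del_gt0 : 0 < del.
Hypothesis grid_covers : 2 * B <= M%:R * del.

Definition threshold (i : nat) : R := del * i%:R - B.

Definition overflow (p : R * R) : bool := B ^+ 2 < p.1 ^+ 2 + p.2 ^+ 2.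

Definition grid_bit (p : R * R) (j : option (bool * 'I_M.+1)) : bool :=
  match j with
  | None => overflow p
  | Some (true, i) => p.1 < threshold i
  | Some (false, i) => p.2 < threshold i
  end.

(** Coding by comparisons with all thresholds makes each such bit a half-plane condition, hence
    measurable, and equal codes force points that do not overflow to be [del]-close in each
    coordinate. *)
Definition grid_code (p : R * R) : {ffun option (bool * 'I_M.+1) -> bool} :=
  [ffun j => grid_bit p j].

Lemma measurable_overflow : measurable [set p | overflow p]%classic.
Proof.
have m : measurable_fun setT (fun p : R * R => p.1 ^+ 2 + p.2 ^+ 2).
  by apply: measurable_funD; apply: measurable_funX.
rewrite -[X in measurable X]setTI.
have -> : [set p | overflow p]%classic =
    ((fun p : R * R => p.1 ^+ 2 + p.2 ^+ 2) @^-1` `]B ^+ 2, +oo[)%classic.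
  by apply/seteqP; split=> p /=; rewrite in_itv /= andbT.
by apply: m => //; exact: measurable_itv.
Qed.

Lemma measurable_grid_bit j : measurable [set p | grid_bit p j]%classic.
Proof.
case: j => [[[] i]|]; last exact: measurable_overflow; rewrite -[X in measurable X]setTI.
  have -> : [set p | grid_bit p (Some (true, i))]%classic =
    ((fun p : R * R => p.1) @^-1` `]-oo, threshold i[)%classic.
    by apply/seteqP; split=> p /=; rewrite in_itv.
  by apply: measurable_fst => //; exact: measurable_itv.
have -> : [set p | grid_bit p (Some (false, i))]%classic =
  ((fun p : R * R => p.2) @^-1` `]-oo, threshold i[)%classic.
  by apply/seteqP; split=> p /=; rewrite in_itv.
by apply: measurable_snd => //; exact: measurable_itv.
Qed.

Lemma measurable_grid_code s : measurable (grid_code @^-1` [set s])%classic.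
Proof.
have -> : (grid_code @^-1` [set s] =
    \bigcap_(j in [set: option (bool * 'I_M.+1)]) [set p | grid_bit p j = s j])%classic.
  apply/seteqP; split=> p /=; first by move=> <- j _ /=; rewrite ffunE.
  by move=> h; apply/ffunP => j; rewrite ffunE; apply: h.
apply: fin_bigcap_measurable => // j _; case: (s j); first exact: measurable_grid_bit.
have -> : [set p | grid_bit p j = false]%classic = (~` [set p | grid_bit p j])%classic.
  by apply/seteqP; split=> p /=; [move=> ->|move=> /negP/negbTE].
by apply: measurableC; apply: measurable_grid_bit.
Qed.

Lemma threshold_between x x' : - B <= x -> x' <= B -> x + del < x' ->
  exists i : 'I_M.+1, x < threshold i <= x'.
Proof.
move=> xB x'B xx'; have X0 : 0 <= (x + B) / del by rewrite divr_ge0 ?(ltW del_gt0) // -lerBlDr sub0r.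
have /andP[t1 t2] := truncn_itv X0; set i := Num.truncn _ in t1 t2.
have h1 : x < threshold i.+1.
  by rewrite /threshold ltrBrDr mulrC -ltr_pdivrMr.
have h2 : threshold i.+1 <= x + del.
  have := t1; rewrite ler_pdivlMr // /threshold -natr1; lra.
have iM : (i.+1 < M.+1)%N.
  rewrite ltnS -(ler_nat R) -(ler_pM2r del_gt0); apply: le_trans grid_covers.
  have := h2; rewrite /threshold; lra.
by exists (Ordinal iM); rewrite /= h1 /= ltW // (le_lt_trans h2).
Qed.

Lemma grid_close x x' : - B <= x <= B -> - B <= x' <= B ->
  (forall i : 'I_M.+1, (x < threshold i) = (x' < threshold i)) -> `|x - x'| <= del.
Proof.
move=> /andP[x1 x2] /andP[y1 y2] h; rewrite ler_distl lerBlDr; apply/andP; split; rewrite leNgt; apply/negP.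
  move=> lt; have [i /andP[a b]] := threshold_between x1 y2 lt.
  by move: (h i); rewrite a ltNge b.
move=> lt; have [i /andP[a b]] := threshold_between y1 x2 lt.
by move: (h i); rewrite a ltNge b.
Qed.

Local Open Scope complex_scope.

Definition cx (p : R * R) : R[i] := p.1 +i* p.2.

Lemma nrm_cx p : ~~ overflow p -> nrm (cx p) <= B.
Proof.
rewrite /overflow -leNgt nrmE /= => h.
by rewrite -(ger0_norm (ltW B_gt0)) -sqrtr_sqr ler_wsqrtr.
Qed.

Lemma coord_le p : ~~ overflow p -> (- B <= p.1 <= B) /\ (- B <= p.2 <= B).
Proof.
move=> /nrm_cx h; rewrite -!ler_norml.
by have [h1 h2] := abs_le_nrm (cx p); split; [apply: le_trans h1 h|apply: le_trans h2 h].
Qed.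

(* An arbitrary non-overflowing point of the cell, or 0 if there is none. *)
Definition grid_val (s : {ffun option (bool * 'I_M.+1) -> bool}) : R[i] :=
  cx (xget (0, 0) [set p | grid_code p = s /\ ~~ overflow p]%classic).

Lemma not_overflow0 : ~~ overflow (0, 0).
Proof. by rewrite /overflow /= expr0n addr0 -leNgt sqr_ge0. Qed.

Lemma nrm_grid_val s : nrm (grid_val s) <= B.
Proof.
rewrite /grid_val; case: xgetP => [p -> [_ h]|_]; apply: nrm_cx => //.
exact: not_overflow0.
Qed.

Lemma grid_val_close p : ~~ overflow p -> nrm (cx p - grid_val (grid_code p)) <= 2 * del.
Proof.
move=> np; rewrite /grid_val; case: xgetP => [p' -> [/ffunP e np']|/(_ p) []//].
have [x1 x2] := coord_le np; have [y1 y2] := coord_le np'.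
apply: le_trans (nrm_le_abs _) _; rewrite /= (_ : 2 * del = del + del); last by rewrite mulrDl mul1r.
apply: lerD; apply: grid_close => // i.
  by have := e (Some (true, i)); rewrite !ffunE.
by have := e (Some (false, i)); rewrite !ffunE.
Qed.

End Grid.

Lemma sqrtr_le_self (R : realType) (x : R) : 1 <= x -> Num.sqrt x <= x.
Proof.
move=> x1; have x0 : 0 <= x := le_trans ler01 x1.
by rewrite -[leRHS](ger0_norm x0) -sqrtr_sqr ler_wsqrtr // expr2 ler_peMl.
Qed.

(** Between the exponents [25 m] and [24 m] lies a factor [cn^m], at least [cn^3]. It pays for the
    normalization [sqrt cn], the dimension [m b <= cn^2 / 9] and the factor 2. *)
Lemma residual_budget (R : realType) (m b : nat) : (3 <= m)%N -> (m <= b)%N ->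
  let cn : R := (3 * b)%:R in
  Num.sqrt cn * cn ^- (25 * m) * (m * b)%:R <= cn ^- (24 * m) / 2.
Proof.
move=> m3 mb; cbv zeta; set cn : R := (3 * b)%:R; have b3 := leq_trans m3 mb.
have cn1 : 1 <= cn by rewrite ler1n muln_gt0 /= (leq_trans _ b3).
have cn0 : 0 < cn := lt_le_trans ltr01 cn1.
have t0 : 0 < cn ^- (24 * m) by rewrite invr_gt0 exprn_gt0.
have -> : cn ^- (25 * m) = cn ^- (24 * m) / cn ^+ m.
  by rewrite -invfM -exprD; congr (_ ^- _); rewrite (mulnDl 24 1) mul1n.
have N9 : (m * b)%:R <= cn ^+ 2 / 9.
  rewrite ler_pdivlMr // -natrX -natrM ler_nat.
  have : (m * b <= b * b)%N by rewrite leq_mul2r mb orbT.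
  by move=> h; rewrite (expnMn 3 b 2) mulnC leq_mul2l /= -mulnn.
rewrite mulrCA -mulrA ler_wpM2l ?(ltW t0) // mulrAC ler_pdivrMr ?exprn_gt0 //.
apply: (@le_trans _ _ (cn * (cn ^+ 2 / 9))).
  by apply: ler_pM; rewrite ?sqrtr_ge0 ?ler0n ?sqrtr_le_self.
apply: (@le_trans _ _ (2^-1 * cn ^+ 3)); last by rewrite ler_wpM2l ?invr_ge0 // ler_weXn2l.
have c3 : 0 < cn ^+ 3 by rewrite exprn_gt0.
rewrite mulrA -exprS; move: c3; clear; lra.
Qed.

Lemma cmeas_block_band (d : measure_display) (T : measurableType d) (R : realType) (m b : nat)
    (xr xi : 'I_3 * 'I_m * 'I_b * 'I_b -> T -> R) (a z : R[i]) :
  (forall k, measurable_fun setT (xr k)) -> (forall k, measurable_fun setT (xi k)) ->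
  forall p q, cmeas (fun w => (a *: pbb_matrix xr xi w - z%:M) p q).
Proof.
move=> mr mi p q.
have entry k : cmeas (fun w => (xr k w +i* xi k w)%C) by split; [apply: mr|apply: mi].
have h : cmeas (fun w => pbb_matrix xr xi w p q).
  case e1 : (q %/ b == p %/ b)%N.
    by under eq_fun do rewrite mxE /= e1 mxE.
  case e2 : ((q %/ b).+1 %% m == p %/ b)%N.
    by under eq_fun do rewrite mxE /= e1 e2 mxE.
  case e3 : (q %/ b == (p %/ b).+1 %% m)%N.
    by under eq_fun do rewrite mxE /= e1 e2 e3 mxE.
  by under eq_fun do rewrite mxE /= e1 e2 e3; apply: cmeas_cst.
apply: (cmeas_ext (f := fun w => a * pbb_matrix xr xi w p q + - (z%:M : 'M[R[i]]_(m * b)) p q)).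
  by move=> w; rewrite !mxE.
by apply: cmeasD (cmeas_cst _ _); apply: cmeasM h; apply: cmeas_cst.
Qed.

(** * From the random matrix to the finite model *)

Section Reduction.
Variables (R : realType) (eps K' C C' : R) (l b : nat).
Local Notation m := l.+3.
Local Notation I := ('I_3 * 'I_m * 'I_b * 'I_b)%type.
Let K := Num.max 1 (8 * C).
Local Notation cn := ((3 * b)%:R : R).
Hypotheses (eps_gt0 : 0 < eps) (C_gt0 : 0 < C) (K'_gt0 : 0 < K').
Hypothesis mb : (m <= b)%N.
Hypothesis b_tail : 8 * K * C + 1 <= b%:R.
Hypothesis b_shift : 3 * K' ^+ 2 <= b%:R.
Hypothesis finite_bound : forall (S : finType) (mu : S -> R) (val : S -> R[i]) (zeta : R[i]),
  (forall s, 0 <= mu s) -> \sum_s mu s = 1 ->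
  (forall z, \sum_s mu s * (nrm (val s - z) < 1 / 4)%R%:R <= 1 - (8 * K)^-1) ->
  (forall x, nrm (val x) <= 3 * b%:R) -> (forall x, nrm (val x - zeta) <= 3 * b%:R) ->
  pr mu (periodic_bad (l := l) (b := b) val (cn ^- (24 * m)) zeta) <= C' / Num.sqrt b%:R.

Variables (d : measure_display) (T : measurableType d) (P : probability T R).
Variables xr xi : I -> T -> R.
Hypothesis mY : forall k, measurable_fun setT (cpair xr xi k).
Hypothesis indep : mutually_independent P (cpair xr xi).
Hypothesis ident : identically_distributed P (cpair xr xi).
Hypothesis mean0 : forall k, (\int[P]_w (xr k w)%:E = 0)%E /\ (\int[P]_w (xi k w)%:E = 0)%E.
Hypothesis var1 : forall k, (\int[P]_w ((xr k w) ^+ 2 + (xi k w) ^+ 2)%:E = 1)%E.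
Hypothesis mom : forall k,
  (\int[P]_w ((Num.sqrt ((xr k w) ^+ 2 + (xi k w) ^+ 2)) `^ (4 + eps))%:E <= C%:E)%E.

Lemma band_prob (z : R[i]) : nrm z <= K' ->
  (P [set w | (sing_val (((Num.sqrt cn)%:C%C)^-1 *: pbb_matrix xr xi w - z%:M) (m * b)
       <= cn ^- (25 * m))%R]%classic <= ((C' + 3 * C) / Num.sqrt b%:R)%:E)%E.
Proof.
move=> zK.
have b3 : (3 <= b)%N := leq_trans (isT : 2 < l.+3)%N mb.
have b0 : (0 < b)%N by apply: leq_trans b3.
set B : R := b%:R; have B1 : 1 <= B by rewrite ler1n.
have B0 : 0 < B by apply: lt_le_trans B1.
have K1 : 1 <= K by rewrite le_max lexx.
have K0 : 0 < K by apply: lt_le_trans K1.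
have mr k : measurable_fun setT (xr k).
  exact: (measurableT_comp measurable_fst (mY k)).
have mi k : measurable_fun setT (xi k).
  exact: (measurableT_comp measurable_snd (mY k)).
set tau : R := cn ^- (24 * m); set t : R := cn ^- (25 * m).
have cn0 : 0 < cn by rewrite ltr0n muln_gt0.
have tau0 : 0 < tau by rewrite invr_gt0 exprn_gt0.
have t0 : 0 <= t by rewrite invr_ge0 exprn_ge0 // ltW.
set c := Num.sqrt cn; have c0 : 0 < c by rewrite sqrtr_gt0.
set N : R := (m * b)%:R; have N0 : 0 < N by rewrite ltr0n muln_gt0.
(* The bound [1/8] enlarges the radius [1/4] for the coded atom to at most the [1/2] of
   [small_ball]; the other bound keeps the discretization error below [tau / 2]. *)
pose del : R := Num.min (1 / 8) (tau / (12 * N)).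
have del0 : 0 < del by rewrite lt_min divr_gt0 //= divr_gt0 // mulr_gt0.
have del8 : del <= 1 / 8 by rewrite ge_min lexx.
have delN : 3 * (2 * del) * N <= tau / 2.
  have : del <= tau / (12 * N) by rewrite ge_min lexx orbT.
  by rewrite ler_pdivlMr ?mulr_gt0 //; lra.
pose M := (Num.truncn (2 * B / del)).+1.
have cover : 2 * B <= M%:R * del.
  by rewrite -ler_pdivrMr // ltW // truncnS_gt.
pose k0 : I := (ord0, ord0, Ordinal b0, Ordinal b0).
pose code := grid_code B del M; pose val := @grid_val R B del M.
have mcode s : measurable (code @^-1` [set s])%classic by apply: measurable_grid_code.
pose Y := cpair xr xi; pose mu := cell_prob P Y code k0.
pose zeta : R[i] := c%:C%C * z.
have mu0 s : 0 <= mu s by apply: cell_prob_ge0.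
have mu1 : \sum_s mu s = 1 by apply: cell_prob_sum1.
have tail k : (P [set w | overflow B (Y k w)]%classic <= (C / B ^+ 4)%:E)%E.
  exact: (tail_le eps_gt0 (mr k) (mi k) (mom k) B1).
have mover k : measurable [set w | overflow B (Y k w)]%classic.
  rewrite -[X in measurable X]setTI; exact: (mY k measurableT (measurable_overflow B)).
(* The mass [1/(4K)] outside a disc is split: half is given up to overflow, which leaves [1/(8K)]
   for the coded atom. *)
have tailK : C / B ^+ 4 <= (8 * K)^-1.
  rewrite ler_pdivrMr ?exprn_gt0 // mulrC ler_pdivlMr ?mulr_gt0 // mulrC.
  apply: (@le_trans _ _ B); last by rewrite -[leLHS]expr1 ler_weXn2l.
  by apply: le_trans b_tail; rewrite lerDl.
have spread z0 : \sum_s mu s * (nrm (val s - z0) < 1 / 4)%R%:R <= 1 - (8 * K)^-1.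
  have := prob_code mY ident k0 mcode (fun s => nrm (val s - z0) < 1 / 4).
  move=> e; rewrite -lee_fin -e.
  set A := [set w | _]%classic.
  pose A1 := [set w | (xr k0 w - complex.Re z0) ^+ 2 + (xi k0 w - complex.Im z0) ^+ 2 <= 1 / 4]%classic.
  have mA1 : measurable A1.
    rewrite -[A1]setTI; have -> : A1 =
      ((fun w => (xr k0 w - complex.Re z0) ^+ 2 + (xi k0 w - complex.Im z0) ^+ 2)
        @^-1` `]-oo, (1/4)%R])%classic.
      by apply/seteqP; split=> w /=; rewrite in_itv.
    apply: measurable_funD => //; try exact: measurable_itv;
      by apply: measurable_funX; apply: measurable_funB.
  have sub : (A `<=` A1 `|` [set w | overflow B (Y k0 w)])%classic.
    move=> w /= h; have [ov|no] := boolP (overflow B (Y k0 w)); [by right|left].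
    have close : nrm (cx (Y k0 w) - val (code (Y k0 w))) <= 2 * del := grid_val_close B0 del0 cover no.
    have {}h : nrm (val (code (Y k0 w)) - z0) < 1 / 4 := h.
    have : nrm (cx (Y k0 w) - z0) <= 1 / 2.
      apply: le_trans (_ : _ <= nrm (cx (Y k0 w) - val (code (Y k0 w))) + nrm (val (code (Y k0 w)) - z0)) _.
        by apply: le_trans (nrmD _ _); rewrite addrA subrK.
      by move: close h del8; lra.
    move=> h1; have h12 : 0 <= 1 / 2 :> R by rewrite divr_ge0.
    have : nrm (cx (Y k0 w) - z0) ^+ 2 <= (1 / 2) ^+ 2 by rewrite lerXn2r ?nnegrE ?nrm_ge0.
    rewrite nrmE sqr_sqrtr ?addr_ge0 ?sqr_ge0 //.
    have -> : (1 / 2) ^+ 2 = 1 / 4 :> R by field.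
    by rewrite !raddfB; exact.
  apply: le_trans (_ : _ <= P A1 + P [set w | overflow B (Y k0 w)]%classic)%E _.
    apply: le_trans (measureU2 _ mA1 (mover k0)); apply: le_measure; rewrite ?inE //.
      exact: (measurable_fibers (F := code \o Y k0) (fun s => nrm (val s - z0) < 1 / 4)
               (fun s => measurable_cell mY mcode k0 s)).
    exact: measurableU.
  have sb := small_ball eps_gt0 (mr k0) (mi k0) (mean0 k0).1 (mean0 k0).2 (var1 k0) (mom k0)
    (complex.Re z0) (complex.Im z0).
  apply: le_trans (leeD sb (tail k0)) _; rewrite -EFinD lee_fin.
  have -> : (4 * K)^-1 = (8 * K)^-1 + (8 * K)^-1 by field; rewrite gt_eqF.
  by move: tailK; lra.
have zetaB : nrm zeta <= B.
  rewrite nrmM (nrm_real (ltW c0)) -(ger0_norm (ltW B0)) -sqrtr_sqr.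
  apply: (@le_trans _ _ (c * K')); first by rewrite ler_wpM2l // ltW.
  rewrite -[K'](ger0_norm (ltW K'_gt0)) -sqrtr_sqr -sqrtrM ?(ltW cn0) // ler_wsqrtr //.
  by rewrite natrM mulrAC expr2 ler_wpM2r // ltW.
have valB s : nrm (val s) <= B by apply: nrm_grid_val.
have B3 : B <= 3 * B by move: B0; lra.
have valz s : nrm (val s - zeta) <= 3 * B.
  by apply: le_trans (nrmB _ _) _; have := valB s; move: zetaB B0; lra.
have fin := finite_bound mu0 mu1 spread (fun s => le_trans (valB s) B3) valz.
have [mbad Pbad] := prob_code_all mY indep ident k0 mcode (periodic_bad (l := l) (b := b) val tau zeta).
set E := [set w | _]%classic.
have mE : measurable E.
  apply: measurable_sing_val_le => //; first by rewrite muln_gt0.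
  exact: cmeas_block_band.
set bad := [set w | _]%classic in mbad Pbad.
pose over := [set w | exists k, overflow B (Y k w)]%classic.
have mo : measurable over.
  rewrite (_ : over = \bigcup_(k in [set: I]) [set w | overflow B (Y k w)])%classic.
    by apply: fin_bigcup_measurable => // k _.
  by apply/seteqP; split=> w /=; [move=> [k h]; exists k|move=> [k _ h]; exists k].
have sub : (E `<=` bad `|` over)%classic.
  move=> w /= sE; have [ov|no] := pselect (over w); [by right|left].
  apply: (@sing_val_periodic_bad R l b _ val zeta (fun k => cx (Y k w)) _ c t (2 * del) tau z) => //.
    move=> k; rewrite ffunE; apply: grid_val_close => //.
    by apply/negP => o; apply: no; exists k.
  apply: le_trans (_ : _ <= tau / 2 + tau / 2) _; last by rewrite -splitr.
  by apply: lerD => //; apply: residual_budget.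
apply: le_trans (_ : _ <= P bad + P over)%E _.
  by apply: le_trans (measureU2 _ mbad mo); apply: le_measure; rewrite ?inE //; apply: measurableU.
have ov := union_bound mover tail.
apply: le_trans (leeD (_ : _ <= (C' / Num.sqrt B)%:E)%E ov) _; first by rewrite Pbad lee_fin.
rewrite -EFinD lee_fin mulrDl lerD2l.
(* There are [3 m b^2 <= 3 b^3] entries, each overflowing with probability at most [C / b^4]. *)
rewrite !card_prod !card_ord !natrM -/B.
have mB : m%:R <= B by rewrite ler_nat.
apply: (@le_trans _ _ (3 * C / B)).
  have -> : 3 * C / B = 3 * B * B * B * (C / B ^+ 4) by field; rewrite gt_eqF.
  apply: ler_wpM2r; first by apply: divr_ge0; rewrite ?exprn_ge0 //; exact: ltW.
  by do 2!(apply: ler_wpM2r; first exact: ltW); rewrite ler_wpM2l.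
apply: ler_wpM2l; first by apply: mulr_ge0 => //; exact: ltW.
by rewrite lef_pV2 ?posrE ?sqrtr_gt0 // sqrtr_le_self.
Qed.

End Reduction.

Local Open Scope classical_set_scope.
Local Open Scope ring_scope.

Theorem theorem2p1 (R : realType) (eps K' C : R) :
  0 < eps -> 0 < K' -> 0 < C ->
  exists (m0 : nat) (Cxi : R),
  forall (d : measure_display) (T : measurableType d) (P : probability T R)
    (m b : nat) (xr xi : 'I_3 * 'I_m * 'I_b * 'I_b -> T -> R),
    (* each entry is a (complex) random variable *)
    (forall k, measurable_fun setT (cpair xr xi k)) ->
    (* the 3m * b^2 entries are independent ... *)
    mutually_independent P (cpair xr xi) ->
    (* ... and identically distributed (as the atom variable xi) *)
    identically_distributed P (cpair xr xi) ->
    (* E xi = 0 *)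
    (forall k, (\int[P]_w (xr k w)%:E = 0)%E /\ (\int[P]_w (xi k w)%:E = 0)%E) ->
    (* E |xi|^2 = 1 *)
    (forall k, (\int[P]_w ((xr k w) ^+ 2 + (xi k w) ^+ 2)%:E = 1)%E) ->
    (* E |xi|^(4+eps) <= C *)
    (forall k, (\int[P]_w ((Num.sqrt ((xr k w) ^+ 2 + (xi k w) ^+ 2)) `^ (4 + eps))%:E
                <= C%:E)%E) ->
    (* b_n >= m >= m0 *)
    (m0 <= m)%N -> (m <= b)%N ->
    forall z : R[i], `|z| <= K'%:C%C ->
    let cn : R := (3 * b)%:R in
    (P [set w | (sing_val
                  (((Num.sqrt cn)%:C%C)^-1 *: pbb_matrix xr xi w - z%:M) (m * b)
                <= cn ^- (25 * m))%R]
      <= (Cxi / Num.sqrt cn)%:E)%E.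
Proof.
move=> eps_gt0 K'_gt0 C_gt0; pose K : R := Num.max 1 (8 * C).
have K1 : 1 <= K by rewrite le_max lexx.
have K0 : 0 < K by apply: lt_le_trans K1.
have c0P : 0 < (1 / 4 : R) <= 1 by rewrite divr_gt0 //= ler_pdivrMr // mul1r ler1n.
have c1P : 0 < (8 * K)^-1 <= 1.
  by rewrite invr_gt0 mulr_gt0 //= invf_le1 ?mulr_gt0 // mulr_ege1 // ler1n.
have [m1 [C' fin]] := periodic_prob_small c0P c1P.
pose D := 8 * K * C + 1 + 3 * K' ^+ 2.
(* [b >= D] makes overflow rare enough and gives [|zeta| <= b]; the factor [sqrt 3] converts
   [sqrt b] into [sqrt cn]. *)
exists (maxn m1 (maxn 3 (Num.truncn D).+1)), ((C' + 3 * C) * Num.sqrt 3).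
move=> d T P m b xr xi mY indep ident mean0 var1 mom.
rewrite !geq_max => /andP[mm1 /andP[m3 mD]] mb z zK; cbv zeta; set cn : R := (3 * b)%:R.
move: @cn; case: m m3 mm1 mD mb xr xi mY indep ident mean0 var1 mom => [|[|[|l]]] // _ lm1 lD lb xr xi.
move=> mY indep ident mean0 var1 mom cn.
have bD : D <= b%:R by apply: le_trans (ltW (truncnS_gt D)) _; rewrite ler_nat (leq_trans lD).
have q1 : 0 <= 8 * K * C by rewrite !mulr_ge0 // ltW.
have q2 : 0 <= 3 * K' ^+ 2 by rewrite mulr_ge0 ?sqr_ge0.
have b1 : 8 * K * C + 1 <= b%:R by apply: le_trans bD; rewrite lerDl.
have b2 : 3 * K' ^+ 2 <= b%:R by apply: le_trans bD; rewrite lerDr addr_ge0.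
have nz : nrm z <= K'.
  move: zK; rewrite -(nrm_real (ltW K'_gt0)) => zK.
  by rewrite -lecR.
have e : (C' + 3 * C) * Num.sqrt 3 / Num.sqrt cn = (C' + 3 * C) / Num.sqrt b%:R.
  have s3 : Num.sqrt 3 != 0 :> R by rewrite gt_eqF // sqrtr_gt0.
  by rewrite /cn natrM sqrtrM // invfM mulrA mulfK.
rewrite e; apply: (band_prob (eps := eps) (K' := K')) => //.
by move=> S mu val zeta *; apply: fin.
Qed.
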